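(* For any $\alpha\ge2$ and $F_t\in\mathbb G_t^{[\alpha]}\langle\langle z\rangle\rangle$, let $\mathcal D^{[\alpha]}\langle z\rangle^*$ be the graded dual of the graded $K$-Hopf algebra $\mathcal D^{[\alpha]}\langle z\rangle$. Then the graded dual map $$\mathcal S_{F_t}^*:\mathcal D^{[\alpha]}\langle z\rangle^*\to\mathcal Q\mathrm{Sym}$$ of $\mathcal S_{F_t}:\mathcal N\mathrm{Sym}\to\mathcal D^{[\alpha]}\langle z\rangle$ is a homomorphism of graded $K$-Hopf algebras.
   Context: Setup. $K$ is a unital commutative $\mathbb Q$-algebra, $z=(z_1,\dots,z_n)$ ($n\ge 1$) are independent variables, either commutative or noncommutative (free); statements hold in both cases and the same notation is used for both. $t$ is a formal parameter commuting with everything. $K\langle z\rangle$ is the polynomial algebra in $z$ over $K$; $K\langle\langle z\rangle\rangle$ and $K[[t]]\langle\langle z\rangle\rangle$ are the formal power series algebras in $z$ over $K$ and $K[[t]]$. $o(u)$ is the lowest degree in $z$ of the monomials occurring in $u$ (for a vector, the minimum over its components). $\mathcal Der^{[\alpha]}\langle\langle z\rangle\rangle$ is the set of $K$-derivations of $K\langle\langle z\rangle\rangle$ that increase the degree in $z$ by at least $\alpha-1$ (i.e. those sending each $z_i$ to some $u_i$ with $o(u_i)\ge\alpha$), and $\mathcal D^{[\alpha]}\langle\langle z\rangle\rangle$ is the unital subalgebra of $\mathrm{End}_K(K\langle\langle z\rangle\rangle)$ generated by $\mathcal Der^{[\alpha]}\langle\langle z\rangle\rangle$. $\mathcal D\langle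 z\rangle$ is the unital subalgebra of $\mathrm{End}_K(K\langle z\rangle)$ generated by all $K$-derivations of $K\langle z\rangle$, and $\mathcal D^{[\alpha]}\langle z\rangle:=\mathcal D\langle z\rangle\cap\mathcal D^{[\alpha]}\langle\langle z\rangle\rangle$. Hopf structure on differential operators (the paper's convention): the algebra generated by derivations is identified with the universal enveloping algebra of the Lie algebra of derivations, and carries the corresponding $K$-Hopf algebra structure, determined on derivations $\delta$ by $\Delta(\delta)=1\otimes\delta+\delta\otimes1$, $S(\delta)=-\delta$, $\epsilon(\delta)=\delta\cdot1$ $(=0)$. Gradings. For $m\ge0$, $\mathcal D_{[m]}\langle z\rangle$ is the set of $U\in\mathcal D\langle z\rangle$ such that for every homogeneous polynomial $h(z)$ of degree $d\ge0$, $Uh(z)$ is zero or homogeneous of degree $m+d$. $\mathcal D^{[\alpha]}\langle z\rangle$ is graded with degree-$m$ component $\mathcal D_{[m]}\langle z\rangle\cap\mathcal D^{[\alpha]}\langle z\rangle$ (scalars in degree $0$). $\mathcal N\mathrm{Sym}=K\langle\Lambda\rangle$ is the free associative $K$-algebra on $\Lambda_m$ ($m\ge1$), graded by giving $\Lambda_m$ weight $m$; it is a graded $K$-Hopf algebra in which, with $\Lambda_0=1$, $\lambda(t)=\sum_{m\ge0}t^m\Lambda_m$, $\sigma(t)=\lambda(-t)^{-1}$ and $\Psi_m$ defined by $\frac{d\sigma(t)}{dt}=\sigma(t)\sum_{m\ge1}t^{m-1}\Psi_m$, each $\Psi_m$ is primitive ($\Delta(\Psi_m)=1\otimes\Psi_m+\Psi_m\otimes1$,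 $\epsilon(\Psi_m)=0$, $S(\Psi_m)=-\Psi_m$). $\mathcal Q\mathrm{Sym}$, the Hopf algebra of quasi-symmetric functions over $K$, is the graded dual of $\mathcal N\mathrm{Sym}$. Automorphisms. $\mathbb A_t^{[\alpha]}\langle\langle z\rangle\rangle$ is the set of automorphisms $F_t(z)=z-H_t(z)$ of $K[[t]]\langle\langle z\rangle\rangle$ over $K[[t]]$ with $H_t(z)\in K[[t]]\langle\langle z\rangle\rangle^{\times n}$, $o(H_t(z))\ge\alpha$ and $H_{t=0}(z)=0$. $\mathbb G_t^{[\alpha]}\langle\langle z\rangle\rangle$ (for $\alpha\ge2$) is the subgroup of those $F_t\in\mathbb A_t^{[\alpha]}\langle\langle z\rangle\rangle$ such that $F_t(z)=t^{-1}F(tz)$ for some automorphism $F(z)$ of $K\langle\langle z\rangle\rangle$. Specialization. For $F_t\in\mathbb A_t^{[\alpha]}\langle\langle z\rangle\rangle$, let $\lambda_m\in\mathcal D^{[\alpha]}\langle\langle z\rangle\rangle$ ($m\ge0$, $\lambda_0=1$) be the unique sequence such that $\big(\sum_{m\ge0}(-1)^mt^m\lambda_m\big)u_t(z)=u_t(F_t(z))$ for all $u_t\in K[[t]]\langle\langle z\rangle\rangle$. $\mathcal S_{F_t}:\mathcal N\mathrm{Sym}\to\mathcal D^{[\alpha]}\langle\langle z\rangle\rangle$ is the unique $K$-algebra homomorphism with $\mathcal S_{F_t}(\Lambda_m)=\lambda_m$ for all $m\ge1$ (it is a $K$-Hopf algebra homomorphism); for $F_t\in\mathbb G_t^{[\alpha]}\langle\langle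 z\rangle\rangle$ it takes values in $\mathcal D^{[\alpha]}\langle z\rangle$ and preserves the gradings.
   Formalization: The algebra D^[α]⟨z⟩ is taken to be the enveloping algebra of the derivations, graded by products of homogeneous derivations, since for commuting z the Hopf structure is not well defined on operators; the λ_m are lifted there as coefficients of an exponential of derivations. *)

(* Defs.v *)
From HB Require Import structures.
From Stdlib Require Import ClassicalEpsilon.
From mathcomp Require Import all_boot all_algebra.
From mathcomp Require Import boolp functions.
From mathcomp Require Import finmap monalg.

Set Implicit Arguments.
Unset Strict Implicit.
Unset Printing Implicit Defensive.

Import GRing.Theory.
Local Open Scope ring_scope.

(* A[[t]], with t commuting with A: [f : pser A] stands for sum_m t^m f(m). *)
Record pser (A : Type) := PSer { pcoef :> nat -> A }.

Notation "\pser_ ( m ) E" := (PSer (fun m => E))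
  (at level 36, m name, E at level 36, format "\pser_ ( m )  E") : ring_scope.

Lemma pserP (A : Type) (f g : pser A) : f =1 g -> f = g.
Proof. by case: f g => [f] [g] /funext /= ->. Qed.

HB.instance Definition _ (A : Type) := [isNew for @pcoef A].
HB.instance Definition _ (A : choiceType) := [Choice of pser A by <:].

Section PSerZmod.
Variable A : zmodType.

Let pser_add (f g : pser A) := \pser_(m) (f m + g m).
Let pser_opp (f : pser A) := \pser_(m) (- f m).
Let pser_zero := \pser_(_) (0 : A).

Let pser_addA : associative pser_add.
Proof. by move=> f g h; apply: pserP => m; apply: addrA. Qed.
Let pser_addC : commutative pser_add.
Proof. by move=> f g; apply: pserP => m; apply: addrC. Qed.
Let pser_add0 : left_id pser_zero pser_add.
Proof. by move=> f; apply: pserP => m; apply: add0r. Qed.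
Let pser_addN : left_inverse pser_zero pser_opp pser_add.
Proof. by move=> f; apply: pserP => m; apply: addNr. Qed.

HB.instance Definition _ :=
  GRing.isZmodule.Build (pser A) pser_addA pser_addC pser_add0 pser_addN.

End PSerZmod.

Section PSerLmod.
Variables (R : pzRingType) (A : lmodType R).

Let pser_scale (c : R) (f : pser A) := \pser_(m) (c *: f m).

Let pser_scaleA a b f : pser_scale a (pser_scale b f) = pser_scale (a * b) f.
Proof. by apply: pserP => m; apply: scalerA. Qed.
Let pser_scale1 : left_id 1 pser_scale.
Proof. by move=> f; apply: pserP => m; apply: scale1r. Qed.
Let pser_scaleDr : right_distributive pser_scale +%R.
Proof. by move=> c f g; apply: pserP => m; apply: scalerDr. Qed.
Let pser_scaleDl f : {morph pser_scale^~ f : a b / a + b}.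
Proof. by move=> a b; apply: pserP => m; apply: scalerDl. Qed.

HB.instance Definition _ := GRing.Zmodule_isLmodule.Build R (pser A)
  pser_scaleA pser_scale1 pser_scaleDr pser_scaleDl.

End PSerLmod.

Section PSerRing.
Variable A : nzRingType.
Implicit Types f g h : pser A.

Let pser_one : pser A := \pser_(m) (m == 0%N)%:R.
Let pser_mul f g : pser A := \pser_(m) \sum_(i < m.+1) f i * g (m - i)%N.

Let trunc N f : {poly A} := \poly_(i < N) f i.

Let pser_mulE N f g m : (m < N)%N -> pser_mul f g m = (trunc N f * trunc N g)`_m.
Proof.
move=> ltmN; rewrite coefM; apply: eq_bigr => i _.
by rewrite !coef_poly !(leq_ltn_trans _ ltmN) ?leq_subr // -ltnS.
Qed.

Let truncM N f g m : (m < N)%N ->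
  (trunc N (pser_mul f g))`_m = (trunc N f * trunc N g)`_m.
Proof. by move=> ltmN; rewrite coef_poly ltmN (pser_mulE _ _ ltmN). Qed.

Let pser_mulA : associative pser_mul.
Proof.
move=> f g h; apply: pserP => m; rewrite !(@pser_mulE m.+1) //.
transitivity (trunc m.+1 f * (trunc m.+1 g * trunc m.+1 h))`_m.
  rewrite coefM [RHS]coefM; apply: eq_bigr => i _; congr (_ * _).
  by rewrite truncM // ltnS leq_subr.
rewrite mulrA coefM [RHS]coefM; apply: eq_bigr => i _; congr (_ * _).
by rewrite truncM.
Qed.

Let pser_mul1l : left_id pser_one pser_mul.
Proof.
move=> f; apply: pserP => m /=; rewrite big_ord_recl /= subn0 mul1r.
by rewrite big1 ?addr0 // => i _; rewrite mul0r.
Qed.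

Let pser_mulr1 : right_id pser_one pser_mul.
Proof.
move=> f; apply: pserP => m /=; rewrite big_ord_recr /= subnn mulr1.
by rewrite big1 ?add0r // => i _; rewrite subn_eq0 leqNgt ltn_ord mulr0.
Qed.

Let pser_mulDl : left_distributive pser_mul +%R.
Proof.
move=> f g h; apply: pserP => m; rewrite -[RHS]big_split /=.
by apply: eq_bigr => i _; apply: mulrDl.
Qed.

Let pser_mulDr : right_distributive pser_mul +%R.
Proof.
move=> f g h; apply: pserP => m; rewrite -[RHS]big_split /=.
by apply: eq_bigr => i _; apply: mulrDr.
Qed.

Let pser_one_neq0 : pser_one != 0.
Proof.
by apply/eqP => /(congr1 (fun f : pser A => f 0)) /= /eqP; rewrite oner_eq0.
Qed.

HB.instance Definition _ := GRing.Zmodule_isNzRing.Build (pser A)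
  pser_mulA pser_mul1l pser_mulr1 pser_mulDl pser_mulDr pser_one_neq0.

End PSerRing.

Section PSerComRing.
Variable R : comNzRingType.

Let pser_mulC : commutative (@GRing.mul (pser R)).
Proof.
move=> f g; apply: pserP => m; rewrite [LHS](reindex_inj rev_ord_inj) /=.
by apply: eq_bigr => i _; rewrite mulrC subSS subKn // -ltnS.
Qed.

HB.instance Definition _ := GRing.PzRing_hasCommutativeMul.Build (pser R) pser_mulC.

End PSerComRing.

Section PSerLalg.
Variables (R : nzRingType) (A : lalgType R).

Let pser_scaleAl (c : R) (f g : pser A) : c *: (f * g) = (c *: f) * g.
Proof.
apply: pserP => m; rewrite [LHS]scaler_sumr.
by apply: eq_bigr => i _; rewrite scalerAl.
Qed.

HB.instance Definition _ := GRing.Lmodule_isLalgebra.Build R (pser A) pser_scaleAl.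

End PSerLalg.

Definition tvar (R : nzRingType) : pser R := \pser_(m) (m == 1%N)%:R.
Definition tconst (R : nzRingType) (c : R) : pser R := \pser_(m) (c *+ (m == 0%N)).
Definition pderiv (A : nzRingType) (f : pser A) : pser A :=
  \pser_(m) (f m.+1 *+ m.+1).

(* exp(a) for a with zero constant term: only the powers a^k with k <= m
   contribute to t^m. *)
Definition pexp (K : comAlgType rat) (A : lalgType K) (a : pser A) : pser A :=
  \pser_(m) \sum_(k < m.+1) ((k`!%:R^-1 : rat)%:A : K) *: (a ^+ k : pser A) m.

Inductive varkind := Commutative | Free.

Definition mono (k : varkind) (n : nat) : monomType :=
  match k with Commutative => {cmonom 'I_n} | Free => {fmonom 'I_n} end.

Definition mono_deg k n : mono k n -> nat :=
  match k with Commutative => @mdeg _ | Free => @fdeg _ end.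

Definition mono_var k n (i : 'I_n) : mono k n :=
  match k with Commutative => ucm i | Free => fmu i end.

Definition mono_letters k n : mono k n -> seq 'I_n :=
  match k with
  | Commutative =>
      fun m : {cmonom 'I_n} => flatten [seq nseq (m i) i | i <- enum 'I_n]
  | Free => fun m : {fmonom 'I_n} => m
  end.

Lemma mono_deg1 k n : mono_deg (@mone (mono k n)) = 0%N.
Proof. by case: k; [exact: mdeg1 | exact: fdeg1]. Qed.

Lemma mono_degM k n (m1 m2 : mono k n) :
  mono_deg (mmul m1 m2) = (mono_deg m1 + mono_deg m2)%N.
Proof. by case: k m1 m2 => m1 m2; [exact: mdegM | exact: fdegM]. Qed.

Definition pol (R : nzRingType) k n := {malg R[mono k n]}.
HB.instance Definition _ (R : nzRingType) k n := GRing.Lalgebra.on (pol R k n).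

Section Polynomials.
Variables (R : nzRingType) (k : varkind) (n : nat).
Implicit Types p q : pol R k n.

Definition zvar (i : 'I_n) : pol R k n := << mono_var k i >>.

Definition homog (d : nat) p : Prop := forall m, m \in msupp p -> mono_deg m = d.

Definition ord_ge (a : nat) p : Prop :=
  forall m, m \in msupp p -> (a <= mono_deg m)%N.

Definition hcomp (d : nat) p : pol R k n :=
  \sum_(m <- msupp p | mono_deg m == d) << p@_m *g m >>.

Definition peval (A : lalgType R) (F : 'I_n -> A) p : A :=
  \sum_(m <- msupp p) p@_m *: \prod_(i <- mono_letters m) F i.

Lemma homogP d p : homog d p <-> forall m, mono_deg m != d -> p@_m = 0.
Proof.
split=> hp m => [hm|]; last first.
  by rewrite -mcoeff_neq0 => hm; apply/eqP; apply: contraNT hm => h; rewrite hp.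
by apply/eqP; rewrite mcoeff_eq0; apply: contra hm => /hp/eqP.
Qed.

Lemma homog0 d : homog d 0.
Proof. by apply/homogP => m _; rewrite mcoeff0. Qed.

Lemma homogL d (c : R) p q : homog d p -> homog d q -> homog d (c *: p + q).
Proof.
move=> /homogP hp /homogP hq; apply/homogP => m hm.
by rewrite mcoeffD mcoeffZ hp // hq // mulr0 addr0.
Qed.

Lemma homogD d p q : homog d p -> homog d q -> homog d (p + q).
Proof. by move=> hp hq; rewrite -[p]scale1r; apply: homogL. Qed.

Lemma homog_sum d (I : Type) (r : seq I) (P : pred I) (f : I -> pol R k n) :
  (forall i, P i -> homog d (f i)) -> homog d (\sum_(i <- r | P i) f i).
Proof.
by move=> hf; apply: big_ind => //; [exact: homog0 | exact: homogD].
Qed.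

Lemma homogM d e p q : homog d p -> homog e q -> homog (d + e) (p * q).
Proof.
move=> hp hq m /(fsubsetP (@msuppM_incl _ _ p q)).
case/imfset2P => m1 m1p [m2 m2q ->].
by rewrite mono_degM (hp _ m1p) (hq _ m2q).
Qed.

Lemma homog1 : homog 0 1.
Proof.
apply/homogP => m; rewrite mcoeff1.
by case: (eqVneq m mone) => [->|//]; rewrite mono_deg1 eqxx.
Qed.

End Polynomials.

Definition pol_map (R S : nzRingType) k n (f : R -> S) (p : pol R k n) :
  pol S k n := \sum_(m <- msupp p) << f p@_m *g m >>.

(* R<<z>> is the product over d of the modules of homogeneous polynomials of
   degree d: a series u is the sequence of its homogeneous components u(d).
   It is a subalgebra of (R<z>)[[s]] via u |-> sum_d s^d u(d). *)
Section Series.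
Variables (R : nzRingType) (k : varkind) (n : nat).

Definition ser_pred : {pred pser (pol R k n)} :=
  fun u => `[< forall d, homog d (u d) >].

Lemma ser_subalg : subalg_closed ser_pred.
Proof.
split.
- by apply/asboolP => -[|d]; [exact: homog1 | exact: homog0].
- move=> c u v /asboolP hu /asboolP hv; apply/asboolP => d.
  exact: homogL.
move=> u v /asboolP hu /asboolP hv; apply/asboolP => d.
apply: homog_sum => i _; rewrite -[X in homog X](subnKC (n := d) (m := i)) ?leq_ord //.
exact: homogM.
Qed.

HB.instance Definition _ :=
  GRing.isSubalgClosed.Build R (pser (pol R k n)) ser_pred
    (GRing.subalg_closed_semi ser_subalg).

Record ser := Ser { ser_val :> pser (pol R k n); _ : ser_val \in ser_pred }.
HB.instance Definition _ := [isSub for ser_val].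
HB.instance Definition _ := [Choice of ser by <:].
HB.instance Definition _ := [SubChoice_isSubLalgebra of ser by <:].

End Series.

Section Substitution.
Variables (R : nzRingType) (k : varkind) (n : nat).
Implicit Types (u v : ser R k n) (F H : 'I_n -> ser R k n).

Definition ser_zvar_comp (i : 'I_n) : pser (pol R k n) :=
  \pser_(d) (zvar R k i *+ (d == 1%N)).

Lemma ser_zvar_subproof i : ser_zvar_comp i \in @ser_pred R k n.
Proof.
apply/asboolP => d /=; case: eqP => [->|_]; last exact: homog0.
move=> m /(fsubsetP msuppU_le); rewrite in_fset1 => /eqP ->.
by case: k; [exact: mdegU | exact: fdegU].
Qed.

Definition ser_zvar (i : 'I_n) : ser R k n := Ser (ser_zvar_subproof i).

(* o(u) >= a *)
Definition ser_ord_ge (a : nat) u : Prop := forall d, (d < a)%N -> u d = 0.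

(* u(F(z)), for F with zero constant terms: only the components u(d) with
   d <= e contribute to the component of degree e. *)
Definition subst_comp F u : pser (pol R k n) :=
  \pser_(e) \sum_(d < e.+1) (peval F (u d) : ser R k n) e.

Lemma subst_subproof F u : subst_comp F u \in @ser_pred R k n.
Proof.
apply/asboolP => e; apply: homog_sum => d _.
by case: (peval _ _) => f /= /asboolP.
Qed.

Definition subst F u : ser R k n := Ser (subst_subproof F u).

(* The endomorphism z_i |-> F_i(z) of R<<z>> is an automorphism. *)
Definition is_aut F : Prop := (forall i, F i 0%N = 0) /\ bijective (subst F).

End Substitution.

Section Automorphisms.
Variables (K : comNzRingType) (k : varkind) (n : nat).

(* K[[t]]<<z>> is [ser (pser K) k n]. *)
Definition At (a : nat) (Ft : 'I_n -> ser (pser K) k n) : Prop :=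
  is_aut Ft /\
  forall i, let H := ser_zvar (pser K) k i - Ft i in
    ser_ord_ge a H /\ forall d m, (H d)@_m 0%N = 0.

(* F_t(z) = t^-1 F(tz) is stated as t F_t(z) = F(tz), componentwise in z. *)
Definition Gt (a : nat) (Ft : 'I_n -> ser (pser K) k n) : Prop :=
  At a Ft /\
  exists2 F : 'I_n -> ser K k n, is_aut F &
    forall i d, tvar K *: Ft i d = tvar K ^+ d *: pol_map (@tconst K) (F i d).

End Automorphisms.

Section QuotientModule.
Variables (K : nzRingType) (V : lmodType K) (rel : V -> Prop).

Inductive span : V -> Prop :=
| span_gen x : rel x -> span x
| span_0 : span 0
| span_lin c x y : span x -> span y -> span (c *: x + y).

Definition span_pred : {pred V} := fun x => `[< span x >].

Lemma span_submod : submod_closed span_pred.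
Proof.
split; first by apply/asboolP; exact: span_0.
by move=> c x y /asboolP hx /asboolP hy; apply/asboolP; exact: span_lin.
Qed.

HB.instance Definition _ := GRing.isSubmodClosed.Build K V span_pred
  (GRing.submod_closed_semi span_submod).

(* The quotient of V by the submodule generated by rel. *)
Definition quotmod : Type := {ideal_quot span_pred}.
HB.instance Definition _ := GRing.Zmodule.on quotmod.

Definition to_quot (v : V) : quotmod := (\pi_{ideal_quot span_pred} v)%qT.
Definition of_quot (x : quotmod) : V := repr (x : {ideal_quot span_pred}).

Lemma of_quotK : cancel of_quot to_quot.
Proof. exact: reprK. Qed.

Lemma to_quotP (v w : V) : to_quot v = to_quot w <-> span (v - w).
Proof.
have := Quotient.idealrBE span_pred v w; split=> [/eqP h|h].
  by apply/asboolP; rewrite -[X in is_true X]/(v - w \in span_pred) H.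
by apply/eqP; rewrite -H; apply/asboolP.
Qed.

Lemma to_quotB : {morph to_quot : v w / v - w}.
Proof. exact: (raddfB (\pi_{ideal_quot span_pred})%qT). Qed.

Let quot_scale (c : K) (x : quotmod) : quotmod := to_quot (c *: of_quot x).

Let to_quotZ c v : quot_scale c (to_quot v) = to_quot (c *: v).
Proof.
apply/to_quotP; rewrite -scalerBr -[_ *: _]addr0.
by apply: span_lin span_0; apply/to_quotP; exact: of_quotK.
Qed.

Let to_quotD : {morph to_quot : v w / v + w}.
Proof. exact: (raddfD (\pi_{ideal_quot span_pred})%qT). Qed.

Let quot_scaleA a b x : quot_scale a (quot_scale b x) = quot_scale (a * b) x.
Proof. by rewrite -[x]of_quotK !to_quotZ scalerA. Qed.
Let quot_scale1 : left_id 1 quot_scale.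
Proof. by move=> x; rewrite -[x]of_quotK to_quotZ scale1r. Qed.
Let quot_scaleDr : right_distributive quot_scale +%R.
Proof.
move=> c x y; rewrite -[x]of_quotK -[y]of_quotK -to_quotD !to_quotZ -to_quotD.
by rewrite scalerDr.
Qed.
Let quot_scaleDl x : {morph quot_scale^~ x : a b / a + b}.
Proof.
by move=> a b; rewrite -[x]of_quotK !to_quotZ -to_quotD scalerDl.
Qed.

HB.instance Definition _ := GRing.Zmodule_isLmodule.Build K quotmod
  quot_scaleA quot_scale1 quot_scaleDr quot_scaleDl.

Lemma to_quot_linear : linear to_quot.
Proof. by move=> c v w; rewrite to_quotD -to_quotZ. Qed.

End QuotientModule.

Section Tensor.
Variables (K : nzRingType) (V W : lmodType K).

Notation free := {malg K[(V * W)%type]}.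

Inductive tens_rel : free -> Prop :=
| tens_rel_l c v v' w :
    tens_rel (<< (c *: v + v', w) >> - c *: << (v, w) >> - << (v', w) >>)
| tens_rel_r c v w w' :
    tens_rel (<< (v, c *: w + w') >> - c *: << (v, w) >> - << (v, w') >>).

Definition tens : Type := quotmod tens_rel.
HB.instance Definition _ := GRing.Lmodule.on tens.

Definition pure (v : V) (w : W) : tens := to_quot tens_rel << (v, w) >>.

(* The linear map on V (x) W induced by b; b is meant to be bilinear, in which
   case the chosen representative of x is irrelevant. *)
Definition tlift (Z : lmodType K) (b : V -> W -> Z) (x : tens) : Z :=
  let f := of_quot x in \sum_(p <- msupp f) f@_p *: b p.1 p.2.

End Tensor.

Definition tens_map (K : nzRingType) (V V' W W' : lmodType K)
    (f : V -> V') (g : W -> W') : tens V W -> tens V' W' :=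
  tlift (fun v w => pure (f v) (g w)).

Definition tens_mul (K : nzRingType) (A B : lalgType K) (x y : tens A B) :
    tens A B :=
  tlift (fun a b => tlift (fun a' b' => pure (a * a') (b * b')) y) x.

(* The operations of a graded Hopf algebra, without its laws: the laws of the
   instances below follow from the way the operations are specified. [hpiece m]
   is the component of degree m. *)
Record gr_hopf (K : nzRingType) := GrHopf {
  hsort :> lmodType K;
  hmul : hsort -> hsort -> hsort;
  hone : hsort;
  hcomul : hsort -> tens hsort hsort;
  hcounit : hsort -> K;
  hantipode : hsort -> hsort;
  hpiece : nat -> hsort -> Prop }.

Record gr_hopf_morphism (K : nzRingType) (A B : gr_hopf K) (f : A -> B) : Prop :=
  GrHopfMorphism {
    hmor_linear : linear f;
    hmor_mul : forall x y, f (hmul x y) = hmul (f x) (f y);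
    hmor_one : f (hone A) = hone B;
    hmor_comul : forall x, hcomul (f x) = tens_map f f (hcomul x);
    hmor_counit : forall x, hcounit (f x) = hcounit x;
    hmor_antipode : forall x, f (hantipode x) = hantipode (f x);
    hmor_piece : forall m x, hpiece m x -> hpiece m (f x) }.

Section GradedDual.
Variables (K : comNzRingType) (H : gr_hopf K).

(* The linear functionals vanishing on all components of large degree. *)
Definition in_gdual (f : H -> K^o) : Prop :=
  linear f /\ exists N, forall m x, (N <= m)%N -> hpiece m x -> f x = 0.

Definition gdual_pred : {pred H -> K^o} := fun f => `[< in_gdual f >].

Lemma gdual_submod : submod_closed gdual_pred.
Proof.
split.
  apply/asboolP; split; first by move=> c x y; rewrite scaler0 addr0.
  by exists 0%N.
move=> c f g /asboolP[lf [N hf]] /asboolP[lg [M hg]]; apply/asboolP.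
have fgE x : (c *: f + g) x = c *: f x + g x by [].
split.
  move=> a x y; rewrite !fgE lf lg !scalerDr !scalerA [c * a]mulrC.
  exact: addrACA.
exists (maxn N M) => m x; rewrite geq_max => /andP[leNm leMm] hx.
by rewrite fgE (hf m) // (hg m) // scaler0 addr0.
Qed.

HB.instance Definition _ := GRing.isSubmodClosed.Build K (H -> K^o) gdual_pred
  (GRing.submod_closed_semi gdual_submod).

Record gdual_type := GDual { gdual_val :> H -> K^o; _ : gdual_val \in gdual_pred }.
HB.instance Definition _ := [isSub for gdual_val].
HB.instance Definition _ := [Choice of gdual_type by <:].
HB.instance Definition _ := [SubChoice_isSubLmodule of gdual_type by <:].

(* The element of the graded dual given by f (0 if f does not belong to it). *)
Definition to_gdual (f : H -> K) : gdual_type := insubd 0 f.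

Definition tens_pairing (x : tens gdual_type gdual_type) (u v : H) : K :=
  tlift (fun f g : gdual_type => f u * g v : K^o) x.

(* The product is dual to the coproduct and vice versa: (f g)(u) =
   (f (x) g)(Delta u), and Delta f is the element of H^* (x) H^* that pairs
   with u (x) v to f(uv). *)
Definition gdual : gr_hopf K := {|
  hsort := gdual_type;
  hmul := fun f g =>
    to_gdual (fun u => tlift (fun v w => f v * g w : K^o) (hcomul u));
  hone := to_gdual (@hcounit K H);
  hcomul := fun f => epsilon (inhabits 0)
    (fun x => forall u v, tens_pairing x u v = f (hmul u v));
  hcounit := fun f => f (hone H);
  hantipode := fun f => to_gdual (fun u => f (hantipode u));
  hpiece := fun m f => forall j u, j != m -> hpiece j u -> f u = 0 |}.

End GradedDual.

Definition gdual_map (K : comNzRingType) (A B : gr_hopf K) (f : A -> B) :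
    gdual B -> gdual A :=
  fun g => to_gdual (fun x => (g : gdual_type B) (f x)).

Section PrimitivelyGenerated.
Variables (K : comNzRingType) (A : lalgType K) (prim : A -> Prop).

(* The coproduct and counit are algebra maps and the antipode is an algebra
   antimorphism, so when prim generates A these conditions determine them. *)
Record is_prim_hopf (D : A -> tens A A) (e : A -> K) (S : A -> A) : Prop := {
  prim_comul_linear : linear D;
  prim_comul_one : D 1 = pure 1 1;
  prim_comul_mul : forall x y, D (x * y) = tens_mul (D x) (D y);
  prim_comul_prim : forall x, prim x -> D x = pure 1 x + pure x 1;
  prim_counit_linear : linear (e : A -> K^o);
  prim_counit_one : e 1 = 1;
  prim_counit_mul : forall x y, e (x * y) = e x * e y;
  prim_counit_prim : forall x, prim x -> e x = 0;
  prim_antipode_linear : linear S;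
  prim_antipode_one : S 1 = 1;
  prim_antipode_mul : forall x y, S (x * y) = S y * S x;
  prim_antipode_prim : forall x, prim x -> S x = - x }.

Definition prim_hopf (piece : nat -> A -> Prop) : gr_hopf K :=
  let ops := epsilon
    (inhabits (fun _ : A => 0 : tens A A, fun _ : A => 0 : K, fun _ : A => 0 : A))
    (fun o => is_prim_hopf o.1.1 o.1.2 o.2) in
  {| hsort := A; hmul := *%R; hone := 1;
     hcomul := ops.1.1; hcounit := ops.1.2; hantipode := ops.2;
     hpiece := piece |}.

End PrimitivelyGenerated.

Section NSym.
Variable K : comNzRingType.

(* The free algebra on Lambda_1, Lambda_2, ...; Lambda_m is the letter m.-1. *)
Definition nsym := {malg K[{fmonom nat}]}.
HB.instance Definition _ := GRing.Lalgebra.on nsym.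

Definition Lam (m : nat) : nsym := if m is j.+1 then << fmu j >> else 1.

Definition nsym_piece (m : nat) (x : nsym) : Prop :=
  forall w : {fmonom nat}, w \in msupp x -> (\sum_(i <- w) i.+1)%N = m.

(* x is one of the Psi_m; psi(m) is Psi_{m+1}. *)
Definition is_Psi (x : nsym) : Prop :=
  exists sigma psi : pser nsym,
    let lambda_neg : pser nsym := \pser_(m) ((-1) ^+ m *: Lam m) in
    [/\ sigma * lambda_neg = 1, lambda_neg * sigma = 1,
        pderiv sigma = sigma * psi & exists m, x = psi m].

Definition NSym : gr_hopf K := prim_hopf is_Psi nsym_piece.

Definition QSym : gr_hopf K := gdual NSym.

End NSym.

Lemma malg_scaleAr (K : comNzRingType) (M : monomType) c (x y : {malg K[M]}) :
  c *: (x * y) = x * (c *: y).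
Proof.
rewrite (malgMEw (fsubset_refl (msupp x)) (@msuppZ_le _ _ c y)).
rewrite malgME scaler_sumr; apply: eq_bigr => w1 _.
rewrite scaler_sumr; apply: eq_bigr => w2 _.
by apply/malgP => w; rewrite mcoeffZ !mcoeffU mcoeffZ mulrnAr mulrCA.
Qed.

Lemma malg_augM (K : comNzRingType) (M : monomType) (x y : {malg K[M]}) :
  (x * y)@_mone = x@_mone * y@_mone.
Proof. exact: (rmorphM (mcoeff mone)). Qed.

Lemma malg_aug_bracket (K : comNzRingType) (M : monomType) (x y z : {malg K[M]}) :
  x@_mone = 0 -> z@_mone = 0 -> (x * y - y * x - z)@_mone = 0.
Proof. by move=> x0 z0; rewrite !mcoeffB z0 !malg_augM x0 mul0r mulr0 !subr0. Qed.

Section Ideal.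
Variables (K : comNzRingType) (A : lalgType K) (rel : A -> Prop).
Hypothesis scaleAr : forall (c : K) (x y : A), c *: (x * y) = x * (c *: y).

Definition ideal_gen (x : A) : Prop :=
  exists2 r, rel r & exists u v, x = u * r * v.

Lemma ideal_spanMl u x : span ideal_gen x -> span ideal_gen (u * x).
Proof.
elim=> {x} [_ [r hr [v [w ->]]]||c x y _ hx _ hy].
- by apply: span_gen; exists r => //; exists (u * v), w; rewrite !mulrA.
- by rewrite mulr0; exact: span_0.
- by rewrite mulrDr -scaleAr; exact: span_lin.
Qed.

Lemma ideal_spanMr u x : span ideal_gen x -> span ideal_gen (x * u).
Proof.
elim=> {x} [_ [r hr [v [w ->]]]||c x y _ hx _ hy].
- by apply: span_gen; exists r => //; exists v, (w * u); rewrite !mulrA.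
- by rewrite mul0r; exact: span_0.
- by rewrite mulrDl -scalerAl; exact: span_lin.
Qed.

End Ideal.

Section Derivations.
Variables (K : comNzRingType) (k : varkind) (n a : nat).
Notation P := (pol K k n).

(* The derivations of K<z> sending each z_i to some u_i with o(u_i) >= a. *)
Definition is_der (d : P -> P) : Prop :=
  [/\ linear d, forall p q, d (p * q) = d p * q + p * d q
    & forall i, ord_ge a (d (zvar K k i))].

Record der := Der { der_fun :> P -> P; derP : is_der der_fun }.

Definition homog_der (m : nat) (d : der) : Prop :=
  forall e p, homog e p -> homog (m + e) (d p).

(* D^[a]<z> carries a Hopf structure with all derivations primitive only through
   its identification with an enveloping algebra: for commuting variables,
   distinct elements of the latter can act by the same operator, and the
   coproduct does not descend to operators. So D^[a]<z> is [env] below, whose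
   elements act on K<z> through [act]. As D<z> and D^[a]<<z>> are spanned,
   respectively topologically spanned, by products of homogeneous derivations,
   their intersection is generated by the polynomial derivations with
   o(u_i) >= a.

   The universal enveloping algebra of the Lie algebra [der]: the free algebra
   on the derivations modulo the two-sided ideal generated by env_rel. *)
Notation free := {malg K[{fmonom {classic der}}]}.

Definition letter (d : der) : free := << fmu (d : {classic der}) >>.

Inductive env_rel : free -> Prop :=
| env_rel_lin c (d d1 d2 : der) : (forall p, d p = c *: d1 p + d2 p) ->
    env_rel (letter d - c *: letter d1 - letter d2)
| env_rel_bracket (d d1 d2 : der) : (forall p, d p = d1 (d2 p) - d2 (d1 p)) ->
    env_rel (letter d1 * letter d2 - letter d2 * letter d1 - letter d).

Notation env_ideal_gen := (ideal_gen env_rel).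

Definition env : Type := quotmod env_ideal_gen.
HB.instance Definition _ := GRing.Lmodule.on env.

Let spanMl := ideal_spanMl (rel := env_rel) (@malg_scaleAr K _).
Let spanMr := ideal_spanMr (rel := env_rel).

Let spanD (x y : free) : span env_ideal_gen x -> span env_ideal_gen y ->
  span env_ideal_gen (x + y).
Proof. by move=> hx hy; rewrite -[x]scale1r; exact: span_lin. Qed.

Let span_aug (x : free) : span env_ideal_gen x -> x@_mone = 0.
Proof.
elim=> {x} [_ [r hr [v [w ->]]]||c x y _ hx _ hy].
- suff r0 : r@_mone = 0 by rewrite !malg_augM r0 mulr0 mul0r.
  have l0 d : (letter d)@_mone = 0 by rewrite mcoeffU1 fm1_eq1.
  case: r / hr => [c d d1 d2 _|d d1 d2 _]; last exact: malg_aug_bracket.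
  by rewrite !mcoeffB mcoeffZ !l0 mulr0 !subr0.
- exact: mcoeff0.
- by rewrite mcoeffD mcoeffZ hx hy mulr0 addr0.
Qed.

Let env_one : env := to_quot env_ideal_gen 1.
Let env_mul (x y : env) : env := to_quot env_ideal_gen (of_quot x * of_quot y).

Let env_mulE (x y : free) : env_mul (to_quot env_ideal_gen x)
    (to_quot env_ideal_gen y) = to_quot env_ideal_gen (x * y).
Proof.
apply/to_quotP; set x' := of_quot _; set y' := of_quot _.
have hx : span env_ideal_gen (x' - x) by apply/to_quotP; exact: of_quotK.
have hy : span env_ideal_gen (y' - y) by apply/to_quotP; exact: of_quotK.
have -> : x' * y' - x * y = (x' - x) * y' + x * (y' - y).
  by rewrite mulrBl mulrBr addrA subrK.
by apply: spanD; [exact: spanMr | exact: spanMl].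
Qed.

Let env_mulA : associative env_mul.
Proof.
by move=> x y z; rewrite -[x]of_quotK -[y]of_quotK -[z]of_quotK !env_mulE mulrA.
Qed.
Let env_mul1l : left_id env_one env_mul.
Proof. by move=> x; rewrite -[x]of_quotK env_mulE mul1r. Qed.
Let env_mulr1 : right_id env_one env_mul.
Proof. by move=> x; rewrite -[x]of_quotK env_mulE mulr1. Qed.
Let to_quotD u v : to_quot env_ideal_gen u + to_quot env_ideal_gen v =
  to_quot env_ideal_gen (u + v) :> env.
Proof. by rewrite -[u]scale1r to_quot_linear !scale1r. Qed.
Let env_mulDl : left_distributive env_mul +%R.
Proof.
move=> x y z; rewrite -[x]of_quotK -[y]of_quotK -[z]of_quotK.
by rewrite !(to_quotD, env_mulE) mulrDl.
Qed.
Let env_mulDr : right_distributive env_mul +%R.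
Proof.
move=> x y z; rewrite -[x]of_quotK -[y]of_quotK -[z]of_quotK.
by rewrite !(to_quotD, env_mulE) mulrDr.
Qed.
Let env_one_neq0 : env_one != 0.
Proof.
apply/eqP => h; have : to_quot env_ideal_gen 1 = to_quot env_ideal_gen 0.
  by rewrite -/env_one h -[0 in RHS](subrr 0) to_quotB subrr.
move=> /to_quotP; rewrite subr0 => /span_aug /eqP.
by rewrite mcoeff1 eqxx oner_eq0.
Qed.

HB.instance Definition _ := GRing.Zmodule_isNzRing.Build env
  env_mulA env_mul1l env_mulr1 env_mulDl env_mulDr env_one_neq0.

Let to_quotZ c u : c *: (to_quot env_ideal_gen u : env) =
  to_quot env_ideal_gen (c *: u).
Proof.
have q0 : to_quot env_ideal_gen 0 = 0 :> env.
  by rewrite -[0 in LHS](subrr 0) to_quotB subrr.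
by rewrite -[c *: u]addr0 to_quot_linear q0 addr0.
Qed.

Let env_mulrE u v : (to_quot env_ideal_gen u : env) * to_quot env_ideal_gen v =
  to_quot env_ideal_gen (u * v).
Proof. exact: env_mulE. Qed.

Let env_scaleAl (c : K) (x y : env) : c *: (x * y) = (c *: x) * y.
Proof.
by rewrite -[x]of_quotK -[y]of_quotK env_mulrE !to_quotZ env_mulrE scalerAl.
Qed.

HB.instance Definition _ := GRing.Lmodule_isLalgebra.Build K env env_scaleAl.

Let env_scaleAr (c : K) (x y : env) : c *: (x * y) = x * (c *: y).
Proof.
by rewrite -[x]of_quotK -[y]of_quotK env_mulrE !to_quotZ env_mulrE malg_scaleAr.
Qed.

HB.instance Definition _ := GRing.Lalgebra_isAlgebra.Build K env env_scaleAr.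

Definition env_der (d : der) : env := to_quot env_ideal_gen (letter d).

(* The action of the enveloping algebra on K<z> by differential operators, and
   its continuous extension to K<<z>>: since the operators do not lower degrees,
   only the components f(d) with d <= e contribute in degree e. *)
Definition act (x : env) (p : P) : P :=
  let r := of_quot x in
  \sum_(w <- msupp r) r@_w *: foldr (fun d : {classic der} => (d : der) : P -> P) p w.

Definition act_ser (x : env) (f : nat -> P) (e : nat) : P :=
  \sum_(d < e.+1) hcomp e (act x (f d)).

(* Degree m: spanned by the products of homogeneous derivations of total
   degree m. *)
Inductive env_piece : nat -> env -> Prop :=
| env_piece_one : env_piece 0 1
| env_piece_mul m m' d x : homog_der m d -> env_piece m' x ->
    env_piece (m + m') (env_der d * x)
| env_piece_zero m : env_piece m 0
| env_piece_lin m c x y : env_piece m x -> env_piece m y ->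
    env_piece m (c *: x + y).

Definition DiffOp : gr_hopf K :=
  prim_hopf (fun x => exists d, x = env_der d) env_piece.

End Derivations.

Section Specialization.
Variables (K : comAlgType rat) (k : varkind) (n a : nat).
Variable Ft : 'I_n -> ser (pser K) k n.

Definition tcoef (j : nat) (u : nat -> pol (pser K) k n) : nat -> pol K k n :=
  fun d => pol_map (fun c : pser K => c j) (u d).

(* lambda_act is the identity
     (sum_m (-1)^m t^m lambda_m) u_t(z) = u_t(F_t(z)),
   read at the coefficient of t^j in the component of degree e in z. It
   determines the lambda_m as operators. The automorphism u_t |-> u_t(F_t) is
   the exponential of a unique derivation, and lambda_exp says that its lift to
   the enveloping algebra is the exponential of that derivation there; this is
   automatic when elements are determined by their action. *)
Record is_lambda (lam : nat -> env K k n a) : Prop := {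
  lambda_exp : exists d : nat -> der K k n a,
    \pser_(m) ((-1) ^+ m *: lam m) =
    pexp (\pser_(m) if m is j.+1 then env_der (d j) else 0);
  lambda_act : forall (u : ser (pser K) k n) (j e : nat),
    tcoef j (subst Ft u) e =
    \sum_(m < j.+1) (-1) ^+ m *: act_ser (lam m) (tcoef (j - m) u) e }.

Definition lambda : nat -> env K k n a :=
  epsilon (inhabits (fun _ => 0)) is_lambda.

(* The algebra homomorphism with Lambda_m |-> lambda_m. *)
Definition specialization : NSym K -> DiffOp K k n a :=
  fun x : nsym K =>
    \sum_(w <- msupp x) x@_w *: \prod_(i <- (w : {fmonom nat})) lambda i.+1.

End Specialization.

(* Main.v *)
(* Dualizing a graded map of coalgebras with antipodes is formal once the duals
   are understood, so everything rests on three facts about the specialization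
   map S.
   (1) S respects coproduct, counit and antipode. The series of the Lambda_m
   is grouplike, because its logarithmic derivative is primitive and a linear
   differential equation over a Q-algebra determines its solution; the series
   of the lambda_m is the exponential of a series of derivations, hence
   grouplike as well, and S maps the one to the other.
   (2) S is graded. The t^j-coefficient of F_t is homogeneous of degree j+1,
   so by induction the derivations in the exponential, then the lambda_m, are
   homogeneous.
   (3) The dual of the enveloping algebra of derivations is closed under the
   coproduct: modulo any degree the identity is a finite sum of graded
   functionals times elements, built from convolution powers of the projection
   onto the elementary derivations z_i |-> monomial. *)
From HB Require Import structures.
From Stdlib Require Import ClassicalEpsilon.
From mathcomp Require Import all_boot all_algebra.
From mathcomp Require Import boolp functions.
From mathcomp Require Import finmap monalg.
Require Import Defs.
Set Implicit Arguments.
Unset Strict Implicit.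
Unset Printing Implicit Defensive.
Import GRing.Theory Num.Theory.
Local Open Scope ring_scope.

(** The Hopf operations and the coproduct of a graded dual are selected by [epsilon], so each is
    used only through its specification, and only after something meeting that specification has
    been exhibited. For the coproduct of a dual this splits the work: on the side of differential
    operators a tensor with the prescribed pairing must exist; on the side of [QSym] it must be
    unique, existence there being inherited along the map. Uniqueness comes from the basis of words
    of [NSym]. Existence is the hard point, since the enveloping algebra is given by generators and
    relations, without a basis at hand. Two hypotheses carry it: with alpha >= 2 every elementary
    derivation has positive degree, so that words of length N lie in degree at least N and can be
    discarded; and over the rationals the r-th convolution power can be divided by r!, which makes
    it the identity on words of length r up to shorter ones. *)

(** * Linear extensions, quotients and tensor products *)

Section LinearMaps.
Variables (K : nzRingType) (V W : lmodType K) (f : V -> W).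
Hypothesis lin_f : linear f.

Lemma lin0 : f 0 = 0.
Proof. by have := lin_f (-1) 0 0; rewrite !scaleN1r oppr0 addr0 addNr. Qed.
Lemma linD x y : f (x + y) = f x + f y.
Proof. by have := lin_f 1 x y; rewrite !scale1r. Qed.
Lemma linZ c x : f (c *: x) = c *: f x.
Proof. by have := lin_f c x 0; rewrite lin0 !addr0. Qed.
Lemma lin_comb0 c x y : f x = 0 -> f y = 0 -> f (c *: x + y) = 0.
Proof. by move=> hx hy; rewrite lin_f hx hy scaler0 addr0. Qed.
Lemma linN x : f (- x) = - f x.
Proof. by rewrite -scaleN1r linZ scaleN1r. Qed.
Lemma linB x y : f (x - y) = f x - f y.
Proof. by rewrite linD linN. Qed.
Lemma linB3 x y z : f (x - y - z) = f x - f y - f z.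
Proof. by rewrite !linB. Qed.
Lemma lin_sum I (r : seq I) (P : pred I) (F : I -> V) :
  f (\sum_(i <- r | P i) F i) = \sum_(i <- r | P i) f (F i).
Proof. exact: (big_morph f linD lin0). Qed.
End LinearMaps.

Lemma sum_linear (K : comNzRingType) (V W : lmodType K) I (r : seq I) (P : pred I)
    (F : I -> V -> W) :
  (forall i, linear (F i)) -> linear (fun x => \sum_(i <- r | P i) F i x).
Proof.
move=> h c x y; rewrite scaler_sumr -big_split /=.
by apply: eq_bigr => i _; rewrite h.
Qed.

Lemma comp_linear (K : nzRingType) (U V W : lmodType K) (f : V -> W) (g : U -> V) :
  linear f -> linear g -> linear (fun x => f (g x)).
Proof. by move=> hf hg c x y; rewrite hg hf. Qed.

Lemma scale_linear (K : comNzRingType) (V W : lmodType K) (c : K) (f : V -> W) :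
  linear f -> linear (fun x => c *: f x).
Proof. by move=> h d x y; rewrite h scalerDr !scalerA mulrC. Qed.

Lemma mull_linear (K : comNzRingType) (A : algType K) (x : A) :
  linear (fun y => x * y).
Proof. by move=> c y z; rewrite mulrDr scalerAr. Qed.

Lemma mulr_linear (K : comNzRingType) (A : algType K) (x : A) :
  linear (fun y => y * x).
Proof. by move=> c y z; rewrite mulrDl scalerAl. Qed.

Section MalgLift.
Variables (K : nzRingType) (M : choiceType).

Definition malg_lift (V : lmodType K) (g : M -> V) (x : {malg K[M]}) : V :=
  \sum_(m <- msupp x) x@_m *: g m.

(** Terms outside the support vanish. Enlarging the index set lets several elements be summed over a
    common one, which is how linearity is obtained. *)
Lemma malg_liftEw (V : lmodType K) (g : M -> V) (d : {fset M}) (x : {malg K[M]}) :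
  (msupp x `<=` d)%fset -> malg_lift g x = \sum_(m <- d) x@_m *: g m.
Proof.
move=> le; rewrite /malg_lift; apply: (big_fset_incl _ le) => m _ hm.
by rewrite (mcoeff_outdom hm) scale0r.
Qed.

Lemma malg_lift_linear (V : lmodType K) (g : M -> V) : linear (malg_lift g).
Proof.
move=> c x y.
pose d := (msupp x `|` msupp y)%fset.
have hx : (msupp x `<=` d)%fset by exact: fsubsetUl.
have hy : (msupp y `<=` d)%fset by exact: fsubsetUr.
have hxy : (msupp (c *: x + y) `<=` d)%fset.
  apply: fsubset_trans (msuppD_le _ _) _.
  by rewrite fsubUset hy (fsubset_trans (msuppZ_le _ _) hx).
rewrite !(malg_liftEw _ hx, malg_liftEw _ hy, malg_liftEw _ hxy) scaler_sumr.
rewrite -big_split; apply: eq_bigr => m _ /=.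
by rewrite mcoeffD mcoeffZ scalerDl scalerA.
Qed.

Lemma malg_liftU (V : lmodType K) (g : M -> V) c m :
  malg_lift g << c *g m >> = c *: g m.
Proof.
rewrite (malg_liftEw _ msuppU_le) big_seq_fset1.
by rewrite mcoeffUU.
Qed.

Lemma malgUZ (c : K) (m : M) : << c *g m >> = c *: << m >> :> {malg K[M]}.
Proof. by apply/malgP => j; rewrite mcoeffZ !mcoeffU mulrnAr mulr1. Qed.

Lemma malg_ext (V : lmodType K) (f g : {malg K[M]} -> V) :
  linear f -> linear g -> (forall m, f << m >> = g << m >>) -> f =1 g.
Proof.
move=> hf hg h x; rewrite (monalgE x) (lin_sum hf) (lin_sum hg).
by apply: eq_bigr => m _; rewrite malgUZ (linZ hf) (linZ hg) h.
Qed.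

End MalgLift.

Lemma malgMUU (K : nzRingType) (M : monomType) (a b : M) :
  << a >> * << b >> = << mmul a b >> :> {malg K[M]}.
Proof. by rewrite malgM_def fgmulUU mulr1. Qed.

Lemma malgU1 (K : nzRingType) (M : monomType) : << mone >> = 1 :> {malg K[M]}.
Proof. by []. Qed.

Section Bilinear.
Variables (K : comNzRingType) (V W Z : lmodType K).

Definition bilin (b : V -> W -> Z) : Prop :=
  (forall w, linear (b^~ w)) /\ (forall v, linear (b v)).

End Bilinear.

Lemma malg_bilin_ext (K : comNzRingType) (M N : choiceType) (V : lmodType K)
    (b b' : {malg K[M]} -> {malg K[N]} -> V) :
  bilin b -> bilin b' -> (forall m n, b << m >> << n >> = b' << m >> << n >>) ->
  forall x y, b x y = b' x y.
Proof.
move=> [b1 b2] [b1' b2'] h x y.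
apply: (malg_ext (b1 y) (b1' y)) => m.
by apply: (malg_ext (b2 _) (b2' _)) => k.
Qed.

(* The two instances needed are the product of B and its opposite. *)
Lemma malg_lift_mul (K : comNzRingType) (M : monomType) (B : lmodType K)
    (op : B -> B -> B) (g : M -> B) :
  bilin op -> (forall m n, g (mmul m n) = op (g m) (g n)) ->
  forall x y, malg_lift g (x * y) = op (malg_lift g x) (malg_lift g y).
Proof.
move=> [op1 op2] h; have gl := malg_lift_linear g.
apply: malg_bilin_ext.
- split=> [w|v].
    by apply: comp_linear gl _ => c x y; rewrite mulrDl scalerAl.
  by apply: comp_linear gl _ => c x y; rewrite mulrDr malg_scaleAr.
- split=> [w|v].
    exact: (comp_linear (op1 _) gl).
  exact: (comp_linear (op2 _) gl).
by move=> m n; rewrite malgMUU !malg_liftU !scale1r h.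
Qed.

Section QuotLift.
Variables (K : comNzRingType) (V : lmodType K) (rel : V -> Prop) (Z : lmodType K).
Variable h : V -> Z.
Hypotheses (h_lin : linear h) (h_rel : forall v, rel v -> h v = 0).

Lemma span_lift0 v : span rel v -> h v = 0.
Proof.
elim=> {v} [v /h_rel //||c x y _ hx _ hy]; first exact: (lin0 h_lin).
by rewrite h_lin hx hy scaler0 addr0.
Qed.

(** [of_quot] returns some representative of the class; it differs from v by an element of the span
    of [rel], which h kills. *)
Lemma quot_liftE v : h (of_quot (to_quot rel v)) = h v.
Proof.
apply/eqP; rewrite -subr_eq0 -(linB h_lin); apply/eqP/span_lift0.
by apply/to_quotP; exact: of_quotK.
Qed.

Lemma quot_lift_linear : linear (fun x : quotmod rel => h (of_quot x)).
Proof.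
move=> c x y; rewrite -[x]of_quotK -[y]of_quotK -to_quot_linear !quot_liftE.
exact: h_lin.
Qed.
End QuotLift.

Section TensorLift.
Variables (K : comNzRingType) (V W : lmodType K).

Lemma to_quot_rel0 (rel : {malg K[(V * W)%type]} -> Prop) x : rel x ->
  to_quot rel x = 0.
Proof.
move=> hx; rewrite -[RHS](lin0 (@to_quot_linear _ _ rel)).
by apply/to_quotP; rewrite subr0; exact: span_gen.
Qed.

Lemma pure_bilin : bilin (@pure K V W).
Proof.
have hl := @to_quot_linear K _ (@tens_rel K V W).
split=> [w c v v'|v c w w'].
  have := to_quot_rel0 (tens_rel_l c v v' w); rewrite !(linB hl) (linZ hl) => /eqP.
  by rewrite -addrA -opprD subr_eq0 => /eqP.
have := to_quot_rel0 (tens_rel_r c v w w'); rewrite !(linB hl) (linZ hl) => /eqP.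
by rewrite -addrA -opprD subr_eq0 => /eqP.
Qed.

Lemma pure_linl w : linear (@pure K V W ^~ w).
Proof. exact: pure_bilin.1. Qed.
Lemma pure_linr v : linear (@pure K V W v).
Proof. exact: pure_bilin.2. Qed.

Lemma tens_ext (Z : lmodType K) (f g : tens V W -> Z) : linear f -> linear g ->
  (forall v w, f (pure v w) = g (pure v w)) -> f =1 g.
Proof.
move=> hf hg h x; rewrite -[x]of_quotK; move: (of_quot x).
have hl := @to_quot_linear K _ (@tens_rel K V W).
apply: malg_ext; [exact: comp_linear|exact: comp_linear|].
by move=> [v w]; exact: h.
Qed.

Lemma tens_ind (P : tens V W -> Prop) :
  P 0 -> (forall c v w x, P x -> P (c *: pure v w + x)) -> forall x, P x.
Proof.
move=> P0 PD x; rewrite -[x]of_quotK; move: (of_quot x) => {}x.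
have hl := @to_quot_linear K _ (@tens_rel K V W).
rewrite (monalgE x) (lin_sum hl); elim/big_rec: _ => // -[v w] y _ hy.
by rewrite malgUZ (linZ hl); apply: PD.
Qed.

Variables (Z : lmodType K) (b : V -> W -> Z).
Hypothesis hb : bilin b.

Let bl := malg_lift_linear (fun p : V * W => b p.1 p.2).
Let b0 v : tens_rel v -> malg_lift (fun p : V * W => b p.1 p.2) v = 0.
Proof.
by case=> [c v1 v2 w|c v1 w1 w2]; rewrite !(linB bl) (linZ bl) !malg_liftU !scale1r /=
  ?hb.1 ?hb.2 addrAC addrK subrr.
Qed.

Lemma tlift_linear : linear (tlift b).
Proof. exact: quot_lift_linear bl b0. Qed.

Lemma tlift_pure v w : tlift b (pure v w) = b v w.
Proof.
have := quot_liftE bl b0 << (v, w) >>; rewrite malg_liftU scale1r /= => <-.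
by [].
Qed.

Lemma tlift_sum I (r : seq I) (x : I -> V) (y : I -> W) :
  tlift b (\sum_(i <- r) pure (x i) (y i)) = \sum_(i <- r) b (x i) (y i).
Proof. by rewrite (lin_sum tlift_linear); apply: eq_bigr => i _; rewrite tlift_pure. Qed.

End TensorLift.

(** * Tensor squares of algebras *)

Section TensorMap.
Variables (K : comNzRingType) (V V' W W' : lmodType K) (f : V -> V') (g : W -> W').
Hypotheses (hf : linear f) (hg : linear g).

Let tens_map_bilin : bilin (fun v w => pure (f v) (g w)).
Proof.
split=> [w|v]; first exact: comp_linear (pure_linl _) hf.
exact: comp_linear (pure_linr _) hg.
Qed.

Lemma tens_map_linear : linear (tens_map f g).
Proof. exact: tlift_linear tens_map_bilin. Qed.

Lemma tens_map_pure v w : tens_map f g (pure v w) = pure (f v) (g w).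
Proof. exact: (tlift_pure tens_map_bilin). Qed.

End TensorMap.

(* The uniqueness half of the universal property of a tensor product, isolated so
   that the proofs using it never see the quotient. *)
Definition generates (K : nzRingType) (V W T : lmodType K) (p : V -> W -> T) : Prop :=
  forall (Z : lmodType K) (f g : T -> Z), linear f -> linear g ->
    (forall v w, f (p v w) = g (p v w)) -> f =1 g.

Lemma lincomb_linear (K : comNzRingType) (V W : lmodType K) (c : K) (f g : V -> W) :
  linear f -> linear g -> linear (fun x => c *: f x + g x).
Proof.
move=> hf hg d x y; rewrite hf hg !scalerDr !scalerA [c * d]mulrC.
exact: addrACA.
Qed.

Section GeneratedProduct.
Variables (K : comNzRingType) (A : algType K) (T : lmodType K) (p : A -> A -> T).
Hypotheses (p_bilin : bilin p) (p_gen : generates p).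

(** Here h y a b plays the role of the product of [p a b] with y. Bilinearity in (a, b) is an
    identity linear in y, so it is enough to check it on the generators y = [p a' b']. It is what
    makes lifting in the first factor legitimate. *)
Lemma generated_bilin (h : T -> A -> A -> T) :
  (forall a b, linear (fun y => h y a b)) ->
  (forall a b a' b', h (p a' b') a b = p (a * a') (b * b')) ->
  forall y, bilin (h y).
Proof.
move=> h_lin hp y; have [pl pr] := p_bilin.
split=> [b|a] c v v'; move: y; apply: p_gen => //.
- exact: lincomb_linear.
- by move=> a' b'; rewrite !hp; exact: (comp_linear (pl _) (mulr_linear a')).
- exact: lincomb_linear.
- by move=> a' b'; rewrite !hp; exact: (comp_linear (pr _) (mulr_linear b')).
Qed.

Variable m : T -> T -> T.
Hypothesis m_linl : forall y, linear (m^~ y).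

(** For fixed c, y, z both sides of the linearity identity are linear in x, so generators x
    suffice. *)
Lemma generated_linr : (forall a b, linear (m (p a b))) -> forall x, linear (m x).
Proof.
move=> h x c y z; move: x; apply: p_gen => [||a b]; last exact: h.
- exact: m_linl.
- exact: (lincomb_linear c (m_linl y) (m_linl z)).
Qed.

Hypothesis m_linr : forall x, linear (m x).
Hypothesis mp : forall a b a' b', m (p a b) (p a' b') = p (a * a') (b * b').

Lemma generated_mulA : associative m.
Proof.
move=> x y z; move: x; apply: p_gen => // [|a b].
  exact: (comp_linear (m_linl z) (m_linl y)).
move: y; apply: p_gen => [||a' b'].
- exact: (comp_linear (m_linr _) (m_linl z)).
- exact: (comp_linear (m_linl z) (m_linr _)).
move: z; apply: p_gen => // [|a'' b'']; last by rewrite !mp !mulrA.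
exact: (comp_linear (m_linr _) (m_linr _)).
Qed.

Lemma generated_mul1l : left_id (p 1 1) m.
Proof. by apply: p_gen => // a b; rewrite mp !mul1r. Qed.

Lemma generated_mulr1 : right_id (p 1 1) m.
Proof. by apply: p_gen => // a b; rewrite mp !mulr1. Qed.

Lemma generated_mapM (B : algType K) (U : lmodType K) (q : B -> B -> U)
    (m' : U -> U -> U) (f : A -> B) (F : T -> U) :
  (forall y, linear (m'^~ y)) -> (forall x, linear (m' x)) ->
  (forall a b a' b', m' (q a b) (q a' b') = q (a * a') (b * b')) ->
  linear F -> (forall a b, F (p a b) = q (f a) (f b)) -> {morph f : x y / x * y} ->
  forall x y, F (m x y) = m' (F x) (F y).
Proof.
move=> m'l m'r m'q F_lin Fp fM x y; move: x; apply: p_gen => [||a b].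
- exact: comp_linear F_lin (m_linl y).
- exact: (comp_linear (m'l _) F_lin).
move: y; apply: p_gen => [||a' b'].
- exact: comp_linear F_lin (m_linr _).
- exact: (comp_linear (m'r _) F_lin).
by rewrite !(Fp, mp, m'q) !fM.
Qed.

End GeneratedProduct.

Lemma pure_generates (K : comNzRingType) (V W : lmodType K) : generates (@pure K V W).
Proof. by move=> Z f g; exact: tens_ext. Qed.

Section TensorAlgebra.
Variables (K : comNzRingType) (A : algType K).
Local Notation A' := (A : lalgType K).
Implicit Types (a b : A') (x y z : tens A' A').

Lemma pure_mul_bilin a b : bilin (fun a' b' : A' => pure (a * a') (b * b')).
Proof.
split=> [w|v]; first exact: comp_linear (pure_linl _) (mull_linear _).
exact: comp_linear (pure_linr _) (mull_linear _).
Qed.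

Let inner y a b := tlift (fun a' b' : A' => pure (a * a') (b * b')) y.

Let inner_pure a b a' b' : inner (pure a' b') a b = pure (a * a') (b * b').
Proof. exact: (tlift_pure (pure_mul_bilin a b)). Qed.

Let inner_linear a b : linear (fun y => inner y a b).
Proof. exact: tlift_linear (pure_mul_bilin a b). Qed.

Let inner_bilin y : bilin (inner y).
Proof.
exact: (generated_bilin (pure_bilin A' A') (@pure_generates K A' A')
  inner_linear inner_pure).
Qed.

Lemma tens_mul_linl y : linear (fun x => tens_mul x y).
Proof. exact: tlift_linear (inner_bilin y). Qed.

Lemma tens_mul_pure a b a' b' :
  tens_mul (pure a b) (pure a' b') = pure (a * a') (b * b').
Proof. by rewrite [LHS](tlift_pure (inner_bilin _)) inner_pure. Qed.

Lemma tens_mul_linr x : linear (tens_mul x).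
Proof.
have e a b y : tens_mul (pure a b) y = inner y a b := tlift_pure (inner_bilin y) a b.
have h a b : linear (tens_mul (pure a b)).
  move=> c y z; apply: etrans (e _ _ _) (etrans (inner_linear a b c y z) _).
  exact: (esym (f_equal2 (fun u v => c *: u + v) (e a b y) (e a b z))).
exact: (@generated_linr K A (tens A' A') (@pure K A' A') (@pure_generates K A' A')
  (@tens_mul K A' A') tens_mul_linl h x).
Qed.

Lemma tens_mulA : associative (@tens_mul K A' A').
Proof.
exact: (generated_mulA (@pure_generates K A' A') tens_mul_linl tens_mul_linr tens_mul_pure).
Qed.

Lemma tens_mul1l : left_id (pure 1 1) (@tens_mul K A' A').
Proof.
exact: (generated_mul1l (@pure_generates K A' A') tens_mul_linr tens_mul_pure).
Qed.

Lemma tens_mulr1 : right_id (pure 1 1) (@tens_mul K A' A').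
Proof.
exact: (generated_mulr1 (@pure_generates K A' A') tens_mul_linl tens_mul_pure).
Qed.

Variable e : A -> K^o.
Hypotheses (e_lin : linear e) (e1 : e 1 = 1).

(* The augmentation e witnesses 1 <> 0 in the tensor square. *)
Definition tens_alg of linear e & e 1 = 1 := tens A A.

Local Notation T := (tens_alg e_lin e1).

HB.instance Definition _ := GRing.Lmodule.on T.

Lemma pure11_neq0 : pure 1 1 != 0 :> tens A A.
Proof.
apply/eqP => h.
have hb : bilin (fun a b => e a * e b : K^o).
  split=> [w c x y|v c x y]; first by rewrite e_lin mulrDl -scalerAl.
  by rewrite e_lin mulrDr; congr (_ + _); exact: mulrCA.
have := tlift_pure hb 1 1; rewrite h (lin0 (tlift_linear hb)) e1 mulr1 => /eqP.
by rewrite eq_sym oner_eq0.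
Qed.

HB.instance Definition _ := GRing.Zmodule_isNzRing.Build T
  tens_mulA tens_mul1l tens_mulr1
  (fun x y z : T => linD (tens_mul_linl z) x y)
  (fun x y z : T => linD (tens_mul_linr x) y z) pure11_neq0.

HB.instance Definition _ := GRing.Lmodule_isLalgebra.Build K T
  (fun c (x y : T) => esym (linZ (tens_mul_linl y) c x)).
HB.instance Definition _ := GRing.Lalgebra_isAlgebra.Build K T
  (fun c (x y : T) => esym (linZ (tens_mul_linr x) c y)).

End TensorAlgebra.

Lemma tens_mapM (K : comNzRingType) (A B : algType K) (f : A -> B) :
  linear f -> {morph f : x y / x * y} ->
  forall x y, tens_map f f (tens_mul x y) = tens_mul (tens_map f f x) (tens_map f f y).
Proof.
move=> f_lin fM.
exact: (generated_mapM (@pure_generates K A A) (@tens_mul_linl K A)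
  (@tens_mul_linr K A) (@tens_mul_pure K A) (@tens_mul_linl K B)
  (@tens_mul_linr K B) (@tens_mul_pure K B) (tens_map_linear f_lin f_lin)
  (tens_map_pure f_lin f_lin) fM).
Qed.

Section FreeAlgebra.
Variables (K : comNzRingType) (I : choiceType) (B : algType K) (h : I -> B).

Definition free_ev : {malg K[{fmonom I}]} -> B :=
  malg_lift (fun w : {fmonom I} => \prod_(i <- w) h i).

Lemma free_ev_linear : linear free_ev.
Proof. exact: malg_lift_linear. Qed.

Lemma free_evM : {morph free_ev : x y / x * y}.
Proof.
apply: (@malg_lift_mul _ _ B *%R); first by split=> [w|v]; [exact: mulr_linear|exact: mull_linear].
by move=> m n; rewrite fmM big_cat.
Qed.

Lemma free_ev1 : free_ev 1 = 1.
Proof. by rewrite -malgU1 /free_ev malg_liftU scale1r fm1 big_nil. Qed.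

Lemma free_ev_letter i : free_ev << fmu i >> = h i.
Proof. by rewrite /free_ev malg_liftU scale1r fmU big_seq1. Qed.

(** Reading the word backwards yields the antihomomorphism with the prescribed values on letters;
    antipodes are built from it. *)
Definition free_evr : {malg K[{fmonom I}]} -> B :=
  malg_lift (fun w : {fmonom I} => \prod_(i <- rev w) h i).

Lemma free_evr_linear : linear free_evr.
Proof. exact: malg_lift_linear. Qed.

Lemma free_evrM x y : free_evr (x * y) = free_evr y * free_evr x.
Proof.
apply: (@malg_lift_mul _ _ B (fun x y => y * x)).
  by split=> [w|v]; [exact: mull_linear|exact: mulr_linear].
by move=> m n; rewrite fmM rev_cat big_cat.
Qed.

Lemma free_evr1 : free_evr 1 = 1.
Proof. by rewrite -malgU1 /free_evr malg_liftU scale1r fm1 big_nil. Qed.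

Lemma free_evr_letter i : free_evr << fmu i >> = h i.
Proof. by rewrite /free_evr malg_liftU scale1r fmU big_seq1. Qed.

End FreeAlgebra.

Lemma fmonom_prod (K : nzRingType) (I : choiceType) (w : {fmonom I}) :
  << w >> = \prod_(i <- w) << fmu i >> :> {malg K[{fmonom I}]}.
Proof.
case: w => s /=; elim: s => [|i s IH]; first by rewrite big_nil -fmoneE.
rewrite big_cons -IH malgMUU; congr << _ >>.
by apply/eqP; rewrite fmP fmM fmU.
Qed.

(** The operation [op] stays abstract so that one statement compares homomorphisms as well as
    antihomomorphisms. *)
Lemma free_alg_ext (K : comNzRingType) (I : choiceType) (B : lmodType K)
    (op : B -> B -> B) (u : B) (f g : {malg K[{fmonom I}]} -> B) :
  linear f -> linear g -> f 1 = u -> g 1 = u ->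
  (forall x y, f (x * y) = op (f x) (f y)) ->
  (forall x y, g (x * y) = op (g x) (g y)) ->
  (forall i, f << fmu i >> = g << fmu i >>) -> f =1 g.
Proof.
move=> hf hg f1 g1 fM gM h; apply: malg_ext => // w.
rewrite fmonom_prod; elim: (fmonom_val w) => [|i s IH]; first by rewrite big_nil f1 g1.
by rewrite big_cons fM gM h IH.
Qed.

(** * Power series and exponentials *)

Section PowerSeries.
Variable A : nzRingType.
Implicit Types f g a : pser A.

Lemma pcoefD f g m : (f + g) m = f m + g m. Proof. by []. Qed.
Lemma pcoefN f m : (- f) m = - f m. Proof. by []. Qed.
Lemma pcoefM f g m : (f * g) m = \sum_(i < m.+1) f i * g (m - i)%N.
Proof. by []. Qed.
Lemma pcoef1 m : (1 : pser A) m = (m == 0%N)%:R. Proof. by []. Qed.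
Lemma pcoef_sum I (r : seq I) (P : pred I) (F : I -> pser A) m :
  (\sum_(i <- r | P i) F i) m = \sum_(i <- r | P i) F i m.
Proof. by elim/big_rec2: _ => // i x y _ <-. Qed.

Lemma eq_pcoefM f f' g g' m :
  (forall i, (i <= m)%N -> f i = f' i) -> (forall i, (i <= m)%N -> g i = g' i) ->
  (f * g) m = (f' * g') m.
Proof.
move=> hf hg; rewrite !pcoefM; apply: eq_bigr => i _.
by rewrite hf ?leq_ord // hg ?leq_subr.
Qed.

Lemma pderiv1 : pderiv (1 : pser A) = 0.
Proof. by apply: pserP => m /=; rewrite mul0rn. Qed.

Lemma pderivM f g : pderiv (f * g) = pderiv f * g + f * pderiv g.
Proof.
apply: pserP => m; rewrite pcoefD !pcoefM.
have -> : pderiv (f * g) m = (f * g) m.+1 *+ m.+1 by [].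
rewrite pcoefM.
(* The multiplicity m + 1 is split as i + (m + 1 - i), one share for each factor. *)
transitivity (\sum_(i < m.+2) (f i *+ i) * g (m.+1 - i)%N +
              \sum_(i < m.+2) f i * (g (m.+1 - i)%N *+ (m.+1 - i))).
  rewrite -big_split -sumrMnl; apply: eq_bigr => i _ /=.
  by rewrite mulrnAl mulrnAr -mulrnDr subnKC // leq_ord.
congr (_ + _).
  by rewrite big_ord_recl mulr0n mul0r add0r; apply: eq_bigr => i _; rewrite lift0 subSS.
rewrite big_ord_recr /= subnn mulr0n mulr0 addr0; apply: eq_bigr => i _ /=.
by rewrite subSn ?leq_ord.
Qed.

(** Solving f g = 1 for the top coefficient of f; this recursion later controls the degree of the
    antipode on the generators of [NSym]. *)
Lemma pcoef_linv f g m : f * g = 1 -> g 0%N = 1 ->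
  f m.+1 = - (\sum_(i < m.+1) f i * g (m.+1 - i)%N).
Proof.
move=> /(congr1 (fun h : pser A => h m.+1)) + g0.
rewrite pcoefM big_ord_recr /= subnn g0 mulr1 => /eqP.
by rewrite addrC addr_eq0 => /eqP.
Qed.

Lemma pcoefX_lt a k m : a 0 = 0 -> (m < k)%N -> (a ^+ k) m = 0.
Proof.
move=> a0; elim: k m => // k IH m; rewrite ltnS => lemk.
rewrite exprS pcoefM big_ord_recl a0 mul0r add0r big1 // => i _.
rewrite lift0 IH ?mulr0 //.
apply: leq_trans lemk; rewrite -subn_gt0 subKn //.
Qed.

End PowerSeries.

Section Substitute.
Variables (K : nzRingType) (A : lalgType K).
Implicit Types (c : nat -> K) (a : pser A).

(* The series sum_k c_k a^k, for a with zero constant term. *)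
Definition pcomp c a : pser A :=
  \pser_(m) \sum_(k < m.+1) c k *: (a ^+ k : pser A) m.

(** The truncation in [pcomp] varies with the coefficient read. Since [a ^+ k] starts in degree k, a
    single bound N serves all smaller degrees, and identities between polynomials in [a] carry over
    to series. *)
Lemma pcomp_trunc c a N m : a 0 = 0 -> (m < N)%N ->
  pcomp c a m = (\sum_(k < N) c k *: (a ^+ k : pser A)) m.
Proof.
move=> a0 ltmN; rewrite /= !pcoef_sum.
rewrite (big_ord_widen N (fun k => c k *: (a ^+ k : pser A) m)) //.
rewrite [RHS](bigID (fun i : 'I_N => (i < m.+1)%N)) /= [X in _ + X]big1 ?addr0 //.
move=> i; rewrite -leqNgt => h.
by rewrite -[LHS]/(c i *: (a ^+ i : pser A) m) pcoefX_lt ?scaler0.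
Qed.

(** The inverse is the geometric series in 1 - f. Each coefficient is read in a partial sum, where
    the product telescopes to 1 minus a power too high to contribute. *)
Lemma pser_invertible (f : pser A) : f 0 = 1 -> exists g, g * f = 1 /\ f * g = 1.
Proof.
move=> f0; pose a := 1 - f; have fE : f = 1 - a by rewrite opprB addrC subrK.
have a0 : a 0 = 0 by rewrite pcoefD pcoefN f0 subrr.
pose S N := \sum_(k < N) (1 : K) *: (a ^+ k : pser A).
have SE N : S N = \sum_(k < N) a ^+ k by apply: eq_bigr => i _; rewrite scale1r.
have E N : (1 - a) * S N = 1 - a ^+ N.
  by rewrite SE -opprB mulNr -subrX1 opprB.
have E' N : S N * (1 - a) = 1 - a ^+ N.
  rewrite -E SE mulr_sumr mulr_suml; apply: eq_bigr => i _.
  by rewrite mulrBr mulrBl mulr1 mul1r -exprS -exprSr.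
exists (pcomp (fun=> 1) a); rewrite fE; split; apply: pserP => m.
  transitivity ((S m.+1 * (1 - a)) m).
    by apply: eq_pcoefM => // i lei; rewrite (pcomp_trunc _ a0 (N := m.+1)).
  by rewrite E' pcoefD pcoefN pcoefX_lt ?subr0.
transitivity (((1 - a) * S m.+1) m).
  by apply: eq_pcoefM => // i lei; rewrite (pcomp_trunc _ a0 (N := m.+1)).
by rewrite E pcoefD pcoefN pcoefX_lt ?subr0.
Qed.

End Substitute.

Lemma pser_scaleAr (K : comNzRingType) (A : algType K) (c : K) (f g : pser A) :
  c *: (f * g) = f * (c *: g).
Proof.
apply: pserP => m; rewrite [LHS]scaler_sumr.
by apply: eq_bigr => i _; rewrite scalerAr.
Qed.

HB.instance Definition _ (K : comNzRingType) (A : algType K) :=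
  GRing.Lalgebra_isAlgebra.Build K (pser A) (@pser_scaleAr K A).

Definition pmap (A B : Type) (f : A -> B) (x : pser A) : pser B := \pser_(m) f (x m).

Section Pmap.
Variables (K : nzRingType) (A B : lalgType K) (f : A -> B).
Hypothesis f_lin : linear f.

Lemma pmap_deriv x : pmap f (pderiv x) = pderiv (pmap f x).
Proof. by apply: pserP => m /=; rewrite -!scaler_nat (linZ f_lin). Qed.

Hypothesis f1 : f 1 = 1.

Lemma pmap1 : pmap f 1 = 1.
Proof.
by apply: pserP => m; rewrite pcoef1 /=; case: eqP; rewrite ?(lin0 f_lin).
Qed.

Lemma pmapM : {morph f : x y / x * y} -> {morph pmap f : x y / x * y}.
Proof.
move=> fM x y; apply: pserP => m; rewrite /= (lin_sum f_lin).
by apply: eq_bigr => i _; rewrite fM.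
Qed.

Lemma pmapM_anti : (forall x y, f (x * y) = f y * f x) ->
  forall x y, pmap f (x * y) = pmap f y * pmap f x.
Proof.
move=> fM x y; apply: pserP => m; rewrite /= (lin_sum f_lin).
rewrite [LHS](reindex_inj rev_ord_inj); apply: eq_bigr => i _ /=.
by rewrite fM subSS subKn ?leq_ord.
Qed.

(** Only compatibility with powers is asked of f, so that antihomomorphisms are covered too. *)
Lemma pmap_pcomp c x : (forall x k, pmap f (x ^+ k) = pmap f x ^+ k) ->
  pmap f (pcomp c x) = pcomp c (pmap f x).
Proof.
move=> fX; apply: pserP => m; rewrite /= (lin_sum f_lin).
by apply: eq_bigr => i _; rewrite (linZ f_lin) -fX.
Qed.

Lemma pmapX : {morph f : x y / x * y} -> forall x k, pmap f (x ^+ k) = pmap f x ^+ k.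
Proof.
by move=> fM x; elim=> [|k IH]; rewrite ?expr0 ?pmap1 // !exprS pmapM ?IH.
Qed.

Lemma pmapX_anti : (forall x y, f (x * y) = f y * f x) ->
  forall x k, pmap f (x ^+ k) = pmap f x ^+ k.
Proof.
by move=> fM x; elim=> [|k IH]; rewrite ?expr0 ?pmap1 // exprS exprSr pmapM_anti ?IH.
Qed.

End Pmap.

Lemma pmap_comm (A B : Type) (C : nzRingType) (f : A -> C) (g : B -> C) x y :
  (forall a b, GRing.comm (f a) (g b)) -> GRing.comm (pmap f x) (pmap g y).
Proof.
move=> h; apply: pserP => m; rewrite !pcoefM /=.
rewrite [LHS](reindex_inj rev_ord_inj); apply: eq_bigr => i _ /=.
by rewrite h subSS subKn ?leq_ord.
Qed.

Section RatAlgebra.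
Variable K : comAlgType rat.

Lemma rat_invK (n : nat) : (0 < n)%N -> ((n%:R^-1 : rat)%:A : K) * n%:R = 1.
Proof.
rewrite lt0n => n0.
rewrite -scalerAl mul1r -[X in _ *: X](scaler_nat (R := rat) n 1) scalerA.
by rewrite mulVf ?pnatr_eq0 // scale1r.
Qed.

Lemma natr_scale_inj (V : lmodType K) (n : nat) (x y : V) :
  x *+ n.+1 = y *+ n.+1 -> x = y.
Proof.
move=> h; rewrite -[x]scale1r -[y]scale1r -(rat_invK (ltn0Sn n)) -!scalerA.
by rewrite !scaler_nat h.
Qed.

(** The derivative at m determines the coefficient m + 1, because m + 1 is invertible in a rational
    algebra. Uniqueness of solutions of linear differential equations follows. *)
Lemma pderiv_eq_ind (A : lalgType K) (f g : pser A) : f 0 = g 0 ->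
  (forall m, (forall i, (i <= m)%N -> f i = g i) -> pderiv f m = pderiv g m) ->
  f = g.
Proof.
move=> h0 h; apply: pserP => m.
suff : forall i, (i <= m)%N -> f i = g i by apply.
elim: m => [i|m IH i]; first by rewrite leqn0 => /eqP ->.
rewrite leq_eqVlt => /orP[/eqP -> {i}|]; last exact: IH.
exact: natr_scale_inj (h m IH).
Qed.

Lemma pderiv_uniql (A : lalgType K) (q f g : pser A) : f 0 = g 0 ->
  pderiv f = q * f -> pderiv g = q * g -> f = g.
Proof.
move=> h0 hf hg; apply: pderiv_eq_ind h0 _ => m IH.
by rewrite hf hg; exact: eq_pcoefM.
Qed.

Lemma pderiv_uniqr (A : lalgType K) (q f g : pser A) : f 0 = g 0 ->
  pderiv f = f * q -> pderiv g = g * q -> f = g.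
Proof.
move=> h0 hf hg; apply: pderiv_eq_ind h0 _ => m IH.
by rewrite hf hg; exact: eq_pcoefM.
Qed.

Definition invfact (k : nat) : K := (k`!%:R^-1 : rat)%:A.

Lemma pexpE (A : lalgType K) (a : pser A) : pexp a = pcomp invfact a.
Proof. by []. Qed.

Lemma invfactK k : invfact k * k`!%:R = 1.
Proof. exact/rat_invK/fact_gt0. Qed.

Lemma invfact_bin n i : (i <= n)%N ->
  invfact n *+ 'C(n, i) = invfact (n - i) * invfact i.
Proof.
move=> lein; rewrite /invfact -scalerAl mul1r scalerA scalerMnl; congr (_ *: _).
have nz k : (k`!%:R : rat) != 0 by rewrite pnatr_eq0 -lt0n fact_gt0.
apply: (mulfI (nz n)); rewrite mulrnAr mulfV //.
rewrite -(bin_fact lein) !natrM -invfM [i`!%:R * _]mulrC mulfK //.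
by rewrite mulf_neq0.
Qed.

(** The triangle k + i < N, summed along antidiagonals on the left and along rows on the right. *)
Lemma sum_triangle (V : nmodType) N (F : nat -> nat -> V) :
  \sum_(n < N) \sum_(i < n.+1) F (n - i)%N i =
  \sum_(k < N) \sum_(i < N | (k + i < N)%N) F k i.
Proof.
transitivity (\sum_(n < N) \sum_(i < N | (i <= n)%N) F (n - i)%N i).
  by apply: eq_bigr => n _; rewrite (big_ord_widen N (fun i => F (n - i)%N i)) //.
rewrite (exchange_big_dep predT) //= [RHS](exchange_big_dep predT) //=.
apply: eq_bigr => i _.
rewrite -(big_mkord (fun n => (i <= n)%N) (fun n => F (n - i)%N i)).
rewrite -(big_mkord (fun k => (k + i < N)%N) (fun k => F k i)).
have leiN : (i <= N)%N by exact: ltnW.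
rewrite -(big_nat_widenl i 0 N predT) // -{1}[i : nat]add0n big_addn.
rewrite (big_nat_widen _ _ N) ?leq_subr //=.
by apply: eq_big => [k|k _]; rewrite ?addnK // ltn_subRL addnC.
Qed.

Lemma pexpD (A : algType K) (x y : pser A) : x 0 = 0 -> y 0 = 0 ->
  GRing.comm x y -> pexp (x + y) = pexp x * pexp y.
Proof.
move=> x0 y0 cxy; apply: pserP => m.
have xy0 : (x + y) 0 = 0 by rewrite pcoefD x0 y0 addr0.
rewrite !pexpE (pcomp_trunc _ xy0 (ltnSn m)).
pose S (z : pser A) := \sum_(k < m.+1) invfact k *: (z ^+ k : pser A).
transitivity ((S x * S y) m); last first.
  by apply: eq_pcoefM => i lei; rewrite (pcomp_trunc _ _ (N := m.+1)).
pose F k i := (invfact k *: x ^+ k) * (invfact i *: y ^+ i).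
have -> : \sum_(k < m.+1) invfact k *: (x + y) ^+ k =
    \sum_(n < m.+1) \sum_(i < n.+1) F (n - i)%N i.
  apply: eq_bigr => n _; rewrite exprDn_comm // scaler_sumr.
  apply: eq_bigr => i _; rewrite -scalerMnr scalerMnl invfact_bin ?leq_ord //.
  by rewrite -scalerA scalerAr scalerAl.
rewrite sum_triangle /S mulr_suml !pcoef_sum; apply: eq_bigr => k _.
rewrite mulr_sumr !pcoef_sum [RHS](bigID (fun i : 'I_m.+1 => (k + i < m.+1)%N)) /=.
(* Outside the triangle k + i > m, and x^k y^i starts in degree k + i, so it does not reach the
   coefficient m. *)
rewrite [X in _ + X]big1 ?addr0 // => i; rewrite -leqNgt => h.
apply: big1 => j _; have [ltjk|lekj] := ltnP j k.
  by rewrite (pcoefX_lt x0) // scaler0 mul0r.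
rewrite [X in _ * (_ *: X)](pcoefX_lt y0) ?scaler0 ?mulr0 //.
by rewrite ltn_subLR ?leq_ord // (leq_trans h) // leq_add2r.
Qed.

Lemma pexp_coef0 (A : lalgType K) (a : pser A) : pexp a 0%N = 1.
Proof. by rewrite /= big_ord1 /= invr1 !scale1r. Qed.

Lemma eq_pcoefX (A : nzRingType) (a b : pser A) m k :
  (forall i, (i <= m)%N -> a i = b i) ->
  forall i, (i <= m)%N -> (a ^+ k) i = (b ^+ k) i.
Proof.
move=> h; elim: k => [|k IH] i lei; first by rewrite !expr0.
rewrite !exprS; apply: eq_pcoefM => j lej; first by rewrite h // (leq_trans lej).
by rewrite IH // (leq_trans lej).
Qed.

(* In degree m.+1 the exponential differs from its argument by a term that
   depends on the lower coefficients only. *)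
Lemma pexp_coefS (A : lalgType K) (a b : pser A) m : a 0%N = 0 -> b 0%N = 0 ->
  (forall i, (i <= m)%N -> a i = b i) ->
  pexp a m.+1 = a m.+1 - b m.+1 + pexp b m.+1.
Proof.
move=> a0 b0 h.
have E (z : pser A) : pexp z m.+1 = z m.+1 + \sum_(k < m) invfact k.+2 *: (z ^+ k.+2 : pser A) m.+1.
  transitivity (\sum_(k < m.+2) invfact k *: (z ^+ k : pser A) m.+1); first by [].
  rewrite 2!big_ord_recl expr0 pcoef1 scaler0 add0r; congr (_ + _).
  transitivity (invfact 1 *: (z ^+ 1 : pser A) m.+1); first by [].
  by rewrite expr1 /invfact invr1 !scale1r.
rewrite (E a) (E b) addrA subrK; apply: (f_equal (fun t => a m.+1 + t)).
apply: eq_bigr => k _; apply: (f_equal (fun t => invfact k.+2 *: t)).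
have nz (c : pser A) : c 0%N = 0 -> (c ^+ k.+1 : pser A) 0%N = 0 by move=> c0; exact: pcoefX_lt.
have X (z : pser A) : z 0%N = 0 -> (z ^+ k.+2 : pser A) m.+1 =
    \sum_(i < m) z i.+1 * (z ^+ k.+1 : pser A) (m - i)%N.
  move=> z0; rewrite exprS pcoefM big_ord_recl z0 mul0r add0r big_ord_recr /=.
  rewrite /bump !leq0n !add1n subnn nz // mulr0 addr0; apply: eq_bigr => i _.
  by rewrite /bump leq0n add1n subSS.
apply: etrans (X a a0) (etrans _ (esym (X b b0))); apply: eq_bigr => i _.
apply: (f_equal2 *%R); first by rewrite h.
by apply: (eq_pcoefX (m := m)) => //; exact: leq_subr.
Qed.

Lemma pexp0 (A : algType K) : pexp (0 : pser A) = 1.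
Proof.
apply: pserP => m; rewrite pexpE /= big_ord_recl expr0 big1 ?addr0.
  by rewrite /invfact invr1 !scale1r.
by move=> i _; rewrite lift0 expr0n /= scaler0.
Qed.

Lemma pexpN (A : algType K) (x : pser A) : x 0 = 0 ->
  pexp (- x) * pexp x = 1 /\ pexp x * pexp (- x) = 1.
Proof.
move=> x0; have nx0 : (- x) 0 = 0 by rewrite pcoefN x0 oppr0.
have c : GRing.comm (- x) x by apply/commr_sym/commrN.
by rewrite -!pexpD ?addNr ?subrr ?pexp0 //; exact: commr_sym.
Qed.

End RatAlgebra.

(** * Noncommutative symmetric functions *)

Section Legs.
Variables (K : comNzRingType) (A : algType K) (e : A -> K^o).
Hypotheses (e_lin : linear e) (e1 : e 1 = 1).
Local Notation T := (tens_alg e_lin e1).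

Definition legl (x : A) : T := pure x 1.
Definition legr (x : A) : T := pure 1 x.

Lemma legl_linear : linear legl. Proof. exact: (@pure_linl K A A). Qed.
Lemma legr_linear : linear legr. Proof. exact: (@pure_linr K A A). Qed.
Lemma tens_algME (x y : T) : x * y = tens_mul x y. Proof. by []. Qed.
Lemma leglM : {morph legl : x y / x * y}.
Proof. by move=> x y; rewrite tens_algME tens_mul_pure mulr1. Qed.
Lemma legrM : {morph legr : x y / x * y}.
Proof. by move=> x y; rewrite tens_algME tens_mul_pure mulr1. Qed.
Lemma leglr x y : legl x * legr y = pure x y.
Proof. by rewrite tens_algME tens_mul_pure mulr1 mul1r. Qed.
Lemma legs_comm x y : GRing.comm (legl x) (legr y).
Proof. by rewrite /GRing.comm leglr tens_algME tens_mul_pure mulr1 mul1r. Qed.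

Lemma pmap_legsM (f g : pser A) m :
  (pmap legl f * pmap legr g) m = \sum_(i < m.+1) pure (f i) (g (m - i)%N).
Proof. by rewrite pcoefM; apply: eq_bigr => i _; rewrite /= leglr. Qed.

End Legs.

Lemma inverse_unique (R : pzRingType) (x y z : R) : x * y = 1 -> y * z = 1 -> x = z.
Proof. by move=> xy yz; rewrite -[x]mulr1 -yz mulrA xy mul1r. Qed.

Lemma comm_mul_inv (R : pzRingType) (l1 l2 s1 s2 : R) :
  GRing.comm s1 l2 -> l1 * s1 = 1 -> l2 * s2 = 1 -> (l1 * l2) * (s1 * s2) = 1.
Proof.
by move=> c h1 h2; rewrite mulrA -[l1 * l2 * s1]mulrA -c mulrA h1 mul1r h2.
Qed.

(** With l_i s_i = 1 and d_i standing for the derivative of s_i, this is the additivity of the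
    logarithmic derivative on a product of commuting factors. *)
Lemma comm_mul_logder (R : pzRingType) (l1 l2 s1 s2 d1 d2 : R) :
  GRing.comm s1 l2 -> GRing.comm d1 l2 -> l1 * s1 = 1 -> l2 * s2 = 1 ->
  (l1 * l2) * (d1 * s2 + s1 * d2) = l1 * d1 + l2 * d2.
Proof.
move=> cs cd h1 h2; rewrite mulrDr; congr (_ + _).
  by rewrite mulrA -[l1 * l2 * d1]mulrA -cd -!mulrA h2 mulr1.
by rewrite mulrA -[l1 * l2 * s1]mulrA -cs mulrA h1 mul1r.
Qed.

Lemma sign_scale_inj (K : nzRingType) (V : lmodType K) m (x y : V) :
  (-1) ^+ m *: x = (-1) ^+ m *: y -> x = y.
Proof.
by move=> /(congr1 (fun x => (-1) ^+ m *: x)); rewrite !scalerA -expr2 sqrr_sign !scale1r.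
Qed.

Section NSymSeries.
Variable K : comAlgType rat.

HB.instance Definition _ :=
  GRing.Lalgebra_isAlgebra.Build K (nsym K) (@malg_scaleAr K _).

Local Notation N := (nsym K).

(** This is lambda(-t), the inverse of sigma(t). *)
Definition lam_neg : pser N := \pser_(m) ((-1) ^+ m *: Lam K m).

Lemma lam_neg0 : lam_neg 0 = 1.
Proof. by rewrite /= expr0 scale1r. Qed.

Lemma sigma_exists : exists s, s * lam_neg = 1 /\ lam_neg * s = 1.
Proof. exact: (pser_invertible lam_neg0). Qed.

Lemma eq_pmap_lam_neg (B : lmodType K) (f g : N -> B) : linear f -> linear g ->
  pmap f lam_neg = pmap g lam_neg -> forall m, f (Lam K m) = g (Lam K m).
Proof.
move=> hf hg h m.
have /(congr1 (fun f : pser B => f m)) := h.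
by rewrite /= (linZ hf) (linZ hg); exact: sign_scale_inj.
Qed.

Section Psi.
Variable sigma : pser N.
Hypotheses (sl : sigma * lam_neg = 1) (ls : lam_neg * sigma = 1).

(** The logarithmic derivative of sigma, obtained by solving sigma' = sigma psi with the inverse
    lambda(-t). *)
Definition psi_of : pser N := lam_neg * pderiv sigma.
Local Notation psi := psi_of.

(** A two-sided inverse is unique, so the sigma quantified in [is_Psi] can be fixed once and for
    all. *)
Lemma is_PsiE x : is_Psi x <-> exists m, x = psi m.
Proof.
split=> [[s [p [h1 h2 h3 [m ->]]]]|[m ->]].
  have es : s = sigma by exact: inverse_unique h1 ls.
  by exists m; rewrite /psi -es h3 mulrA h2 mul1r.
exists sigma, psi; split; [exact: sl|exact: ls| |by exists m].
by rewrite /psi mulrA sl mul1r.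
Qed.

Lemma pderiv_sigma : pderiv sigma = sigma * psi.
Proof. by rewrite /psi mulrA sl mul1r. Qed.

Lemma pderiv_lam_neg_sigma : pderiv lam_neg * sigma = - psi.
Proof.
have := pderivM lam_neg sigma; rewrite ls pderiv1 => /eqP.
by rewrite eq_sym addr_eq0 => /eqP.
Qed.

Lemma pderiv_lam_neg : pderiv lam_neg = - psi * lam_neg.
Proof. by rewrite -pderiv_lam_neg_sigma -mulrA sl mulr1. Qed.

Lemma sigma0 : sigma 0 = 1.
Proof.
have /(congr1 (fun f : pser N => f 0)) := sl.
by rewrite pcoefM big_ord1 lam_neg0 mulr1.
Qed.

Section Comul.
Variables (T : algType K) (il ir D : N -> T).
Hypotheses (il_lin : linear il) (ir_lin : linear ir) (D_lin : linear D).
Hypotheses (il1 : il 1 = 1) (ir1 : ir 1 = 1) (D1 : D 1 = 1).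
Hypotheses (ilM : {morph il : x y / x * y}) (irM : {morph ir : x y / x * y}).
Hypothesis DM : {morph D : x y / x * y}.
Hypothesis comm_lr : forall x y, GRing.comm (il x) (ir y).

Let pmap_comm_lr f g : GRing.comm (pmap il f) (pmap ir g).
Proof. exact: pmap_comm. Qed.

(** If lambda(-t) is grouplike then so is its inverse sigma, and the logarithmic derivative of the
    product of the two commuting legs is a sum. This direction serves to construct the Hopf
    structure, whose specification mentions only the Psi_m; the converse below recovers the
    coproduct of the Lambda_m from that specification. *)
Lemma pmap_psi_primitive : pmap D lam_neg = pmap il lam_neg * pmap ir lam_neg ->
  pmap D psi = pmap il psi + pmap ir psi.
Proof.
move=> hD.
have ls1 : pmap il lam_neg * pmap il sigma = 1.
  by rewrite -(pmapM il_lin ilM) ls (pmap1 il_lin il1).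
have ls2 : pmap ir lam_neg * pmap ir sigma = 1.
  by rewrite -(pmapM ir_lin irM) ls (pmap1 ir_lin ir1).
have cs := comm_mul_inv (pmap_comm_lr sigma lam_neg) ls1 ls2.
rewrite -hD in cs.
have sE : pmap D sigma = pmap il sigma * pmap ir sigma.
  have sd : pmap D sigma * pmap D lam_neg = 1.
    by rewrite -(pmapM D_lin DM) sl (pmap1 D_lin D1).
  exact: inverse_unique sd cs.
rewrite {1}/psi (pmapM D_lin DM) (pmap_deriv D_lin) sE pderivM hD.
rewrite (comm_mul_logder _ (pmap_comm_lr _ _) _ ls1 ls2); last first.
  by rewrite -(pmap_deriv il_lin); exact: pmap_comm_lr.
rewrite -(pmap_deriv il_lin) -(pmap_deriv ir_lin).
by rewrite -(pmapM il_lin ilM) -(pmapM ir_lin irM).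
Qed.

(** Both sides have constant term 1 and solve f' = - D(psi) f; for the product of the legs this uses
    that they commute. *)
Lemma pmap_lam_grouplike : pmap D psi = pmap il psi + pmap ir psi ->
  pmap D lam_neg = pmap il lam_neg * pmap ir lam_neg.
Proof.
move=> hD; apply: (pderiv_uniql (q := - pmap D psi)).
- by rewrite pcoefM big_ord1 /= expr0 scale1r D1 il1 ir1 mulr1.
- rewrite -(pmap_deriv D_lin) pderiv_lam_neg; apply: etrans (pmapM D_lin DM _ _) _.
  by congr (_ * _); apply: pserP => m; rewrite /= (linN D_lin).
have N_l : pmap il (- psi) = - pmap il psi.
  by apply: pserP => m; rewrite /= (linN il_lin).
have N_r : pmap ir (- psi) = - pmap ir psi.
  by apply: pserP => m; rewrite /= (linN ir_lin).
rewrite pderivM -(pmap_deriv il_lin) -(pmap_deriv ir_lin) pderiv_lam_neg.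
rewrite (pmapM il_lin ilM) (pmapM ir_lin irM) N_l N_r hD opprD mulrDl -!mulrA.
congr (_ + _); rewrite !mulrA; congr (_ * _); rewrite mulrN mulNr; congr (- _).
exact: pmap_comm_lr.
Qed.

End Comul.

Section Antipode.
Variable S : N -> N.
Hypotheses (S_lin : linear S) (S1 : S 1 = 1).
Hypothesis SM : forall x y, S (x * y) = S y * S x.

Lemma pmap_psi_antiprimitive : pmap S lam_neg = sigma -> pmap S psi = - psi.
Proof.
move=> hS; have sE : pmap S sigma = lam_neg.
  apply: (inverse_unique (x := pmap S sigma) (z := lam_neg) _ sl).
  rewrite -{2}hS -(pmapM_anti S_lin SM) ls.
  exact: pmap1 S_lin S1.
rewrite {1}/psi (pmapM_anti S_lin SM) (pmap_deriv S_lin) sE hS.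
exact: pderiv_lam_neg_sigma.
Qed.

(** Applying S to the equation of lambda(-t) reverses the factors and produces f' = f psi, which
    sigma solves with the same constant term. *)
Lemma pmap_lam_antipode : pmap S psi = - psi -> pmap S lam_neg = sigma.
Proof.
move=> hS; apply: (pderiv_uniqr (q := psi)).
- by rewrite /= expr0 scale1r S1 sigma0.
- rewrite -(pmap_deriv S_lin) pderiv_lam_neg (pmapM_anti S_lin SM); congr (_ * _).
  rewrite -[RHS]opprK -[in RHS]hS; apply: pserP => m.
  by rewrite /= (linN S_lin).
exact: pderiv_sigma.
Qed.

End Antipode.

Lemma pmap_lam_counit (e : N -> K^o) : linear e -> e 1 = 1 ->
  (forall x y, e (x * y) = e x * e y) -> (forall m, e (psi m) = 0) ->
  forall m, e (Lam K m.+1) = 0.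
Proof.
move=> e_lin e1 eM e0 m.
have : pmap e lam_neg = 1.
  apply: (pderiv_uniql (q := 0)).
  - by rewrite /= expr0 scale1r e1.
  - rewrite -(pmap_deriv e_lin) pderiv_lam_neg (pmapM e_lin eM); congr (_ * _).
    by apply: pserP => j; rewrite /= (linN e_lin) e0 oppr0.
  by rewrite pderiv1 mul0r.
move=> /(congr1 (fun f : pser K => (-1) ^+ m.+1 * f m.+1)).
rewrite /= (linZ e_lin) mulr0 => <-.
by rewrite mulrA -expr2 sqrr_sign mul1r.
Qed.

Lemma counit_psi (e : N -> K^o) : linear e -> e 1 = 1 ->
  (forall x y, e (x * y) = e x * e y) -> (forall m, e (Lam K m.+1) = 0) ->
  forall m, e (psi m) = 0.
Proof.
move=> e_lin e1 eM e0 m.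
have lam1 : pmap e lam_neg = 1.
  apply: pserP => -[|j]; first by rewrite /= expr0 scale1r e1.
  by rewrite /= (linZ e_lin) e0 scaler0.
have s1 : pmap e sigma = 1.
  by rewrite -[LHS]mulr1 -lam1 -(pmapM e_lin eM) sl (pmap1 e_lin e1).
have /(congr1 (fun f : pser K => f m)) : pmap e psi = 0; last by [].
by rewrite /psi (pmapM e_lin eM) (pmap_deriv e_lin) s1 pderiv1 mulr0.
Qed.

End Psi.
End NSymSeries.

(** The operations are selected by [epsilon]: any triple meeting the specification guarantees that
    the selected one meets it. *)
Lemma prim_hopfP (K : comNzRingType) (A : lalgType K) (prim : A -> Prop)
    (piece : nat -> A -> Prop) D e S : is_prim_hopf prim D e S ->
  let H := prim_hopf prim piece in
  is_prim_hopf prim (@hcomul K H) (@hcounit K H) (@hantipode K H).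
Proof.
move=> h; rewrite /=.
pose Q := (fun o : (A -> tens A A) * (A -> K) * (A -> A) =>
  is_prim_hopf prim o.1.1 o.1.2 o.2).
by apply: (@epsilon_spec _ (inhabits _) Q); exists (D, e, S).
Qed.

Section NSymHopf.
Variable K : comAlgType rat.
Local Notation N := (nsym K).

Definition nsym_aug (x : N) : K^o := x@_mone.

Lemma nsym_aug_linear : linear nsym_aug.
Proof. by move=> c x y; rewrite /nsym_aug mcoeffD mcoeffZ. Qed.
Lemma nsym_aug1 : nsym_aug 1 = 1.
Proof. by rewrite /nsym_aug mcoeff1 eqxx. Qed.
Lemma nsym_augM x y : nsym_aug (x * y) = nsym_aug x * nsym_aug y.
Proof. exact: malg_augM. Qed.

Local Notation T := (tens_alg nsym_aug_linear nsym_aug1).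
Local Notation il := (legl nsym_aug_linear nsym_aug1).
Local Notation ir := (legr nsym_aug_linear nsym_aug1).
Let il_lin := legl_linear nsym_aug_linear nsym_aug1.
Let ir_lin := legr_linear nsym_aug_linear nsym_aug1.
Let il1 : il 1 = 1 := erefl.
Let ir1 : ir 1 = 1 := erefl.
Let ilM := leglM nsym_aug_linear nsym_aug1.
Let irM := legrM nsym_aug_linear nsym_aug1.
Let comm_lr := legs_comm nsym_aug_linear nsym_aug1.

Let D : N -> T :=
  free_ev (fun j => \sum_(i < j.+2) pure (Lam K i) (Lam K (j.+1 - i)) : T).
Let Dlin : linear D := @free_ev_linear K nat T _.
Let DM : {morph D : x y / x * y} := @free_evM K nat T _.
Let D1 : D 1 = 1 := @free_ev1 K nat T _.

Let D_Lam m : D (Lam K m) = \sum_(i < m.+1) pure (Lam K i) (Lam K (m - i)).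
Proof.
case: m => [|j]; last exact: (@free_ev_letter K nat T).
by rewrite big_ord1 /= D1.
Qed.

Lemma grouplike_Lam (D' : N -> T) : linear D' ->
  pmap D' (lam_neg K) = pmap il (lam_neg K) * pmap ir (lam_neg K) <->
  forall m, D' (Lam K m) = \sum_(i < m.+1) pure (Lam K i) (Lam K (m - i)).
Proof.
move=> D'lin.
have E m : (pmap il (lam_neg K) * pmap ir (lam_neg K)) m =
    (-1) ^+ m *: (\sum_(i < m.+1) pure (Lam K i) (Lam K (m - i)) : T).
  rewrite pmap_legsM scaler_sumr; apply: eq_bigr => i _.
  rewrite (linZ (pure_linl _)) (linZ (pure_linr _)) scalerA.
  by rewrite -exprD subnKC ?leq_ord.
split=> [h m|h].
  have /(congr1 (fun f : pser T => f m)) := h.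
  by rewrite E /= (linZ D'lin); exact: sign_scale_inj.
by apply: pserP => m; rewrite E /= (linZ D'lin) h.
Qed.

(** Freeness allows the maps to be prescribed on the Lambda_m, by the grouplike formula, the
    augmentation, and S(lambda(-t)) = sigma(t). The required behaviour on the Psi_m is then deduced
    by logarithmic differentiation. *)
Lemma nsym_prim_hopf_exists :
  exists D e S, is_prim_hopf (@is_Psi K) D e S.
Proof.
have [s [sl ls]] := sigma_exists K.
(* The sign cancels the one in [lam_neg], so that S sends lambda(-t) to sigma(t). *)
pose S : N -> N := free_evr (fun j => (-1) ^+ j.+1 *: s j.+1).
have Slin : linear S by exact: free_evr_linear.
have S1 : S 1 = 1 by exact: free_evr1.
have SM x y : S (x * y) = S y * S x by exact: free_evrM.
exists D, nsym_aug, S.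
have hD : pmap D (psi_of s) = pmap il (psi_of s) + pmap ir (psi_of s).
  apply: (@pmap_psi_primitive K s sl ls T il ir D il_lin ir_lin Dlin
    il1 ir1 D1 ilM irM DM comm_lr).
  exact: (grouplike_Lam Dlin).2 D_Lam.
have hS : pmap S (psi_of s) = - psi_of s.
  apply: (pmap_psi_antiprimitive sl ls) => //.
  apply: pserP => -[|j]; first by rewrite /= expr0 scale1r S1 (sigma0 sl).
  rewrite /= (linZ Slin) /S free_evr_letter.
  by rewrite scalerA -expr2 sqrr_sign scale1r.
split.
- exact: Dlin.
- exact: D1.
- exact: DM.
- move=> x /(is_PsiE sl ls)[m ->].
  have /(congr1 (fun f : pser T => f m)) := hD.
  by rewrite addrC.
- exact: nsym_aug_linear.
- exact: nsym_aug1.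
- exact: nsym_augM.
- move=> x /(is_PsiE sl ls)[m ->]; apply: (counit_psi sl nsym_aug_linear nsym_aug1 nsym_augM) => j.
  by rewrite /nsym_aug /= mcoeffU1 fm1_eq1.
- exact: Slin.
- exact: S1.
- exact: SM.
- move=> x /(is_PsiE sl ls)[m ->].
  by have /(congr1 (fun f : pser N => f m)) := hS.
Qed.

Let H := NSym K.

Lemma NSym_hopf :
  is_prim_hopf (@is_Psi K) (@hcomul K H) (@hcounit K H) (@hantipode K H).
Proof. by have [D' [e [S h]]] := nsym_prim_hopf_exists; exact: prim_hopfP h. Qed.

(** The selected coproduct is only specified on the Psi_m; the differential equation of lambda(-t)
    transfers this to the Lambda_m. *)
Lemma NSym_comul_Lam m :
  @hcomul K H (Lam K m) = \sum_(i < m.+1) pure (Lam K i) (Lam K (m - i)).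
Proof.
have [s [sl ls]] := sigma_exists K; have h := NSym_hopf.
have Dl : linear (@hcomul K H : N -> T) := prim_comul_linear h.
have D'1 : (@hcomul K H : N -> T) 1 = 1 := prim_comul_one h.
have D'M : {morph (@hcomul K H : N -> T) : x y / x * y} := prim_comul_mul h.
have hpsi : pmap (@hcomul K H : N -> T) (psi_of s) =
    pmap il (psi_of s) + pmap ir (psi_of s).
  apply: pserP => j; rewrite pcoefD [RHS]addrC.
  by apply: (prim_comul_prim h); apply/(is_PsiE sl ls); exists j.
move: Dl D'1 D'M hpsi; move: (@hcomul K H : N -> T) => D' Dl D'1 D'M hpsi.
apply: (grouplike_Lam Dl).1.
exact: (pmap_lam_grouplike sl ls il_lin ir_lin Dl il1 ir1 D'1 ilM irM D'M comm_lr hpsi).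
Qed.

Lemma NSym_counit_Lam m : @hcounit K H (Lam K m.+1) = 0.
Proof.
have [s [sl ls]] := sigma_exists K; have h := NSym_hopf.
apply: (pmap_lam_counit sl ls (prim_counit_linear h) (prim_counit_one h)).
  exact: (prim_counit_mul h).
by move=> j; apply: (prim_counit_prim h); apply/(is_PsiE sl ls); exists j.
Qed.

(** The antipode inverts lambda(-t), stated without reference to a choice of sigma. *)
Lemma NSym_antipode_Lam : pmap (@hantipode K H) (lam_neg K) * lam_neg K = 1.
Proof.
have [s [sl ls]] := sigma_exists K; have h := NSym_hopf.
rewrite (pmap_lam_antipode sl ls (prim_antipode_linear h) (prim_antipode_one h)
  (prim_antipode_mul h)); first exact: sl.
apply: pserP => j.
by apply: (prim_antipode_prim h); apply/(is_PsiE sl ls); exists j.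
Qed.

End NSymHopf.

(** The cross terms cancel; this is why d -> 1 (x) d + d (x) 1 respects brackets. *)
Lemma commutator_add (R : pzRingType) (x1 x2 y1 y2 : R) :
  GRing.comm x1 y2 -> GRing.comm y1 x2 ->
  (x1 + y1) * (x2 + y2) - (x2 + y2) * (x1 + y1) =
  (x1 * x2 - x2 * x1) + (y1 * y2 - y2 * y1).
Proof.
move=> c1 c2; rewrite !mulrDl !mulrDr c1 c2 [X in X - _]addrACA opprD [LHS]addrACA.
by congr (_ + _); rewrite opprD addrACA subrr ?addr0 ?add0r.
Qed.

Lemma linB_commutator (K : nzRingType) (A B : lalgType K) (f : A -> B) :
  linear f -> {morph f : x y / x * y} ->
  forall x y, f (x * y - y * x) = f x * f y - f y * f x.
Proof. by move=> f_lin fM x y; rewrite (linB f_lin) !fM. Qed.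

Lemma linB3_commutator (K : nzRingType) (A : lalgType K) (B : lmodType K)
    (op : B -> B -> B) (f : A -> B) : linear f ->
  (forall x y, f (x * y) = op (f x) (f y)) ->
  forall x y z, f (x * y - y * x - z) = op (f x) (f y) - op (f y) (f x) - f z.
Proof. by move=> f_lin fM x y z; rewrite (linB3 f_lin) !fM. Qed.

(** * The enveloping algebra of derivations *)

Section EnvTheory.
Variables (K : comNzRingType) (k : varkind) (n a : nat).
Notation P := (pol K k n).
Notation der := (der K k n a).
Notation free := {malg K[{fmonom {classic der}}]}.
Notation env := (env K k n a).
Notation env_rel := (@env_rel K k n a).
Notation qenv := (to_quot (ideal_gen env_rel) : free -> env).

Lemma qenv_linear : linear qenv.
Proof. exact: to_quot_linear. Qed.

Lemma qenvM (u v : free) : qenv (u * v) = qenv u * qenv v.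
Proof.
have hK (x : free) : span (ideal_gen env_rel) (x - of_quot (qenv x)).
  by apply/to_quotP; rewrite of_quotK.
apply/to_quotP; set u' := of_quot _; set v' := of_quot _.
have -> : u * v - u' * v' = 1 *: ((u - u') * v) + u' * (v - v').
  by rewrite scale1r mulrBl mulrBr addrA subrK.
apply: span_lin; first by apply: ideal_spanMr; exact: hK.
by apply: ideal_spanMl; [exact: malg_scaleAr | exact: hK].
Qed.

Lemma qenv1 : qenv 1 = 1. Proof. by []. Qed.

Lemma qenv_rel0 u : env_rel u -> qenv u = 0.
Proof.
move=> hu; rewrite -[RHS](lin0 qenv_linear); apply/to_quotP; rewrite subr0.
by apply: span_gen; exists u => //; exists 1, 1; rewrite mul1r mulr1.
Qed.

Lemma env_der_lin c (d d1 d2 : der) : (forall p, d p = c *: d1 p + d2 p) ->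
  env_der d = c *: env_der d1 + env_der d2.
Proof.
move=> h; apply/eqP; rewrite -subr_eq0 opprD addrA; apply/eqP.
rewrite -[RHS](qenv_rel0 (env_rel_lin h)).
apply: esym; apply: etrans (linB3 qenv_linear _ _ _) _.
by rewrite (linZ qenv_linear).
Qed.

Lemma env_der_bracket (d d1 d2 : der) : (forall p, d p = d1 (d2 p) - d2 (d1 p)) ->
  env_der d1 * env_der d2 - env_der d2 * env_der d1 = env_der d.
Proof.
move=> h; apply/eqP; rewrite -subr_eq0; apply/eqP.
rewrite -[RHS](qenv_rel0 (env_rel_bracket h)).
exact/esym/(linB3_commutator qenv_linear qenvM).
Qed.

Lemma qenv_word (s : seq {classic der}) :
  qenv << FMonom s >> = \prod_(d <- s) env_der d.
Proof.
rewrite fmonom_prod /=; elim: s => [|d s IH]; first by rewrite !big_nil.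
by rewrite !big_cons qenvM IH.
Qed.

Section Lift.
Variables (B : lmodType K) (op : B -> B -> B) (L : free -> B).
Hypotheses (opP : bilin op) (L_lin : linear L).
Hypothesis LM : forall x y, L (x * y) = op (L x) (L y).
Hypothesis L_rel : forall x, env_rel x -> L x = 0.

Let L_ideal x : ideal_gen env_rel x -> L x = 0.
Proof.
move=> [r hr [u [v ->]]]; rewrite !LM (L_rel hr).
by rewrite (lin0 (opP.2 _)) (lin0 (opP.1 _)).
Qed.

(** The operation [op] can be the product of an algebra, its opposite, or the product of [K] for the
    augmentation, so that a single lift serves all of these. *)
Definition env_lift (x : env) : B := L (of_quot x).

Lemma env_liftE u : env_lift (qenv u) = L u.
Proof. exact: quot_liftE. Qed.

Lemma env_lift_linear : linear env_lift.
Proof. exact: quot_lift_linear. Qed.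

Lemma env_liftM x y : env_lift (x * y) = op (env_lift x) (env_lift y).
Proof.
rewrite -[x]of_quotK -[y]of_quotK -!/(qenv _).
by rewrite -qenvM !env_liftE LM.
Qed.

End Lift.

Lemma env_ext (B : lmodType K) (f g : env -> B) : linear f -> linear g ->
  (forall s : seq der, f (\prod_(d <- s) env_der d) = g (\prod_(d <- s) env_der d)) ->
  f =1 g.
Proof.
move=> hf hg h x; rewrite -[x]of_quotK; move: (of_quot x).
apply: malg_ext; [exact: comp_linear hf qenv_linear|exact: comp_linear hg qenv_linear|].
by case=> s; have := h s; rewrite -qenv_word.
Qed.

Definition env_aug : env -> K^o := env_lift (fun x : free => x@_mone : K^o).

Let aug_lin : linear (fun x : free => x@_mone : K^o).
Proof. by move=> c x y; rewrite mcoeffD mcoeffZ. Qed.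
Let mulK_bilin : bilin (fun x y : K^o => x * y : K^o).
Proof.
split=> [w c x y|v c x y]; first by rewrite mulrDl -scalerAl.
by rewrite mulrDr; congr (_ + _); exact: mulrCA.
Qed.
Let augM (x y : free) : (x * y)@_mone = x@_mone * y@_mone.
Proof. exact: malg_augM. Qed.
Let aug_rel x : env_rel x -> x@_mone = 0.
Proof.
have l0 (d : der) : (letter d)@_mone = 0 :> K by rewrite mcoeffU1 fm1_eq1.
case=> [c d d1 d2 _|d d1 d2 _]; last exact: malg_aug_bracket.
by rewrite !mcoeffB mcoeffZ !l0 mulr0 !subr0.
Qed.

Lemma env_aug_linear : linear env_aug.
Proof. exact: env_lift_linear mulK_bilin aug_lin augM aug_rel. Qed.
Lemma env_augM x y : env_aug (x * y) = env_aug x * env_aug y.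
Proof. exact: env_liftM mulK_bilin aug_lin augM aug_rel _ _. Qed.
Lemma env_aug1 : env_aug 1 = 1.
Proof.
by rewrite -qenv1 [LHS](env_liftE mulK_bilin aug_lin augM aug_rel) mcoeff1 eqxx.
Qed.
Lemma env_aug_der d : env_aug (env_der d) = 0.
Proof.
by rewrite [LHS](env_liftE mulK_bilin aug_lin augM aug_rel) mcoeffU1 fm1_eq1.
Qed.

Section Hom.
Variables (B : algType K) (h : der -> B).
Hypothesis h_lin : forall c (d d1 d2 : der), (forall p, d p = c *: d1 p + d2 p) ->
  h d = c *: h d1 + h d2.

(** The universal property of the enveloping algebra: linearity and compatibility with brackets are
    what kills the two families of defining relations. *)
Lemma env_hom_exists :
  (forall d d1 d2 : der, (forall p, d p = d1 (d2 p) - d2 (d1 p)) ->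
    h d1 * h d2 - h d2 * h d1 = h d) ->
  exists f : env -> B, [/\ linear f, f 1 = 1, {morph f : x y / x * y} &
    forall d, f (env_der d) = h d].
Proof.
move=> h_bracket; pose op (x y : B) := x * y.
have opP : bilin op by split=> [w|v]; [exact: mulr_linear|exact: mull_linear].
pose L : free -> B := free_ev (fun d : {classic der} => h d).
have L_lin : linear L := free_ev_linear _.
have LM : forall x y, L (x * y) = op (L x) (L y) := @free_evM _ _ _ _.
have Ll d : L (letter d) = h d by exact: free_ev_letter.
have L1 : L 1 = 1 by exact: free_ev1.
have L_rel x : env_rel x -> L x = 0.
  move: L L_lin LM Ll {L1} => L L_lin LM Ll [c d d1 d2 hd|d d1 d2 hd].
    apply: etrans (linB3 L_lin _ _ _) _; rewrite (linZ L_lin) !Ll (h_lin hd).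
    by rewrite -addrA -opprD subrr.
  apply: etrans (linB3_commutator L_lin LM _ _ _) _.
  by rewrite /op !Ll -(h_bracket _ _ _ hd) subrr.
exists (env_lift L); split=> [|||d].
- exact: env_lift_linear opP L_lin LM L_rel.
- by rewrite -qenv1 (env_liftE opP L_lin LM L_rel).
- exact: env_liftM opP L_lin LM L_rel.
- by rewrite (env_liftE opP L_lin LM L_rel) Ll.
Qed.

Lemma env_antihom_exists :
  (forall d d1 d2 : der, (forall p, d p = d1 (d2 p) - d2 (d1 p)) ->
    h d2 * h d1 - h d1 * h d2 = h d) ->
  exists f : env -> B, [/\ linear f, f 1 = 1, forall x y, f (x * y) = f y * f x &
    forall d, f (env_der d) = h d].
Proof.
move=> h_bracket; pose op (x y : B) := y * x.
have opP : bilin op by split=> [w|v]; [exact: mull_linear|exact: mulr_linear].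
pose L : free -> B := free_evr (fun d : {classic der} => h d).
have L_lin : linear L := free_evr_linear _.
have LM : forall x y, L (x * y) = op (L x) (L y) := @free_evrM _ _ _ _.
have Ll d : L (letter d) = h d by exact: free_evr_letter.
have L1 : L 1 = 1 by exact: free_evr1.
have L_rel x : env_rel x -> L x = 0.
  move: L L_lin LM Ll {L1} => L L_lin LM Ll [c d d1 d2 hd|d d1 d2 hd].
    apply: etrans (linB3 L_lin _ _ _) _; rewrite (linZ L_lin) !Ll (h_lin hd).
    by rewrite -addrA -opprD subrr.
  apply: etrans (linB3_commutator L_lin LM _ _ _) _.
  by rewrite /op !Ll -(h_bracket _ _ _ hd) subrr.
exists (env_lift L); split=> [|||d].
- exact: env_lift_linear opP L_lin LM L_rel.
- by rewrite -qenv1 (env_liftE opP L_lin LM L_rel).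
- exact: env_liftM opP L_lin LM L_rel.
- by rewrite (env_liftE opP L_lin LM L_rel) Ll.
Qed.

End Hom.

(** The map d -> -d reverses brackets, hence extends to an antihomomorphism. *)
Lemma env_antipode_exists : exists S : env -> env,
  [/\ linear S, S 1 = 1, forall x y, S (x * y) = S y * S x &
      forall d, S (env_der d) = - env_der d].
Proof.
apply: env_antihom_exists => [c d d1 d2 /env_der_lin ->|d d1 d2 /env_der_bracket <-].
  by rewrite scalerN opprD.
by rewrite !mulrNN opprB.
Qed.

Section Comul.
Local Notation T := (tens_alg env_aug_linear env_aug1).
Local Notation il := (legl env_aug_linear env_aug1).
Local Notation ir := (legr env_aug_linear env_aug1).

Lemma env_comul_exists : exists D : env -> T,
  [/\ linear D, D 1 = 1, {morph D : x y / x * y} &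
      forall d, D (env_der d) = ir (env_der d) + il (env_der d)].
Proof.
have il_lin := legl_linear env_aug_linear env_aug1.
have ir_lin := legr_linear env_aug_linear env_aug1.
have ilM := leglM env_aug_linear env_aug1.
have irM := legrM env_aug_linear env_aug1.
have comm_lr := legs_comm env_aug_linear env_aug1.
move: il_lin ir_lin ilM irM comm_lr.
move: (il : env -> T) (ir : env -> T); move: (T : algType K) => B il ir.
move=> il_lin ir_lin ilM irM comm_lr.
apply: env_hom_exists => [c d d1 d2 /env_der_lin ->|d d1 d2 /env_der_bracket <-].
  by rewrite ir_lin il_lin scalerDr addrACA.
rewrite commutator_add; [|exact/commr_sym/comm_lr|exact: comm_lr].
have e1 := linB_commutator ir_lin irM (env_der d1) (env_der d2).
have e2 := linB_commutator il_lin ilM (env_der d1) (env_der d2).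
exact: (esym (f_equal2 +%R e1 e2)).
Qed.
End Comul.
End EnvTheory.

Lemma pure_scale (K : comNzRingType) (V W : lmodType K) (c d : K) (v : V) (w : W) :
  pure (c *: v) (d *: w) = (c * d) *: pure v w.
Proof. by rewrite (linZ (pure_linl _)) (linZ (pure_linr _)) scalerA. Qed.

(** * Exponentials of primitive series *)

Section Exponential.
Variables (K : comAlgType rat) (A : algType K) (prim : A -> Prop).
Variables (D : A -> tens A A) (e : A -> K) (S : A -> A).
Hypothesis A_hopf : is_prim_hopf prim D e S.
Variables (a : pser A) (lam : nat -> A).
Hypotheses (a0 : a 0%N = 0) (a_prim : forall m, prim (a m.+1)).
Hypothesis lamE : \pser_(m) ((-1) ^+ m *: lam m) = pexp a.

Local Notation N := (nsym K).
Definition spec : N -> A := free_ev (fun j => lam j.+1).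

Let spec_lin : linear spec. Proof. exact: free_ev_linear. Qed.
Let specM : {morph spec : x y / x * y}. Proof. exact: free_evM. Qed.
Let spec1 : spec 1 = 1. Proof. exact: free_ev1. Qed.

Lemma pmap_spec_lam : pmap spec (lam_neg K) = pexp a.
Proof.
rewrite -lamE; apply: pserP => m; rewrite /= (linZ spec_lin); congr (_ *: _).
case: m => [|m]; last exact: free_ev_letter.
(* The constant term of [lamE] forces lam 0 = 1, in accordance with Lambda_0 = 1. *)
rewrite spec1; have /(congr1 (fun f : pser A => f 0%N)) := lamE.
by rewrite /= expr0 scale1r big_ord1 /= invr1 !scale1r.
Qed.

Let e_lin : linear (e : A -> K^o) := prim_counit_linear A_hopf.
Let e1 : e 1 = 1 := prim_counit_one A_hopf.
Local Notation T := (tens_alg e_lin e1).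
Local Notation il := (legl e_lin e1).
Local Notation ir := (legr e_lin e1).

Let pmap0 (B : lalgType K) (f : A -> B) : linear f -> pmap f a 0%N = 0.
Proof. by move=> f_lin; rewrite /= a0 (lin0 f_lin). Qed.

Lemma pmap_pexp (B : lalgType K) (f : A -> B) : linear f -> f 1 = 1 ->
  {morph f : x y / x * y} -> pmap f (pexp a) = pexp (pmap f a).
Proof. by move=> f_lin f1 fM; rewrite !pexpE pmap_pcomp //; exact: pmapX. Qed.

Lemma pmap_pexp_anti (B : lalgType K) (f : A -> B) : linear f -> f 1 = 1 ->
  (forall x y, f (x * y) = f y * f x) -> pmap f (pexp a) = pexp (pmap f a).
Proof. by move=> f_lin f1 fM; rewrite !pexpE pmap_pcomp //; exact: pmapX_anti. Qed.

(** A multiplicative map commutes with the exponential, and the exponential of a sum of two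
    commuting legs is the product of their exponentials. *)
Lemma pexp_grouplike (B : algType K) (DB il ir : A -> B) :
  linear DB -> linear il -> linear ir -> DB 1 = 1 -> il 1 = 1 -> ir 1 = 1 ->
  {morph DB : x y / x * y} -> {morph il : x y / x * y} -> {morph ir : x y / x * y} ->
  (forall x y, GRing.comm (il x) (ir y)) ->
  (forall x, prim x -> DB x = ir x + il x) ->
  pmap DB (pexp a) = pmap il (pexp a) * pmap ir (pexp a).
Proof.
move=> Dl ll rl D1 l1 r1 DM lM rM c Dp.
rewrite !pmap_pexp // -pexpD; [|exact: pmap0|exact: pmap0|exact: pmap_comm].
congr pexp; apply: pserP => -[|m]; rewrite pcoefD ?pmap0 ?addr0 //.
by rewrite /= Dp // addrC.
Qed.

Lemma pexp_comul m :
  D (pexp a m) = \sum_(i < m.+1) pure (pexp a i) (pexp a (m - i)%N).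
Proof.
have D_lin : linear (D : A -> T) := prim_comul_linear A_hopf.
have /(congr1 (fun f : pser T => f m)) := @pexp_grouplike T D il ir D_lin
  (legl_linear e_lin e1) (legr_linear e_lin e1) (prim_comul_one A_hopf) erefl erefl
  (prim_comul_mul A_hopf) (leglM e_lin e1) (legrM e_lin e1) (legs_comm e_lin e1)
  (prim_comul_prim A_hopf).
by rewrite pmap_legsM.
Qed.

Lemma spec_comul x : D (spec x) = tens_map spec spec (@hcomul K (NSym K) x).
Proof.
have hN := NSym_hopf K; move: x.
have D_lin : linear (D : A -> T) := prim_comul_linear A_hopf.
have DN_lin : linear (@hcomul K (NSym K)) := prim_comul_linear hN.
have m_lin := tens_map_linear spec_lin spec_lin.
have Ds_lin : linear (fun x => D (spec x)) by move=> c x y; rewrite spec_lin; exact: D_lin.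
have mD_lin : linear (fun x => tens_map spec spec (@hcomul K (NSym K) x)).
  exact: (@comp_linear K N (tens N N) (tens A A) _ _ m_lin DN_lin).
apply: (@free_alg_ext K nat T *%R 1 _ _ Ds_lin mD_lin).
- by rewrite spec1 (prim_comul_one A_hopf).
- by rewrite (prim_comul_one hN) (tens_map_pure spec_lin spec_lin) spec1.
- by move=> x y; rewrite specM (prim_comul_mul A_hopf).
- by move=> x y; rewrite (prim_comul_mul hN) (tens_mapM spec_lin specM).
(* All generators are treated at once, by comparing the images of lambda(-t) as power series. *)
move=> i; rewrite -[<< _ >>]/(Lam K i.+1); move: (i.+1).
apply: (eq_pmap_lam_neg Ds_lin mD_lin).
transitivity (pmap (D : A -> T) (pmap spec (lam_neg K))); first by [].
rewrite pmap_spec_lam.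
rewrite (@pexp_grouplike T D il ir D_lin (legl_linear e_lin e1) (legr_linear e_lin e1)
  (prim_comul_one A_hopf) erefl erefl (prim_comul_mul A_hopf) (leglM e_lin e1)
  (legrM e_lin e1) (legs_comm e_lin e1) (prim_comul_prim A_hopf)).
rewrite -pmap_spec_lam; apply: pserP => m; rewrite pmap_legsM /=.
rewrite (linZ mD_lin) NSym_comul_Lam (lin_sum m_lin) scaler_sumr.
apply: eq_bigr => j _.
apply: etrans (f_equal2 (@pure K A A) (linZ spec_lin _ _) (linZ spec_lin _ _)) _.
apply: etrans (pure_scale _ _ _ _) (esym (f_equal2 *:%R _ (tens_map_pure spec_lin spec_lin _ _))).
by rewrite -exprD subnKC ?leq_ord.
Qed.

Lemma spec_counit x : e (spec x) = @hcounit K (NSym K) x.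
Proof.
have hN := NSym_hopf K; move: x.
apply: (@free_alg_ext K nat K^o *%R 1).
- exact: comp_linear e_lin spec_lin.
- exact: prim_counit_linear hN.
- by rewrite spec1.
- exact: prim_counit_one hN.
- by move=> x y; rewrite specM (prim_counit_mul A_hopf).
- exact: prim_counit_mul hN.
move=> i; rewrite -[<< _ >>]/(Lam K i.+1) NSym_counit_Lam.
have : pmap (e : A -> K^o) (pmap spec (lam_neg K)) = 1.
  rewrite pmap_spec_lam pmap_pexp //; last exact: prim_counit_mul A_hopf.
  rewrite -pexp0; congr pexp; apply: pserP => -[|m]; first exact: pmap0.
  by rewrite /= (prim_counit_prim A_hopf).
move=> /(congr1 (fun f : pser K => f i.+1)).
rewrite /= (linZ spec_lin) (linZ e_lin) => h.
by apply: (@sign_scale_inj K K^o i.+1); rewrite h scaler0.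
Qed.

(** The antipode negates the primitive series, so it sends exp(a) to exp(-a), the inverse of exp(a);
    on the other side the antipode of [NSym] inverts lambda(-t), whose image is exp(a). *)
Lemma spec_antipode x : S (spec x) = spec (@hantipode K (NSym K) x).
Proof.
have hN := NSym_hopf K; move: x.
have S_lin : linear S := prim_antipode_linear A_hopf.
have SN_lin : linear (@hantipode K (NSym K)) := prim_antipode_linear hN.
have sS_lin : linear (fun x => spec (@hantipode K (NSym K) x)).
  exact: comp_linear.
have Ss_lin : linear (fun x => S (spec x)) by exact: comp_linear.
apply: (@free_alg_ext K nat A (fun x y => y * x) 1) => //.
- by rewrite spec1 (prim_antipode_one A_hopf).
- by rewrite (prim_antipode_one hN).
- by move=> x y; rewrite specM (prim_antipode_mul A_hopf).
- by move=> x y; rewrite (prim_antipode_mul hN) specM.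
move=> i; rewrite -[<< _ >>]/(Lam K i.+1); move: (i.+1).
apply: (eq_pmap_lam_neg Ss_lin sS_lin).
transitivity (pexp (- a)).
  transitivity (pmap S (pmap spec (lam_neg K))); first by [].
  rewrite pmap_spec_lam.
  rewrite (pmap_pexp_anti S_lin (prim_antipode_one A_hopf) (prim_antipode_mul A_hopf)).
  congr pexp; apply: pserP => -[|m]; first by rewrite pmap0 // pcoefN a0 oppr0.
  by rewrite /= (prim_antipode_prim A_hopf).
apply/esym/(inverse_unique (y := pexp a)); last exact: (pexpN a0).2.
rewrite -pmap_spec_lam.
transitivity (pmap spec (pmap (@hantipode K (NSym K)) (lam_neg K) * lam_neg K)).
  exact: (esym (pmapM spec_lin specM (pmap (@hantipode K (NSym K)) (lam_neg K)) (lam_neg K))).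
by rewrite NSym_antipode_Lam (pmap1 spec_lin spec1).
Qed.

End Exponential.

(** * Derivations of polynomials *)

Section Monomials.
Variables (k : varkind) (n : nat).
Implicit Types m : mono k n.

Lemma count_cmono_letters (m : mono Commutative n) j :
  count_mem j (mono_letters m) = (m : {cmonom 'I_n}) j.
Proof.
rewrite /mono_letters count_flatten -map_comp sumnE big_map big_enum /=.
rewrite (bigD1 j) //= big1 ?addn0 => [|i ne]; first by rewrite count_nseq /= eqxx mul1n.
by rewrite count_nseq /= (negbTE ne).
Qed.

Lemma mono_prodK m : \big[mmul/mone]_(i <- mono_letters m) mono_var k i = m.
Proof.
case: k m => m.
  apply/eqP/cmP => j; rewrite -(count_cmono_letters m).
  elim: (mono_letters m) => [|i s IH]; first by rewrite big_nil cm1.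
  by rewrite big_cons cmM IH /= cmU.
apply/eqP; rewrite fmP /=; apply/eqP.
case: m => s /=; elim: s => [|i s IH]; first by rewrite big_nil fm1.
by rewrite big_cons fmM fmU IH.
Qed.

Lemma mono_deg_var i : @mono_deg k n (mono_var k i) = 1%N.
Proof. by case: k; [exact: mdegU|exact: fdegU]. Qed.

Lemma size_mono_letters m : size (mono_letters m) = mono_deg m.
Proof.
rewrite -[in RHS](mono_prodK m).
elim: (mono_letters m) => [|i s IH]; first by rewrite big_nil mono_deg1.
by rewrite big_cons mono_degM -IH mono_deg_var.
Qed.

Lemma mono_letters_var i : @mono_letters k n (mono_var k i) = [:: i].
Proof.
have := size_mono_letters (mono_var k i); rewrite mono_deg_var.
case: (k); last by rewrite /= fmU.
case e : (mono_letters _) => [|x [|//]] // _.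
have := count_cmono_letters (mono_var Commutative i) i; rewrite e /= cmU eqxx addn0.
by case: eqP => // ->.
Qed.

(** A commutative monomial lists its letters grouped by variable, so concatenation is respected only
    up to a permutation. *)
Lemma mono_lettersM m1 m2 :
  match k with
  | Commutative =>
      perm_eq (mono_letters (mmul m1 m2)) (mono_letters m1 ++ mono_letters m2) : Prop
  | Free => mono_letters (mmul m1 m2) = mono_letters m1 ++ mono_letters m2
  end.
Proof.
case: k m1 m2 => m1 m2; last exact: fmM.
by apply/allP => j _; rewrite /= count_cat !count_cmono_letters cmM.
Qed.

End Monomials.

Lemma pser_comm (A : nzRingType) (f g : pser A) :
  (forall i j, GRing.comm (f i) (g j)) -> GRing.comm f g.
Proof.
move=> h; apply: pserP => m; rewrite !pcoefM.
rewrite [LHS](reindex_inj rev_ord_inj); apply: eq_bigr => i _ /=.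
by rewrite h subSS subKn ?leq_ord.
Qed.

Lemma prod_perm_comm (B : nzRingType) (I : eqType) (F : I -> B) (s t : seq I) :
  (forall i j, GRing.comm (F i) (F j)) -> perm_eq s t ->
  \prod_(i <- s) F i = \prod_(i <- t) F i.
Proof.
move=> hc; elim: s t => [|x s IH] t st.
  by move: st; rewrite perm_sym => /perm_nilP ->.
have : x \in t by rewrite -(perm_mem st) mem_head.
move=> xt; case/splitPr: xt st => t1 t2 st.
have {}st : perm_eq s (t1 ++ t2).
  by rewrite -(perm_cons x) (perm_trans st) // -cat1s perm_catCA.
rewrite big_cons (IH _ st) !big_cat big_cons /= !mulrA; congr (_ * _).
by apply: commr_prod => i _.
Qed.

Section PolTheory.
Variables (K : comNzRingType) (k : varkind) (n : nat).
Local Notation P := (pol K k n).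

HB.instance Definition _ := GRing.Lalgebra_isAlgebra.Build K P (@malg_scaleAr K _).

Lemma monoE (m : mono k n) : << m >> = \prod_(i <- mono_letters m) zvar K k i :> P.
Proof.
rewrite -[in LHS](mono_prodK m).
elim: (mono_letters m) => [|i s IH]; first by rewrite !big_nil.
by rewrite !big_cons -IH [RHS]malgMUU.
Qed.

Lemma prod_letters_mul (B : nzRingType) (F : 'I_n -> B) :
  (k = Commutative -> forall i j, GRing.comm (F i) (F j)) ->
  forall m1 m2 : mono k n, \prod_(i <- mono_letters (mmul m1 m2)) F i =
    (\prod_(i <- mono_letters m1) F i) * \prod_(i <- mono_letters m2) F i.
Proof.
move=> hc m1 m2; rewrite -big_cat.
have := mono_lettersM m1 m2; case: (k) hc m1 m2 => [/(_ erefl) hc|_] m1 m2; last by move->.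
by exact: prod_perm_comm.
Qed.

Lemma pol_comm (p q : P) : k = Commutative -> GRing.comm p q.
Proof.
move=> hk; move: p q; apply: (@malg_bilin_ext K _ _ P
  (fun p q => (p : P) * q) (fun p q => (q : P) * p)).
- by split=> [w|v]; [exact: (@mulr_linear K P)|exact: (@mull_linear K P)].
- by split=> [w|v]; [exact: (@mull_linear K P)|exact: (@mulr_linear K P)].
have mmulC (m1 m2 : mono k n) : mmul m1 m2 = mmul m2 m1.
  by case: (k) hk m1 m2 => // _ m1 m2; exact: mulcmC.
by move=> m1 m2; apply: etrans (malgMUU _ _ _) _; rewrite mmulC -malgMUU.
Qed.

Lemma pol_ext (V : lmodType K) (f g : P -> V) :
  linear f -> linear g -> f 1 = g 1 ->
  (forall i p, f p = g p -> f (zvar K k i * p) = g (zvar K k i * p)) -> f =1 g.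
Proof.
move=> hf hg h1 hz; apply: malg_ext => // m; rewrite monoE.
elim: (mono_letters m) => [|i s IH]; first by rewrite !big_nil.
by rewrite !big_cons; exact: hz.
Qed.

Section DerivationOf.
Variable u : 'I_n -> P.

(** The derivation with z_i -> u_i is found as the t-coefficient of the homomorphism z_i -> z_i + t
    u_i into power series: multiplicativity read at order t is the Leibniz rule. *)
Let E (i : 'I_n) : pser P :=
  \pser_(j) match j with 0%N => zvar K k i | 1%N => u i | _ => 0 end.

Let phi : P -> pser P := malg_lift (fun m : mono k n => \prod_(i <- mono_letters m) E i).

Let phiM : {morph phi : p q / p * q}.
Proof.
apply: (@malg_lift_mul _ _ (pser P) *%R).
  by split=> [w|v]; [exact: mulr_linear|exact: mull_linear].
apply: prod_letters_mul => hk i j; apply: pser_comm => x y.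
exact: pol_comm.
Qed.

Let phi_lin : linear phi. Proof. exact: malg_lift_linear. Qed.

Let phi_zvar i : phi (zvar K k i) = E i.
Proof. by rewrite /phi malg_liftU scale1r mono_letters_var big_seq1. Qed.

Let phi1 : phi 1 = 1.
Proof.
rewrite -malgU1 /phi malg_liftU scale1r.
have := size_mono_letters (@mone (mono k n)); rewrite mono_deg1 => /size0nil ->.
by rewrite big_nil.
Qed.

Definition pol_deriv (p : P) : P := phi p 1%N.

Lemma pol_deriv_linear : linear pol_deriv.
Proof. by move=> c p q; rewrite /pol_deriv phi_lin. Qed.

Let phi0 p : phi p 0%N = p.
Proof.
move: p; apply: (@pol_ext P) => //.
- by move=> c p q; rewrite phi_lin.
- by rewrite phi1.
by move=> i p hp; rewrite phiM pcoefM big_ord1 phi_zvar hp.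
Qed.

Lemma pol_derivM p q : pol_deriv (p * q) = pol_deriv p * q + p * pol_deriv q.
Proof.
by rewrite /pol_deriv phiM pcoefM big_ord_recl big_ord1 /= !phi0 addrC.
Qed.

Lemma pol_deriv_zvar i : pol_deriv (zvar K k i) = u i.
Proof. by rewrite /pol_deriv phi_zvar. Qed.

End DerivationOf.

(** A set Q of allowed degrees: a singleton gives [homog], an upper set gives [ord_ge], so one
    degree count serves both. *)
Definition deg_in (Q : nat -> Prop) (p : P) : Prop :=
  forall m, m \in msupp p -> Q (mono_deg m).

Lemma deg_inP Q p : deg_in Q p <-> forall m, ~ Q (mono_deg m) -> p@_m = 0.
Proof.
split=> hp m hm; first by apply: mcoeff_outdom; apply/negP => /hp.
by apply: contrapT => /hp /eqP; rewrite mcoeff_eq0 hm.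
Qed.

Lemma deg_in0 Q : deg_in Q 0.
Proof. by apply/deg_inP => m _; rewrite mcoeff0. Qed.

Lemma deg_in_lin Q c p q : deg_in Q p -> deg_in Q q -> deg_in Q (c *: p + q).
Proof.
move=> /deg_inP hp /deg_inP hq; apply/deg_inP => m hm.
by rewrite mcoeffD mcoeffZ hp // hq // mulr0 addr0.
Qed.

Lemma deg_inD Q p q : deg_in Q p -> deg_in Q q -> deg_in Q (p + q).
Proof. by move=> hp hq; rewrite -[p]scale1r; exact: deg_in_lin. Qed.

Lemma deg_inZ Q c p : deg_in Q p -> deg_in Q (c *: p).
Proof. by move=> hp; rewrite -[_ *: _]addr0; apply: deg_in_lin => //; exact: deg_in0. Qed.

Lemma deg_in_sum Q (I : Type) (r : seq I) (R : pred I) (F : I -> P) :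
  (forall i, R i -> deg_in Q (F i)) -> deg_in Q (\sum_(i <- r | R i) F i).
Proof. by move=> h; apply: big_ind => //; [exact: deg_in0|exact: deg_inD]. Qed.

Lemma deg_inM (Q Q' Q'' : nat -> Prop) p q : deg_in Q p -> deg_in Q' q ->
  (forall i j, Q i -> Q' j -> Q'' (i + j)%N) -> deg_in Q'' (p * q).
Proof.
move=> hp hq h m /(fsubsetP (@msuppM_incl _ _ p q)).
case/imfset2P => m1 m1p [m2 m2q ->].
by rewrite mono_degM; apply: h; [exact: hp|exact: hq].
Qed.

Lemma deg_in_mono m : deg_in (fun j => j = mono_deg m) << m >>.
Proof. by move=> j /(fsubsetP msuppU_le); rewrite in_fset1 => /eqP ->. Qed.

Lemma deg_in_zvar i : deg_in (fun j => j = 1%N) (zvar K k i).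
Proof. by move=> m /deg_in_mono ->; exact: mono_deg_var. Qed.

Section DerivationDegree.
Variables (d : P -> P) (R : nat -> Prop).
Hypotheses (d_lin : linear d) (dM : forall p q, d (p * q) = d p * q + p * d q).
Hypothesis dz : forall i, deg_in R (d (zvar K k i)).

Lemma derivation1 : d 1 = 0.
Proof. by apply: (addrI (d 1)); rewrite addr0 -{3}[1]mulr1 dM mulr1 mul1r. Qed.

(** A derivation replaces one letter, of degree 1, by a polynomial with degrees in R. The change of
    degree r - 1 is written with a successor because r may be 0. *)
Lemma derivation_mono_degree m :
  deg_in (fun j => exists2 r, R r & j.+1 = (r + mono_deg m)%N) (d << m >>).
Proof.
rewrite monoE -size_mono_letters; elim: (mono_letters m) => [|i s IH].
  by rewrite big_nil derivation1; exact: deg_in0.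
set Q := (fun j => _); rewrite big_cons dM; apply: deg_inD.
  have hs t : deg_in (fun j => j = size t) (\prod_(j <- t) zvar K k j).
    elim: t => [|j t IHt]; first by rewrite big_nil -malgU1 => w /deg_in_mono ->; exact: mono_deg1.
    rewrite big_cons.
    by apply: (@deg_inM _ _ (fun x => x = (size t).+1) _ _ (@deg_in_zvar j) IHt) => x y -> ->.
  apply: (deg_inM (Q'' := Q) (@dz i) (hs s)) => r j Rr ->.
  by exists r => //=; rewrite addnS.
apply: (deg_inM (Q'' := Q) (@deg_in_zvar i) IH) => x j -> [r Rr e].
by exists r => //=; rewrite addnS -e add1n.
Qed.

Lemma derivation_degree (Q Q' : nat -> Prop) p : deg_in Q p ->
  (forall e r j, Q e -> R r -> j.+1 = (r + e)%N -> Q' j) -> deg_in Q' (d p).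
Proof.
move=> hp h; rewrite (monalgE p) (lin_sum d_lin) big_seq.
apply: deg_in_sum => m /hp Qm; rewrite malgUZ (linZ d_lin); apply: deg_inZ.
by move=> w /derivation_mono_degree[r Rr e]; exact: h Qm Rr e.
Qed.

End DerivationDegree.

Lemma derivation_ext (d d' : P -> P) : linear d -> linear d' ->
  (forall p q, d (p * q) = d p * q + p * d q) ->
  (forall p q, d' (p * q) = d' p * q + p * d' q) ->
  (forall i, d (zvar K k i) = d' (zvar K k i)) -> d =1 d'.
Proof.
move=> dl dl' dM dM' h; apply: pol_ext => // [|i p hp].
  by rewrite !derivation1.
by rewrite dM dM' h hp.
Qed.

End PolTheory.

Lemma span_linear (K : nzRingType) (V W : lmodType K) (rel : V -> Prop)
    (rel' : W -> Prop) (f : V -> W) : linear f ->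
  (forall x, rel x -> span rel' (f x)) -> forall x, span rel x -> span rel' (f x).
Proof.
move=> f_lin h x; elim=> {x} [x /h //||c x y _ hx _ hy].
  by rewrite (lin0 f_lin); exact: span_0.
by rewrite f_lin; exact: span_lin.
Qed.

(** * Gradings on tensor squares *)

Section TensorPiece.
Variables (K : comNzRingType) (V : lmodType K) (piece : nat -> V -> Prop).

Inductive pure_piece m : tens V V -> Prop :=
| PurePiece i j u v : (i + j = m)%N -> piece i u -> piece j v -> pure_piece m (pure u v).

Definition tens_piece m : tens V V -> Prop := span (pure_piece m).

Lemma tens_piece_lin m c s t : tens_piece m s -> tens_piece m t ->
  tens_piece m (c *: s + t).
Proof. exact: span_lin. Qed.

Lemma tens_piece0 m : tens_piece m 0.
Proof. exact: span_0. Qed.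

Lemma tens_pieceD m s t : tens_piece m s -> tens_piece m t -> tens_piece m (s + t).
Proof. by move=> hs ht; rewrite -[s]scale1r; exact: tens_piece_lin. Qed.

Lemma tens_piece_sum m I (r : seq I) (R : pred I) (F : I -> tens V V) :
  (forall i, R i -> tens_piece m (F i)) -> tens_piece m (\sum_(i <- r | R i) F i).
Proof. by move=> h; apply: big_ind => //; [exact: tens_piece0|exact: tens_pieceD]. Qed.

End TensorPiece.

Section GradedTensor.
Variables (K : comNzRingType) (A : algType K) (piece : nat -> A -> Prop).
Hypothesis pieceM : forall i j x y, piece i x -> piece j y -> piece (i + j)%N (x * y).

Lemma tens_pieceM m m' s t : tens_piece piece m s -> tens_piece piece m' t ->
  tens_piece piece (m + m') (tens_mul s t).
Proof.
move=> hs ht; move: s hs; apply: (span_linear (tens_mul_linl t)) => _ [i j u v <- hu hv].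
move: t ht; apply: (span_linear (tens_mul_linr _)) => _ [i' j' u' v' <- hu' hv'].
rewrite tens_mul_pure; apply: span_gen.
by apply: (PurePiece (i := (i + i')%N) (j := (j + j')%N)); rewrite 1?addnACA //; exact: pieceM.
Qed.

End GradedTensor.

(** Here u and v are the mixed terms d2 p * d1 q and d1 p * d2 q; their cancellation makes a bracket
    of derivations a derivation. *)
Lemma subr_cross (V : zmodType) (x1 x2 y1 y2 u v : V) :
  x1 + u + (v + y1) - (x2 + v + (u + y2)) = x1 - x2 + (y1 - y2).
Proof.
have e (x y w t : V) : x + w + (t + y) = x + y + (w + t).
  by rewrite [t + y]addrC addrACA.
by rewrite [X in X - _]e [X in _ - X]e [v + u]addrC opprD addrACA subrr addr0 opprD addrACA.
Qed.

(** * Action and grading of the enveloping algebra *)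

Section DerTheory.
Variables (K : comNzRingType) (k : varkind) (n a : nat).
Hypothesis a_gt0 : (0 < a)%N.
Local Notation P := (pol K k n).
Local Notation der := (der K k n a).
Local Notation env := (env K k n a).
Local Notation z := (zvar K k).

Lemma der_exists (u : 'I_n -> P) : (forall i, ord_ge a (u i)) ->
  exists d : der, forall i, d (z i) = u i.
Proof.
move=> hu.
have hd : @is_der K k n a (pol_deriv u).
  split; [exact: pol_deriv_linear|exact: pol_derivM|].
  by move=> i; rewrite pol_deriv_zvar.
by exists (Der hd) => i; exact: pol_deriv_zvar.
Qed.

Lemma der_linear (d : der) : linear d. Proof. by case: (derP d). Qed.
Lemma derM (d : der) p q : d (p * q) = d p * q + p * d q.
Proof. by case: (derP d). Qed.
Lemma der_zvar (d : der) i : ord_ge a (d (z i)). Proof. by case: (derP d). Qed.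

Lemma homog_derP m (d : der) : (forall i, homog m.+1 (d (z i))) -> homog_der m d.
Proof.
move=> h e p hp.
apply: (@derivation_degree K k n d (fun j => j = m.+1) (der_linear d) (derM d) h
  (fun j => j = e) (fun j => j = (m + e)%N) p hp).
by move=> x r j -> -> [->].
Qed.

Lemma der_ord_ge (d : der) b p : ord_ge b p -> ord_ge b (d p).
Proof.
move=> hp.
apply: (@derivation_degree K k n d (fun j => (a <= j)%N) (der_linear d) (derM d)
  (@der_zvar d) (fun j => (b <= j)%N) (fun j => (b <= j)%N) p hp).
move=> e r j lebe lear ej; rewrite -ltnS ej -addn1 addnC leq_add //.
exact: leq_trans lear.
Qed.

Lemma der_bracket_exists (d1 d2 : der) :
  exists d : der, forall p, d p = d1 (d2 p) - d2 (d1 p).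
Proof.
have hd : @is_der K k n a (fun p => d1 (d2 p) - d2 (d1 p)).
  split=> [c p q|p q|i].
  - by rewrite !der_linear opprD addrACA scalerBr.
  - rewrite !derM !(linD (der_linear _)) !derM mulrBl mulrBr; exact: subr_cross.
  rewrite addrC -scaleN1r; apply: (@deg_in_lin K k n (fun j => (a <= j)%N)).
    exact/der_ord_ge/der_zvar.
  exact/der_ord_ge/der_zvar.
by exists (Der hd).
Qed.

Let actw (p : P) : {malg K[{fmonom {classic der}}]} -> P :=
  malg_lift (fun w : {fmonom {classic der}} =>
    foldr (fun d : {classic der} => (d : der) : P -> P) p w).

Let actw_lin p : linear (actw p). Proof. exact: malg_lift_linear. Qed.

Let actw_linr x : linear (fun p => actw p x).
Proof.
rewrite /actw /malg_lift; apply: sum_linear => w; apply: scale_linear.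
by elim: (w : seq _) => //= d s IH c p q; rewrite IH der_linear.
Qed.

Let actwM p u v : actw p (u * v) = actw (actw p v) u.
Proof.
move: u v; apply: malg_bilin_ext.
- split=> [w|v]; apply: comp_linear (actw_lin p) _.
    by move=> c x y; rewrite mulrDl scalerAl.
  by move=> c x y; rewrite mulrDr malg_scaleAr.
- split=> [w|v]; first exact: actw_lin.
  exact: comp_linear (actw_linr v) (actw_lin p).
move=> w w'; apply: etrans (_ : actw p << mmul w w' >> = _).
  by rewrite -malgMUU.
by rewrite /actw !malg_liftU !scale1r fmM foldr_cat.
Qed.

(** The defining relations hold between the operators themselves, so the action does not depend on
    the representative chosen by [of_quot]. *)
Let act_rel p x : ideal_gen (@env_rel K k n a) x -> actw p x = 0.
Proof.
move=> [r hr [u [v ->]]]; rewrite !actwM.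
suff -> : actw (actw p v) r = 0 by rewrite (lin0 (actw_linr u)).
have E q d : actw q (letter d) = d q by rewrite /actw malg_liftU scale1r fmU.
move: (actw p v) => q {p u v}; case: r / hr => [c d d1 d2 h|d d1 d2 h].
  apply: etrans (linB3 (actw_lin q) _ _ _) _.
  by rewrite (linZ (actw_lin q)) !E h -addrA -opprD subrr.
apply: etrans (linB3 (actw_lin q) _ _ _) _.
have EE d1' d2' : actw q (letter d1' * letter d2') = d1' (d2' q).
  by apply: etrans (actwM _ _ _) (etrans (E _ _) _); congr (d1' _); exact: E.
apply: etrans (f_equal3 (fun x y w => x - y - w) (EE d1 d2) (EE d2 d1) (E q d)) _.
by rewrite h subrr.
Qed.

Lemma act_linear p : linear (fun x : env => act x p).
Proof. exact: quot_lift_linear (actw_lin p) (@act_rel p). Qed.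

Let actE p u : act (to_quot (ideal_gen (@env_rel K k n a)) u) p = actw p u.
Proof. exact: (quot_liftE (actw_lin p) (@act_rel p)). Qed.

Lemma act_linearr (x : env) : linear (act x).
Proof. exact: actw_linr. Qed.

Lemma actM (x y : env) p : act (x * y) p = act x (act y p).
Proof. by rewrite -[x]of_quotK -[y]of_quotK -qenvM !actE actwM. Qed.

Lemma act1 p : act (1 : env) p = p.
Proof. by rewrite -qenv1 actE -malgU1 /actw malg_liftU scale1r fm1. Qed.

Lemma act_der (d : der) p : act (env_der d) p = d p.
Proof. by rewrite actE /actw malg_liftU scale1r fmU. Qed.

Implicit Types (x y : env).

Lemma env_pieceD m x y : env_piece m x -> env_piece m y -> env_piece m (x + y).
Proof. by move=> hx hy; rewrite -[x]scale1r; exact: env_piece_lin. Qed.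

Lemma env_pieceZ m c x : env_piece m x -> env_piece m (c *: x).
Proof.
move=> hx; rewrite -[_ *: _]addr0.
exact: (env_piece_lin c hx (env_piece_zero _ _ _ _ _)).
Qed.

Lemma env_piece_sum m I (r : seq I) (R : pred I) (F : I -> env) :
  (forall i, R i -> env_piece m (F i)) -> env_piece m (\sum_(i <- r | R i) F i).
Proof. by move=> h; apply: big_ind => //; [exact: env_piece_zero|exact: env_pieceD]. Qed.

Lemma env_pieceM i j x y : env_piece i x -> env_piece j y -> env_piece (i + j) (x * y).
Proof.
move=> hx hy; elim: hx => {i x} [|m i d x hd _ IH|i|i c x x' _ IH _ IH'].
- by rewrite mul1r.
- by rewrite -mulrA -addnA; exact: env_piece_mul.
- by rewrite mul0r; exact: env_piece_zero.
- have -> : (c *: x + x') * y = c *: (x * y) + x' * y by exact: (mulr_linear y c x x').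
  exact: (env_piece_lin c IH IH').
Qed.

Lemma env_piece_der m (d : der) : homog_der m d -> env_piece m (env_der d).
Proof.
by move=> hd; rewrite -[env_der d]mulr1 -[m]addn0; apply: env_piece_mul hd (env_piece_one _ _ _ _).
Qed.

Lemma act_homog m x e p : env_piece m x -> homog e p -> homog (m + e) (act x p).
Proof.
move=> hx hp; elim: hx => {m x} [|m i d x hd _ IH|i|i c x y _ IH _ IH'].
- by rewrite act1.
- by rewrite actM act_der -addnA; exact: hd.
- by rewrite (lin0 (act_linear p)); exact: homog0.
- by rewrite act_linear; exact: homogL.
Qed.

Section HopfPieces.
Variables (D : env -> tens env env) (e : env -> K) (S : env -> env).
Hypothesis h : is_prim_hopf (fun x => exists d, x = env_der d) D e S.

Lemma env_piece_counit m x : env_piece m x -> (0 < m)%N -> e x = 0.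
Proof.
elim=> {m x} [//|m i d x _ _ _ _|i _|i c x y _ IH _ IH' i0].
- rewrite (prim_counit_mul h) (prim_counit_prim h) ?mul0r //.
  by exists d.
- exact: (lin0 (prim_counit_linear h)).
- by have := prim_counit_linear h c x y; rewrite IH // IH' // scaler0 addr0.
Qed.

Lemma env_piece_antipode m x : env_piece m x -> env_piece m (S x).
Proof.
elim=> {m x} [|m i d x hd _ IH|i|i c x y _ IH _ IH'].
- by rewrite (prim_antipode_one h); exact: env_piece_one.
- rewrite (prim_antipode_mul h) addnC; apply: env_pieceM => //.
  rewrite (prim_antipode_prim h); last by exists d.
  by rewrite -scaleN1r; exact/env_pieceZ/env_piece_der.
- by rewrite (lin0 (prim_antipode_linear h)); exact: env_piece_zero.
- by rewrite (prim_antipode_linear h); exact: env_piece_lin.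
Qed.

Lemma env_piece_comul m x : env_piece m x -> tens_piece (@env_piece K k n a) m (D x).
Proof.
have p1 := env_piece_one K k n a.
elim=> {m x} [|m i d x hd _ IH|i|i c x y _ IH _ IH'].
- by rewrite (prim_comul_one h); apply: span_gen; exact: (PurePiece _ p1 p1).
- rewrite (prim_comul_mul h); apply: tens_pieceM => //; first exact: env_pieceM.
  rewrite (prim_comul_prim h); last by exists d.
  by apply: tens_pieceD; apply: span_gen;
    [apply: (PurePiece _ p1 (env_piece_der hd))|apply: (PurePiece _ (env_piece_der hd) p1)];
    rewrite ?addn0.
- by rewrite (lin0 (prim_comul_linear h)); exact: tens_piece0.
have -> : D (c *: x + y) = c *: D x + D y by exact: prim_comul_linear h _ _ _.
exact: (tens_piece_lin c IH IH').
Qed.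

End HopfPieces.

End DerTheory.

Lemma DiffOp_hopf (K : comNzRingType) (k : varkind) (n a : nat) :
  let H := DiffOp K k n a in
  is_prim_hopf (fun x : env K k n a => exists d, x = env_der d)
    (@hcomul K H) (@hcounit K H) (@hantipode K H).
Proof.
have [D [D_lin D1 DM Dd]] := env_comul_exists K k n a.
have [S [S_lin S1 SM Sd]] := env_antipode_exists K k n a.
apply: (@prim_hopfP K _ _ _ D (@env_aug K k n a) S); split => //.
- by move=> _ [d ->]; exact: Dd.
- exact: env_aug_linear.
- exact: env_aug1.
- exact: env_augM.
- by move=> _ [d ->]; exact: env_aug_der.
- by move=> _ [d ->]; exact: Sd.
Qed.

(** These facts put the product, the unit and the antipode of the dual inside the graded dual;
    outside it [to_gdual] would return its default value 0. *)
Record graded_hopf_facts (K : comNzRingType) (H : gr_hopf K) : Prop := {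
  gh_comul_linear : linear (@hcomul K H);
  gh_comul_piece : forall m x, hpiece m x -> tens_piece (@hpiece K H) m (hcomul x);
  gh_counit_linear : linear (@hcounit K H : H -> K^o);
  gh_counit_piece : forall m (x : H), hpiece m x -> (0 < m)%N -> hcounit x = 0;
  gh_antipode_linear : linear (@hantipode K H);
  gh_antipode_piece : forall m (x : H), hpiece m x -> hpiece m (hantipode x) }.

(** * Graded duals *)

Section GradedDualTheory.
Variables (K : comNzRingType) (H : gr_hopf K).
Local Notation G := (gdual_type H).

Lemma gdualP (f : G) : in_gdual f.
Proof. by case: f => f /= /asboolP. Qed.

Lemma gdual_linear (f : G) : linear (f : H -> K^o).
Proof. by case: (gdualP f). Qed.

Lemma to_gdualE (f : H -> K^o) : in_gdual f -> to_gdual f = f :> (H -> K^o).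
Proof. by move=> hf; rewrite /to_gdual insubdK //; apply/asboolP. Qed.

Lemma gdual_ext (f g : G) : (forall u, f u = g u) -> f = g.
Proof. by move=> h; apply: val_inj; apply/funext. Qed.

Lemma gdual_linE c (f g : G) u : (c *: f + g) u = c * f u + g u.
Proof. by []. Qed.

Definition mulK_of (V W : lmodType K) (f : V -> K^o) (g : W -> K^o) (v : V) (w : W) : K^o :=
  f v * g w.

Lemma mulK_of_bilin (V W : lmodType K) (f : V -> K^o) (g : W -> K^o) :
  linear f -> linear g -> bilin (mulK_of f g).
Proof.
move=> hf hg; rewrite /mulK_of; split=> [w c x y|v c x y].
  by rewrite hf mulrDl -scalerAl.
by rewrite hg mulrDr; congr (_ + _); exact: mulrCA.
Qed.

Let pairing_bilin (u v : H) : bilin (fun f g : G => f u * g v : K^o).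
Proof.
split=> [w c x y|w c x y]; first by rewrite gdual_linE mulrDl -mulrA.
by rewrite gdual_linE mulrDr mulrCA.
Qed.

Lemma tens_pairing_linear u v : linear (fun x => @tens_pairing K H x u v : K^o).
Proof. exact: tlift_linear (pairing_bilin u v). Qed.

Lemma tens_pairing_pure (f g : G) (u v : H) :
  @tens_pairing K H (pure f g) u v = f u * g v :> K.
Proof. exact: (tlift_pure (pairing_bilin u v)). Qed.

Definition comul_dualizable : Prop :=
  forall f : G, exists x, forall u v, tens_pairing x u v = f (hmul u v).

Lemma gdual_comulP (f : gdual H) :
  (exists x, forall u v, tens_pairing x u v = (f : G) (hmul u v)) ->
  forall u v, tens_pairing (hcomul f) u v = (f : G) (hmul u v).
Proof.
exact: (epsilon_spec (inhabits 0)
  (fun x : tens G G => forall u v, tens_pairing x u v = (f : G) (hmul u v))).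
Qed.

Hypothesis hH : graded_hopf_facts H.

(** In total degree at least N + M, each pure tensor has a left factor of degree at least N or a
    right factor of degree at least M. *)
Lemma gdual_mul_in (f g : G) : in_gdual (fun u => tlift (mulK_of f g) (hcomul u)).
Proof.
have hb := mulK_of_bilin (gdual_linear f) (gdual_linear g).
split; first exact: comp_linear (tlift_linear hb) (gh_comul_linear hH).
have [_ [N hf]] := gdualP f; have [_ [M hg]] := gdualP g.
exists (N + M)%N => m x leNM hx.
suff h : forall t, tens_piece (@hpiece K H) m t -> tlift (mulK_of f g) t = 0.
  exact/h/(gh_comul_piece hH).
move=> t; elim=> {t} [_ [i j u v eij hu hv]||c s t _ hs _ ht].
- rewrite (tlift_pure hb) /mulK_of; have [leNi|ltiN] := leqP N i.
    by rewrite (hf i) // mul0r.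
  rewrite (hg j) ?mulr0 //; rewrite -(leq_add2l i) eij (leq_trans _ leNM) //.
  by rewrite leq_add2r ltnW.
- exact: lin0 (tlift_linear hb).
- by rewrite (tlift_linear hb) hs ht scaler0 addr0.
Qed.

Lemma gdual_mulE (f g : gdual H) (u : H) :
  (hmul f g : G) u = tlift (mulK_of (f : G) (g : G)) (hcomul u).
Proof. by rewrite [LHS](f_equal (fun h => h u) (to_gdualE (gdual_mul_in f g))). Qed.

Lemma gdual_mul_sum (f g : gdual H) (u : H) I (L : seq I) (x y : I -> H) :
  hcomul u = \sum_(i <- L) pure (x i) (y i) ->
  (hmul f g : G) u = \sum_(i <- L) (f : G) (x i) * (g : G) (y i).
Proof.
move=> hu; have hb := mulK_of_bilin (gdual_linear f) (gdual_linear g).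
by rewrite gdual_mulE hu (tlift_sum hb).
Qed.

Lemma gdual_mul_piece m p (f g : gdual H) :
  hpiece m f -> hpiece p g -> hpiece (m + p)%N (hmul f g).
Proof.
move=> hf hg j u ne hu; rewrite gdual_mulE.
have hb := mulK_of_bilin (gdual_linear f) (gdual_linear g).
suff h : forall t, tens_piece (@hpiece K H) j t -> tlift (mulK_of (f : G) (g : G)) t = 0.
  exact/h/(gh_comul_piece hH).
move=> t; elim=> {t} [_ [i i' v w eij hv hw]||c s t _ hs _ ht].
- rewrite (tlift_pure hb) /mulK_of; have [eim|nim] := eqVneq i m.
    rewrite [X in _ * X](hg i') ?mulr0 //; apply: contra ne => /eqP <-.
    by rewrite -eij eim.
  by rewrite [X in X * _](hf i) ?mul0r.
- exact: lin0 (tlift_linear hb).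
- by rewrite (tlift_linear hb) hs ht scaler0 addr0.
Qed.

Lemma gdual_one_in : in_gdual (@hcounit K H : H -> K^o).
Proof.
split; first exact: gh_counit_linear hH.
by exists 1%N => m x m_gt0 hx; exact: (gh_counit_piece hH hx m_gt0).
Qed.

Lemma gdual_oneE (u : H) : (hone (gdual H) : G) u = hcounit u.
Proof. by rewrite [LHS](f_equal (fun h => h u) (to_gdualE gdual_one_in)). Qed.

Lemma gdual_antipode_in (f : G) : in_gdual (fun u => f (hantipode u)).
Proof.
split; first exact: comp_linear (gdual_linear f) (gh_antipode_linear hH).
have [_ [N hf]] := gdualP f; exists N => m x leNm hx.
exact: (hf _ _ leNm (gh_antipode_piece hH hx)).
Qed.

Lemma gdual_antipodeE (f : gdual H) (u : H) :
  (hantipode f : G) u = (f : G) (hantipode u).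
Proof. by rewrite [LHS](f_equal (fun h => h u) (to_gdualE (gdual_antipode_in f))). Qed.

End GradedDualTheory.

Section DualMorphism.
Variables (K : comNzRingType) (A B : gr_hopf K) (phi : B -> A).
Hypotheses (hA : graded_hopf_facts A) (hB : graded_hopf_facts B).
Hypothesis A_dual : comul_dualizable A.
Hypothesis B_inj : forall x y : tens (gdual_type B) (gdual_type B),
  (forall u v, tens_pairing x u v = tens_pairing y u v) -> x = y.
Hypotheses (phi_lin : linear phi) (phiM : forall x y, phi (hmul x y) = hmul (phi x) (phi y)).
Hypothesis phi1 : phi (hone B) = hone A.
Hypothesis phi_comul : forall x, hcomul (phi x) = tens_map phi phi (hcomul x).
Hypothesis phi_counit : forall x, hcounit (phi x) = hcounit x.
Hypothesis phi_antipode : forall x, hantipode (phi x) = phi (hantipode x).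
Hypothesis phi_piece : forall m x, hpiece m x -> hpiece m (phi x).

Local Notation psi := (gdual_map phi : gdual A -> gdual B).

Lemma gdual_mapE (f : gdual A) u : (psi f : gdual_type B) u = (f : gdual_type A) (phi u).
Proof.
have h : in_gdual (fun u => (f : gdual_type A) (phi u)).
  split; first exact: comp_linear (gdual_linear f) phi_lin.
  have [_ [N hf]] := gdualP f; exists N => m x leNm hx.
  exact: (hf _ _ leNm (phi_piece hx)).
by rewrite [LHS](f_equal (fun h => h u) (to_gdualE h)).
Qed.

Lemma gdual_map_linear : linear psi.
Proof. by move=> c f g; apply: gdual_ext => u; rewrite gdual_linE !gdual_mapE. Qed.

Lemma gdual_map_tens (x : tens (gdual A) (gdual A)) u v :
  tens_pairing (tens_map psi psi x) u v = tens_pairing x (phi u) (phi v).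
Proof.
have m_lin := tens_map_linear gdual_map_linear gdual_map_linear.
move: x; apply: (@tens_ext K (gdual A) (gdual A) K^o
  (fun x => tens_pairing (tens_map psi psi x : tens (gdual_type B) (gdual_type B)) u v)
  (fun x => @tens_pairing K A x (phi u) (phi v))).
- exact: comp_linear (tens_pairing_linear u v) m_lin.
- exact: tens_pairing_linear.
move=> f g; rewrite (tens_map_pure gdual_map_linear gdual_map_linear) !tens_pairing_pure.
by rewrite !gdual_mapE.
Qed.

Theorem gdual_map_morphism : gr_hopf_morphism psi.
Proof.
split.
- exact: gdual_map_linear.
- move=> f g; apply: gdual_ext => u; rewrite gdual_mapE !gdual_mulE // phi_comul.
  have hb := mulK_of_bilin (gdual_linear f) (gdual_linear g).
  have hb' := mulK_of_bilin (gdual_linear (psi f)) (gdual_linear (psi g)).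
  move: (hcomul u); apply: (@tens_ext K B B K^o
    (fun t => tlift (mulK_of (f : gdual_type A) (g : gdual_type A)) (tens_map phi phi t))
    (tlift (mulK_of (psi f : gdual_type B) (psi g : gdual_type B)))).
  + exact: comp_linear (tlift_linear hb) (tens_map_linear phi_lin phi_lin).
  + exact: tlift_linear.
  move=> v w; rewrite (tens_map_pure phi_lin phi_lin) (tlift_pure hb) (tlift_pure hb').
  by rewrite /mulK_of !gdual_mapE.
- by apply: gdual_ext => u; rewrite gdual_mapE !gdual_oneE.
(* Both tensors have the same pairing, and uniqueness in the target identifies them. The image of
   the tensor selected in the source is itself the witness that makes the selection in the target
   meaningful. *)
- move=> f; apply: B_inj => u v; rewrite gdual_map_tens.
  have h := gdual_comulP (A_dual f).
  rewrite h gdual_comulP; first by rewrite gdual_mapE phiM.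
  exists (tens_map psi psi (hcomul f)) => u' v'.
  by rewrite gdual_map_tens h gdual_mapE phiM.
- move=> f; exact: etrans (gdual_mapE _ _) (f_equal _ phi1).
- move=> f; apply: gdual_ext => u.
  by rewrite gdual_mapE !gdual_antipodeE // gdual_mapE phi_antipode.
- move=> m f hf j u ne hu; rewrite gdual_mapE; exact: (hf _ _ ne (phi_piece hu)).
Qed.

End DualMorphism.

Lemma pure_sum_lin (K : comNzRingType) (V W : lmodType K) (I : Type) (L : seq I)
    (c : K) (a b : I -> K) (x : I -> V) (y : I -> W) (e : I -> I -> K) :
  c *: pure (\sum_(i <- L) a i *: x i) (\sum_(j <- L) b j *: y j) +
    \sum_(i <- L) \sum_(j <- L) e i j *: pure (x i) (y j) =
  \sum_(i <- L) \sum_(j <- L) (c * (a i * b j) + e i j) *: pure (x i) (y j).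
Proof.
rewrite (lin_sum (pure_linl _)) scaler_sumr -big_split; apply: eq_bigr => v _ /=.
rewrite (lin_sum (pure_linr _)) scaler_sumr -big_split; apply: eq_bigr => w _ /=.
by rewrite (linZ (pure_linl _)) (linZ (pure_linr _)) !scalerA -scalerDl mulrA.
Qed.

(** * Grading of [NSym] and uniqueness of coproducts in [QSym] *)

Section Words.
Variable I : eqType.
Implicit Types (L w : seq I).

Fixpoint words L (s : nat) : seq (seq I) :=
  if s is s'.+1 then [seq i :: w | i <- L, w <- words L s'] else [:: [::]].

Definition words_upto L (M : nat) : seq (seq I) :=
  flatten [seq words L s | s <- iota 0 M].

Lemma mem_words L w : {subset w <= L} -> w \in words L (size w).
Proof.
elim: w => //= i w IH h; apply: allpairs_f.
  by apply: h; rewrite mem_head.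
by apply: IH => j jw; apply: h; rewrite inE jw orbT.
Qed.

Lemma mem_words_upto L M w : (size w < M)%N -> {subset w <= L} -> w \in words_upto L M.
Proof.
move=> hs h; apply/flattenP; exists (words L (size w)); last exact: mem_words.
by apply: map_f; rewrite mem_iota.
Qed.

End Words.

Section NSymPieces.
Variable K : comAlgType rat.
Local Notation N := (nsym K).
Local Notation piece := (@nsym_piece K).

Definition weight (w : {fmonom nat}) : nat := (\sum_(i <- (w : seq nat)) i.+1)%N.

Lemma weight1 : weight mone = 0%N.
Proof. by rewrite /weight fm1 big_nil. Qed.

Lemma weightM v w : weight (mmul v w) = (weight v + weight w)%N.
Proof. by rewrite /weight fmM big_cat. Qed.

Lemma nsym_pieceP m (x : N) :
  piece m x <-> forall w, weight w != m -> x@_w = 0.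
Proof.
split=> h w hw.
  by apply: mcoeff_outdom; apply: contra hw => /h <-.
by apply/eqP; apply: contraLR hw => /h; rewrite -mcoeff_eq0 => ->.
Qed.

Lemma nsym_piece0 m : piece m 0.
Proof. by apply/nsym_pieceP => w _; rewrite mcoeff0. Qed.

Lemma nsym_piece_lin m c (x y : N) : piece m x -> piece m y -> piece m (c *: x + y).
Proof.
move=> /nsym_pieceP hx /nsym_pieceP hy; apply/nsym_pieceP => w hw.
by rewrite mcoeffD mcoeffZ hx // hy // mulr0 addr0.
Qed.

Lemma nsym_pieceZ m c (x : N) : piece m x -> piece m (c *: x).
Proof.
move=> hx; have -> : c *: x = c *: x + 0 by rewrite addr0.
exact: (@nsym_piece_lin m c x 0 hx (@nsym_piece0 m)).
Qed.

Lemma nsym_pieceU w : piece (weight w) << w >>.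
Proof. by move=> v /(fsubsetP msuppU_le); rewrite in_fset1 => /eqP ->. Qed.

Lemma nsym_piece1 : piece 0 1.
Proof. by rewrite -weight1 -malgU1; exact: nsym_pieceU. Qed.

Lemma nsym_pieceM i j (x y : N) : piece i x -> piece j y -> piece (i + j) (x * y).
Proof.
move=> hx hy m /(fsubsetP (@msuppM_incl _ _ x y)).
case/imfset2P => m1 m1p [m2 m2q ->].
by rewrite -[LHS]/(weight (mmul m1 m2)) weightM /weight hx // hy.
Qed.

Lemma nsym_piece_Lam m : piece m (Lam K m).
Proof.
case: m => [|j]; first exact: nsym_piece1.
have := @nsym_pieceU (fmu j); rewrite /weight fmU big_seq1; exact.
Qed.

(** A component is spanned by the words of its weight, so a property stable under linear
    combinations need only be checked on them. *)
Lemma nsym_piece_ind (V : lmodType K) (f : N -> V) (Q : V -> Prop) m x :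
  linear f -> Q 0 -> (forall c u v, Q u -> Q v -> Q (c *: u + v)) ->
  (forall w, weight w = m -> Q (f << w >>)) -> piece m x -> Q (f x).
Proof.
move=> f_lin Q0 Ql h hx; rewrite (monalgE x) (lin_sum f_lin) big_seq.
elim/big_rec: _ => // w v hw hv; rewrite malgUZ (linZ f_lin).
by apply: Ql hv; apply: h; exact: hx.
Qed.

Let H := NSym K.
Let hN := NSym_hopf K.

Lemma weight_cons i s : weight (FMonom (i :: s)) = (i.+1 + weight (FMonom s))%N.
Proof. by rewrite /weight /= big_cons. Qed.

Lemma nsym_word_cons i s : << FMonom (i :: s) >> = Lam K i.+1 * << FMonom s >> :> N.
Proof. by rewrite !fmonom_prod /= big_cons. Qed.

Lemma nsym_word_nil : << FMonom [::] >> = 1 :> N.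
Proof. by rewrite fmonom_prod /= big_nil. Qed.

Lemma weight_nil : weight (FMonom [::]) = 0%N.
Proof. by rewrite /weight /= big_nil. Qed.

Lemma nsym_piece_comul m x : piece m x -> tens_piece piece m (@hcomul K H x).
Proof.
have D_lin : linear (@hcomul K H) := prim_comul_linear hN.
apply: (nsym_piece_ind (Q := tens_piece piece m) D_lin (tens_piece0 _ _)).
  by move=> c u v; exact: tens_piece_lin.
move=> [s] <- {x}; elim: s => [|i s IH].
  rewrite nsym_word_nil weight_nil (prim_comul_one hN); apply: span_gen.
  exact: (PurePiece _ nsym_piece1 nsym_piece1).
rewrite weight_cons nsym_word_cons (prim_comul_mul hN).
apply: (tens_pieceM nsym_pieceM _ IH).
rewrite NSym_comul_Lam; apply: tens_piece_sum => j _; apply: span_gen.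
by apply: (PurePiece _ (@nsym_piece_Lam _) (@nsym_piece_Lam _)); rewrite subnKC ?leq_ord.
Qed.

Lemma nsym_piece_counit m x : piece m x -> (0 < m)%N -> @hcounit K H x = 0.
Proof.
move=> hx m0; move: hx.
apply: (nsym_piece_ind (V := K^o) (Q := fun v => v = 0) (prim_counit_linear hN)) => //.
  by move=> c u v -> ->; rewrite scaler0 addr0.
case=> -[|i s] e; first by move: m0; rewrite -e weight_nil.
by rewrite nsym_word_cons (prim_counit_mul hN) NSym_counit_Lam mul0r.
Qed.

(** Solving S(lambda(-t)) lambda(-t) = 1 degree by degree expresses S(Lambda_{m+1}) through the
    products S(Lambda_i) Lambda_{m+1-i} with i <= m. *)
Lemma nsym_piece_antipode_Lam m : piece m (@hantipode K H (Lam K m)).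
Proof.
have S_lin : linear (@hantipode K H) := prim_antipode_linear hN.
have S1 : @hantipode K H 1 = 1 := prim_antipode_one hN.
elim/ltn_ind: m => -[_|m IH]; first by rewrite S1; exact: nsym_piece1.
have h : @hantipode K H ((-1) ^+ m.+1 *: Lam K m.+1) =
    - (\sum_(i < m.+1) @hantipode K H ((-1) ^+ i *: Lam K i) *
        ((-1) ^+ (m.+1 - i) *: Lam K (m.+1 - i))).
  exact: pcoef_linv m (NSym_antipode_Lam K) (lam_neg0 K).
have -> : Lam K m.+1 = (-1) ^+ m.+1 *: ((-1) ^+ m.+1 *: Lam K m.+1) :> N.
  by rewrite scalerA -expr2 sqrr_sign scale1r.
rewrite (linZ S_lin) h; apply: nsym_pieceZ; rewrite -scaleN1r; apply: nsym_pieceZ.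
apply: big_ind => [|x y hx hy|i _]; first exact: nsym_piece0.
  by rewrite -[x]scale1r; exact: nsym_piece_lin.
rewrite (linZ S_lin) -scalerAl; apply: nsym_pieceZ; rewrite -scalerAr; apply: nsym_pieceZ.
have := @nsym_pieceM i (m.+1 - i) _ _ (IH i (ltn_ord i)) (@nsym_piece_Lam (m.+1 - i)).
by rewrite subnKC // ltnW.
Qed.

Lemma nsym_piece_antipode m x : piece m x -> piece m (@hantipode K H x).
Proof.
have S_lin : linear (@hantipode K H) := prim_antipode_linear hN.
apply: (nsym_piece_ind (Q := piece m) S_lin (@nsym_piece0 m)).
  by move=> c u v; exact: nsym_piece_lin.
move=> [s] <- {x}; elim: s => [|i s IH].
  by rewrite nsym_word_nil weight_nil (prim_antipode_one hN); exact: nsym_piece1.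
rewrite weight_cons nsym_word_cons (prim_antipode_mul hN) addnC.
exact: (nsym_pieceM IH (@nsym_piece_antipode_Lam _)).
Qed.

Lemma NSym_graded : graded_hopf_facts H.
Proof.
split.
- exact: prim_comul_linear hN.
- exact: nsym_piece_comul.
- exact: prim_counit_linear hN.
- exact: nsym_piece_counit.
- exact: prim_antipode_linear hN.
- exact: nsym_piece_antipode.
Qed.

Local Notation Q := (gdual_type H).

Lemma dual_word_in (w : {fmonom nat}) : in_gdual (fun x : H => (x : N)@_w : K^o).
Proof.
split; first by move=> c x y; rewrite mcoeffD mcoeffZ.
exists (weight w).+1 => m x ltwm /nsym_pieceP hx; apply: hx.
by rewrite neq_ltn ltwm.
Qed.

Definition dual_word (w : {fmonom nat}) : Q := to_gdual (fun x : H => (x : N)@_w : K^o).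

Lemma dual_wordE w (x : N) : dual_word w x = x@_w.
Proof. by rewrite [LHS](f_equal (fun h => h x) (to_gdualE (dual_word_in w))). Qed.

(** A word of weight below M has fewer than M letters, each below M, so it occurs in this finite
    list. Heavier words occur as well; the expansions below accept any list that is long enough. *)
Definition words_below (M : nat) : seq {fmonom nat} :=
  undup [seq FMonom w | w <- words_upto (iota 0 M) M].

Lemma mem_words_below M w : (weight w < M)%N -> w \in words_below M.
Proof.
case: w => w; rewrite /weight /= => hw; rewrite mem_undup; apply: map_f.
apply: mem_words_upto.
  apply: leq_ltn_trans hw; elim: w => //= i s IH; rewrite big_cons.
  by rewrite -add1n leq_add.
move=> i iw; rewrite mem_iota /= add0n; apply: leq_ltn_trans hw.
by rewrite (big_rem i iw) /= (leq_trans (leqnSn i)) // leq_addr.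
Qed.

Lemma gdual_sumE I (r : seq I) (c : I -> K) (g : I -> Q) (x : H) :
  (\sum_(i <- r) c i *: g i : Q) x = \sum_(i <- r) c i * g i x.
Proof. by elim/big_rec2: _ => // i y f _ <-. Qed.

(** A functional of the graded dual vanishes on all words of large weight. The quantification over
    every sufficiently long list allows several functionals to be expanded over a common one. *)
Lemma gdual_expand (f : Q) : exists M, forall L : seq {fmonom nat}, uniq L ->
  (forall w, weight w < M -> w \in L)%N ->
  f = \sum_(w <- L) f (<< w >> : N) *: dual_word w.
Proof.
have [f_lin [M hM]] := gdualP f; exists M => L uL sL; apply: gdual_ext.
set g := (\sum_(w <- L) _ : Q).
apply: (@malg_ext K _ K^o f g f_lin (gdual_linear g)) => v; rewrite {}/g.
rewrite gdual_sumE.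
transitivity (\sum_(w <- L) f (<< w >> : N) * (v == w)%:R).
  2: by apply: eq_bigr => w _; rewrite dual_wordE mcoeffU1.
have [vL|nvL] := boolP (v \in L).
  rewrite (bigD1_seq v) //= eqxx mulr1 big1 ?addr0 // => w ne.
  by rewrite eq_sym (negbTE ne) mulr0.
rewrite big_seq big1 => [|w wL].
  apply: (hM (weight v)); last exact: nsym_pieceU.
  by rewrite leqNgt; apply: contra nvL; exact: sL.
by case: eqP => [e|_]; [rewrite -e (negbTE nvL) in wL|rewrite mulr0].
Qed.

Lemma tens_gdual_expand (x : tens Q Q) : exists M, forall L : seq {fmonom nat}, uniq L ->
  (forall w, weight w < M -> w \in L)%N ->
  x = \sum_(v <- L) \sum_(w <- L)
        @tens_pairing K H x << v >> << w >> *: pure (dual_word v) (dual_word w).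
Proof.
elim/tens_ind: x => [|c f g x [M hM]].
  exists 0%N => L _ _; apply/esym/big1 => v _; apply: big1 => w _.
  by rewrite (lin0 (@tens_pairing_linear K H _ _)) scale0r.
have [Mf hf] := gdual_expand f; have [Mg hg] := gdual_expand g.
exists (maxn M (maxn Mf Mg)) => L uL sL.
have sub M' : (M' <= maxn M (maxn Mf Mg))%N -> forall w, (weight w < M')%N -> w \in L.
  by move=> le w lt; apply: sL; exact: leq_trans lt le.
have ex := hM L uL (sub _ (leq_maxl _ _)).
have ef : f = \sum_(w <- L) f (<< w >> : N) *: dual_word w.
  by apply: hf => //; apply: sub; rewrite !leq_max leqnn orbT.
have eg : g = \sum_(w <- L) g (<< w >> : N) *: dual_word w.
  by apply: hg => //; apply: sub; rewrite !leq_max leqnn !orbT.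
apply: etrans (f_equal2 (fun s t => c *: s + t) (f_equal2 (@pure K Q Q) ef eg) ex) _.
apply: etrans (pure_sum_lin _ _ _ _ _ _ _) _.
apply: eq_bigr => v _; apply: eq_bigr => w _.
apply: (f_equal (fun t => t *: (pure (dual_word v) (dual_word w) : tens Q Q))).
apply: esym; apply: etrans (@tens_pairing_linear K H << v >> << w >> c (pure f g) x) _.
by rewrite tens_pairing_pure.
Qed.

(** Over a common list of words, the coefficients of both expansions are pairings with words, hence
    equal. *)
Lemma QSym_pairing_inj (x y : tens Q Q) :
  (forall u v, @tens_pairing K H x u v = @tens_pairing K H y u v) -> x = y.
Proof.
move=> h; have [M hM] := tens_gdual_expand x; have [M' hM'] := tens_gdual_expand y.
pose L := words_below (maxn M M').
have sL w : (weight w < maxn M M')%N -> w \in L by exact: mem_words_below.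
apply: etrans (hM L (undup_uniq _) _) _ => [w lt|].
  by apply: sL; rewrite leq_max lt.
apply: etrans (esym (hM' L (undup_uniq _) _)) => [|w lt]; last first.
  by apply: sL; rewrite leq_max lt orbT.
apply: eq_bigr => v _; apply: eq_bigr => w _.
exact: (f_equal (fun t => t *: (pure (dual_word v) (dual_word w) : tens Q Q)) (h _ _)).
Qed.

End NSymPieces.

(** * The coproduct on the dual of the enveloping algebra *)

Section Splits.
Variable I : Type.
Implicit Types s u v : seq I.

(** The unshuffles of s: all pairs formed by a subsequence and its complement, with repetitions.
    They index the coproduct of a product of primitive elements. *)
Fixpoint splits s : seq (seq I * seq I) :=
  if s is x :: s' then
    [seq (x :: p.1, p.2) | p <- splits s'] ++ [seq (p.1, x :: p.2) | p <- splits s']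
  else [:: ([::], [::])].

Lemma big_splits (V : nmodType) (F : seq I -> seq I -> V) x s :
  \sum_(p <- splits (x :: s)) F p.1 p.2 =
  \sum_(p <- splits s) F (x :: p.1) p.2 + \sum_(p <- splits s) F p.1 (x :: p.2).
Proof. by rewrite /= big_cat !big_map. Qed.

End Splits.

Section SplitsEq.
Variable I : eqType.
Implicit Types s : seq I.

Lemma size_splits s p : p \in splits s -> (size p.1 + size p.2)%N = size s.
Proof.
elim: s p => [|x s IH] p /=; first by rewrite inE => /eqP ->.
by rewrite mem_cat => /orP[] /mapP[q /IH <- ->] /=; rewrite ?addSn ?addnS.
Qed.

Lemma sub_splits s p : p \in splits s -> {subset p.1 <= s} /\ {subset p.2 <= s}.
Proof.
elim: s p => [|x s IH] p /=; first by rewrite inE => /eqP ->.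
have sub (t : seq I) : {subset t <= s} -> {subset x :: t <= x :: s}.
  by move=> h y; rewrite !inE => /orP[->//|/h ->]; rewrite orbT.
have sub' (t : seq I) : {subset t <= s} -> {subset t <= x :: s}.
  by move=> h y /h ys; rewrite inE ys orbT.
by rewrite mem_cat => /orP[] /mapP[q /IH[h1 h2] ->] /=; split; auto.
Qed.

Lemma count_splits0 s : count (fun p => size p.1 == 0%N) (splits s) = 1%N.
Proof.
elim: s => //= x s IH; rewrite count_cat !count_map /= -[RHS]IH.
by rewrite (@eq_count _ _ pred0) ?count_pred0.
Qed.

(** The number of ways to extract one letter; it supplies the new factor each time a factorial
    grows. *)
Lemma count_splits1 s : count (fun p => size p.1 == 1%N) (splits s) = size s.
Proof.
elim: s => //= x s IH; rewrite count_cat !count_map.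
transitivity (1 + size s)%N; last by rewrite add1n.
congr addn; last exact: IH.
rewrite -[RHS](count_splits0 s).
by apply: eq_count => p /=; rewrite eqSS.
Qed.
End SplitsEq.

Lemma commutator1 (R : pzRingType) (x : R) : 1 * x - x * 1 = 0.
Proof. by rewrite mul1r mulr1 subrr. Qed.

Lemma commutatorM (R : pzRingType) (x y w : R) :
  (x * w) * y - y * (x * w) = x * (w * y - y * w) + (x * y - y * x) * w.
Proof. by rewrite mulrBr mulrBl !mulrA addrA subrK. Qed.

Lemma commutator_split (R : pzRingType) (u v x w : R) :
  u * (x * v) - x * w = (u * x - x * u) * v + x * (u * v - w).
Proof. by rewrite mulrBl mulrBr !mulrA addrA subrK. Qed.

Lemma mulA_subr (R : pzRingType) (u v x w : R) :
  (x * u) * v - x * w = x * (u * v - w).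
Proof. by rewrite mulrBr mulrA. Qed.

Lemma mul11_sub1 (R : pzRingType) : 1 * 1 - 1 = 0 :> R.
Proof. by rewrite mulr1 subrr. Qed.

Lemma bilinear_mul_sum (K : comNzRingType) (T : lmodType K) (m : T -> T -> T)
    (u v : T) I (L : seq I) (w : I -> T) :
  (forall y, linear (m^~ y)) -> (forall x, linear (m x)) ->
  m (u + v) (\sum_(i <- L) w i) = \sum_(i <- L) m v (w i) + \sum_(i <- L) m u (w i).
Proof. by move=> ml mr; rewrite (linD (ml _)) !(lin_sum (mr _)) addrC. Qed.

Lemma tens_mul_primitive (K : comNzRingType) (A : algType K)
    (x : (A : lalgType K)) I (L : seq I) (f g : I -> (A : lalgType K)) :
  tens_mul (pure 1 x + pure x 1) (\sum_(i <- L) pure (f i) (g i)) =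
  \sum_(i <- L) pure (x * f i) (g i) + \sum_(i <- L) pure (f i) (x * g i).
Proof.
apply: etrans (bilinear_mul_sum _ _ _ _ (@tens_mul_linl K A) (@tens_mul_linr K A)) _.
by apply: (f_equal2 +%R); apply: eq_bigr => i _; rewrite tens_mul_pure mul1r.
Qed.

Lemma scaled_sub (K : comNzRingType) (V : lmodType K) (c d : K) (x y : V) :
  c * d = 1 -> x - c *: y = (- c) *: (y - d *: x).
Proof. by move=> cd; rewrite scalerBr !scaleNr scalerA cd scale1r opprK addrC. Qed.

Lemma sum_delta (K : comNzRingType) (V : lmodType K) (I : eqType) (L : seq I) (q : I)
    (c : I -> K) (F : I -> V) : uniq L -> q \in L ->
  (forall p, p \in L -> c p = (p == q)%:R) -> \sum_(p <- L) c p *: F p = F q.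
Proof.
move=> uL qL hc; rewrite (bigD1_seq q) //= hc // eqxx scale1r big_seq_cond big1 ?addr0 //.
by move=> p /andP[pL ne]; rewrite hc // (negbTE ne) scale0r.
Qed.

Lemma sum3_distr (R : pzRingType) (I J S : Type) (L : seq I) (M : seq J) (Q : seq S)
    (A : S -> I -> R) (B : S -> J -> R) :
  \sum_(i <- L) \sum_(j <- M) \sum_(s <- Q) A s i * B s j =
  \sum_(s <- Q) (\sum_(i <- L) A s i) * (\sum_(j <- M) B s j).
Proof.
under [RHS]eq_bigr do rewrite big_distrlr /=.
rewrite [RHS]exchange_big /=; apply: eq_bigr => i _.
by rewrite [RHS]exchange_big.
Qed.

Lemma mul_sub_scale (K : comNzRingType) (A : algType K) (c : K) (x f v w : A) :
  x * f - c *: w = x * (f - c *: v) + c *: (x * v - w).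
Proof. by rewrite mulrBr scalerBr -scalerAr addrA subrK. Qed.

Lemma subr_rearrange (V : zmodType) (x f q g : V) :
  x - (f + (q - g)) = x - q - (f - g).
Proof. by rewrite opprD !opprB [- f + _]addrC addrAC addrA addrAC. Qed.

Section Frames.
Variables (K : comAlgType rat) (k : varkind) (n a : nat).
Hypothesis a_gt1 : (1 < a)%N.
Local Notation P := (pol K k n).
Local Notation der := (der K k n a).
Local Notation env := (env K k n a).
Local Notation z := (zvar K k).
Local Notation piece := (@env_piece K k n a).
Local Notation J := ('I_n * mono k n)%type.
Let H := DiffOp K k n a.
Let hE := DiffOp_hopf K k n a.
Let a_gt0 : (0 < a)%N. Proof. exact: ltnW. Qed.
Local Notation G := (gdual_type H).

(** Values of the elementary derivation z_i -> m attached to p = (i, m). A monomial of degree below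
    a is replaced by 0, so that the family is indexed by all pairs. *)
Definition basis_val (p : J) (i : 'I_n) : P :=
  if (i == p.1) && (a <= mono_deg p.2)%N then << p.2 >> else 0.

Lemma basis_val_ord p i : ord_ge a (basis_val p i).
Proof.
rewrite /basis_val; case: ifP => [/andP[_ h]|_]; last exact: (@deg_in0 K k n (fun j => (a <= j)%N)).
by move=> m /deg_in_mono ->.
Qed.

Lemma basis_der_subproof p : @is_der K k n a (pol_deriv (basis_val p)).
Proof.
split; [exact: pol_deriv_linear|exact: pol_derivM|].
by move=> i; rewrite pol_deriv_zvar; exact: basis_val_ord.
Qed.

Definition basis_der (p : J) : der := Der (basis_der_subproof p).

Lemma basis_der_zvar p i : basis_der p (z i) = basis_val p i.
Proof. exact: pol_deriv_zvar. Qed.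

Definition basis_elt (p : J) : env := env_der (basis_der p).
Local Notation E := basis_elt.

(** The derivation z_i -> m has degree one less than m. The maximum with 1 changes this only where
    the element is 0, because a >= 2, and it makes every letter weigh at least 1. *)
Definition basis_wt (p : J) : nat := maxn 1 (mono_deg p.2).-1.

Lemma env_der0 (d : der) : (forall i, d (z i) = 0) -> env_der d = 0.
Proof.
move=> h; have d0 : d =1 (fun=> 0).
  apply: derivation_ext h; [exact: der_linear| |exact: derM|].
    by move=> c p q; rewrite scaler0 addr0.
  by move=> p q; rewrite mulr0 mul0r addr0.
rewrite (@env_der_lin _ _ _ _ (-1) d d d) ?scaleN1r ?addNr // => p.
by rewrite scaleN1r addNr d0.
Qed.

Lemma basis_elt0 p : (mono_deg p.2 < a)%N -> E p = 0.
Proof.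
move=> lt; apply: env_der0 => i.
by rewrite basis_der_zvar /basis_val leqNgt lt andbF.
Qed.

Lemma basis_elt_piece p : piece (basis_wt p) (E p).
Proof.
have [lt|le] := ltnP (mono_deg p.2) a; first by rewrite basis_elt0 //; exact: env_piece_zero.
apply: env_piece_der; apply: homog_derP => i; rewrite basis_der_zvar /basis_val.
case: ifP => _; last exact: homog0.
move=> m /deg_in_mono ->; rewrite /basis_wt.
have gt1 : (1 < mono_deg p.2)%N by exact: leq_trans le.
have -> : maxn 1 (mono_deg p.2).-1 = (mono_deg p.2).-1.
  by apply/maxn_idPr; rewrite -ltnS prednK // ltnW.
by rewrite prednK // ltnW.
Qed.

Lemma env_der_lincomb (d : der) (L : seq J) (c : J -> K) :
  (forall i, d (z i) = \sum_(p <- L) c p *: basis_val p i) ->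
  env_der d = \sum_(p <- L) c p *: E p.
Proof.
elim: L d => [|p L IH] d hd.
  by rewrite big_nil env_der0 // => i; rewrite hd big_nil.
have [|d' hd'] := @der_exists K k n a (fun i => \sum_(p <- L) c p *: basis_val p i).
  move=> i; apply: (@deg_in_sum K k n (fun j => (a <= j)%N)) => q _.
    by apply: (@deg_inZ K k n (fun j => (a <= j)%N)); exact: basis_val_ord.
rewrite big_cons -(IH d' hd'); apply: env_der_lin.
apply: derivation_ext; [exact: der_linear| |exact: derM| |].
- move=> b x y; rewrite !der_linear !scalerDr !scalerA [c p * b]mulrC.
  exact: addrACA.
- move=> x y; rewrite !derM scalerDr mulrDl mulrDr scalerAl scalerAr.
  exact: addrACA.
by move=> i; rewrite hd big_cons basis_der_zvar hd'.
Qed.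

Lemma env_der_basis (d : der) : exists L c, env_der d = \sum_(p <- L) c p *: E p.
Proof.
exists (flatten [seq [seq (i, m) | m <- msupp (d (z i))] | i <- enum 'I_n]).
exists (fun p => (d (z p.1))@_(p.2)); apply: env_der_lincomb => j.
rewrite big_flatten /= big_map big_enum /= (bigD1 j) //= [X in _ + X]big1 => [|i ne].
  rewrite addr0 big_map {1}(monalgE (d (z j))) big_seq [RHS]big_seq.
  apply: eq_bigr => m hm; rewrite malgUZ /basis_val /= eqxx /=.
  by have -> : (a <= mono_deg m)%N by case: (derP d) => _ _ /(_ j); exact.
rewrite big_map big1 // => m _; rewrite /basis_val /= eq_sym (negbTE ne) /=.
exact: scaler0.
Qed.

Definition word (s : seq J) : env := \prod_(p <- s) E p.

Lemma word_cons p s : word (p :: s) = E p * word s.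
Proof. exact: big_cons. Qed.
Lemma word_nil : word [::] = 1.
Proof. exact: big_nil. Qed.

(** Every derivation is a finite combination of elementary ones, so words in these span the
    enveloping algebra. *)
Lemma env_word_ind (Q : env -> Prop) : Q 0 ->
  (forall c x y, Q x -> Q y -> Q (c *: x + y)) -> (forall s, Q (word s)) ->
  forall x, Q x.
Proof.
move=> Q0 Ql Qw x.
suff : span (fun x => exists s, x = word s) x.
  by elim=> [_ [s ->]||c y y' _ hy _ hy'] //; exact: Ql.
have wM y : span (fun x => exists s, x = word s) y -> forall d : der,
    span (fun x => exists s, x = word s) (env_der d * y).
  move=> hy d; have [L [c ->]] := env_der_basis d.
  apply: (span_linear (@mull_linear K env _)) hy => _ [s ->].
  rewrite mulr_suml; elim/big_rec: _ => [|p t _ ht]; first exact: span_0.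
  rewrite -scalerAl; apply: span_lin ht; apply: span_gen.
  by exists (p :: s); rewrite word_cons.
rewrite -[x]of_quotK; move: (of_quot x) => {}x.
rewrite (monalgE x) (lin_sum (@qenv_linear K k n a)).
elim/big_rec: _ => [|w t _ ht]; first exact: span_0.
rewrite malgUZ (linZ (@qenv_linear K k n a)); apply: span_lin ht.
case: w => s; rewrite qenv_word; elim: s => [|d s IH].
  by apply: span_gen; exists [::]; rewrite word_nil big_nil.
by rewrite big_cons; exact: wM.
Qed.

Lemma word_cat s t : word (s ++ t) = word s * word t.
Proof. exact: big_cat. Qed.

(** The length filtration of the enveloping algebra with a strict bound, so that [fil 0] is zero and
    can start an induction. *)
Definition fil (r : nat) : env -> Prop :=
  span (fun x => exists2 s, (size s < r)%N & x = word s).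

Lemma fil0 r : fil r 0. Proof. exact: span_0. Qed.
Lemma fil_lin r c x y : fil r x -> fil r y -> fil r (c *: x + y).
Proof. exact: span_lin. Qed.
Lemma filD r x y : fil r x -> fil r y -> fil r (x + y).
Proof. by move=> hx hy; rewrite -[x]scale1r; exact: fil_lin. Qed.
Lemma filZ r c x : fil r x -> fil r (c *: x).
Proof. by move=> hx; have := fil_lin c hx (fil0 r); rewrite addr0. Qed.
Lemma fil_sum r I (L : seq I) (R : pred I) (F : I -> env) :
  (forall i, R i -> fil r (F i)) -> fil r (\sum_(i <- L | R i) F i).
Proof. by move=> h; apply: big_ind => //; [exact: fil0|exact: filD]. Qed.

Lemma fil_word r s : (size s < r)%N -> fil r (word s).
Proof. by move=> h; apply: span_gen; exists s. Qed.

Lemma filM i j x y : fil i.+1 x -> fil j y -> fil (i + j) (x * y).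
Proof.
move=> hx hy; move: x hx; apply: (span_linear (@mulr_linear K env y)) => _ [s hs ->].
move: y hy; apply: (span_linear (@mull_linear K env (word s))) => _ [t ht ->].
by rewrite -word_cat; apply: fil_word; rewrite size_cat -addnS leq_add.
Qed.

Lemma fil_elt p : fil 2 (E p).
Proof. by rewrite -[E p]mulr1 -word_nil -word_cons; exact: fil_word. Qed.

Lemma fil_bracket p q : fil 2 (E p * E q - E q * E p).
Proof.
have [d hd] := der_bracket_exists a_gt0 (basis_der p) (basis_der q).
rewrite (env_der_bracket hd); have [L [c ->]] := env_der_basis d.
by apply: fil_sum => r _; apply: filZ; exact: fil_elt.
Qed.

Lemma word_comm s p : fil (size s).+1 (word s * E p - E p * word s).
Proof.
elim: s => [|q s IH]; first by rewrite word_nil commutator1; exact: fil0.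
rewrite word_cons commutatorM.
apply: filD; first exact: (filM (fil_elt q) IH).
exact: (filM (fil_bracket q p) (fil_word (ltnSn (size s)))).
Qed.

(** The commutator of two letters is again a derivation, so reordering a word changes it by shorter
    words only. *)
Lemma splits_word s p : p \in splits s -> fil (size s) (word p.1 * word p.2 - word s).
Proof.
elim: s p => [|q s IH] p /=.
  by rewrite inE => /eqP -> /=; rewrite word_nil mul11_sub1; exact: fil0.
rewrite mem_cat => /orP[] /mapP[r hr ->] /=.
  by rewrite !word_cons mulA_subr; exact: (filM (fil_elt q) (IH _ hr)).
rewrite !word_cons commutator_split.
apply: filD; last exact: (filM (fil_elt q) (IH _ hr)).
rewrite -(size_splits hr) -addnS.
exact: (filM (word_comm _ _) (fil_word (ltnSn _))).
Qed.

Lemma DiffOp_graded : graded_hopf_facts H.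
Proof.
split.
- exact: prim_comul_linear hE.
- exact: env_piece_comul hE.
- exact: prim_counit_linear hE.
- exact: env_piece_counit hE.
- exact: prim_antipode_linear hE.
- exact: env_piece_antipode hE.
Qed.

Lemma comul_word s :
  @hcomul K H (word s) = \sum_(p <- splits s) pure (word p.1) (word p.2).
Proof.
elim: s => [|q s IH].
  by rewrite word_nil (prim_comul_one hE) big_seq1 word_nil.
rewrite word_cons (prim_comul_mul hE) IH (prim_comul_prim hE); last by exists (basis_der q).
apply: etrans (tens_mul_primitive _ _ _ _) _; apply: esym.
apply: etrans (big_splits (fun u v => pure (word u) (word v) : tens env env) _ _) _.
by apply: f_equal2; apply: eq_bigr => p _; rewrite word_cons.
Qed.

Lemma conv_word (f g : gdual H) s :
  (hmul f g : G) (word s) =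
  \sum_(p <- splits s) (f : G) (word p.1) * (g : G) (word p.2).
Proof.
exact: (gdual_mul_sum DiffOp_graded f g (comul_word s)).
Qed.

(** On the nonzero elementary derivations these functionals form the dual family. Their values on
    words of length at least 2 are uncontrolled; the filtration argument absorbs them. *)
Definition coord (p : J) (x : env) : K^o := (act x (z p.1))@_(p.2).

Lemma coord_linear p : linear (coord p).
Proof. by move=> c x y; rewrite /coord act_linear mcoeffD mcoeffZ. Qed.

Lemma coord_piece p j x : mono_deg p.2 != j.+1 -> piece j x -> coord p x = 0.
Proof.
move=> ne hx; have h : homog 1 (z p.1) := @deg_in_zvar K k n p.1.
by have /homogP hh := act_homog hx h; apply: hh; rewrite addn1.
Qed.

Lemma coord_in p : in_gdual (coord p : H -> K^o).
Proof.
split; first exact: coord_linear.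
exists (mono_deg p.2) => m x le hx; apply: coord_piece hx.
by rewrite neq_ltn ltnS le.
Qed.

Definition coordG (p : J) : gdual H := @to_gdual K H (coord p).

Lemma coordGE p (x : env) : (coordG p : G) x = coord p x.
Proof. by rewrite [LHS](f_equal (fun h => h x) (to_gdualE (coord_in p))). Qed.

Lemma coord1 p : (a <= mono_deg p.2)%N -> coord p 1 = 0.
Proof.
move=> le; apply: (coord_piece (j := 0)) (env_piece_one _ _ _ _).
by rewrite neq_ltn (leq_trans a_gt1) // orbT.
Qed.

Lemma coord_elt p q : (a <= mono_deg q.2)%N -> coord p (E q) = (p == q)%:R.
Proof.
move=> le; rewrite /coord act_der basis_der_zvar /basis_val le andbT.
rewrite -pair_eqE /pair_eq /=; case: eqP => _; last by rewrite mcoeff0.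
by rewrite mcoeffU1 eq_sym.
Qed.

Definition monos_upto (N : nat) : seq (mono k n) :=
  undup [seq \big[mmul/mone]_(i <- w) mono_var k i | w <- words_upto (enum 'I_n) N.+1].

Lemma mem_monos_upto N m : (mono_deg m <= N)%N -> m \in monos_upto N.
Proof.
move=> leN; rewrite mem_undup; apply/mapP.
exists (mono_letters m); last by rewrite mono_prodK.
by apply: mem_words_upto => [|j _]; rewrite ?size_mono_letters ?mem_enum.
Qed.

Definition basis_upto (N : nat) : seq J :=
  [seq p <- [seq (i, m) | i <- enum 'I_n, m <- monos_upto N] | (a <= mono_deg p.2)%N].

Lemma basis_upto_uniq N : uniq (basis_upto N).
Proof.
apply: filter_uniq; apply: allpairs_uniq; [exact: enum_uniq|exact: undup_uniq|].
by move=> [x1 y1] [x2 y2].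
Qed.

Lemma basis_uptoP N p : p \in basis_upto N -> (a <= mono_deg p.2)%N.
Proof. by rewrite mem_filter => /andP[]. Qed.

Lemma mem_basis_upto N p : (a <= mono_deg p.2 <= N)%N -> p \in basis_upto N.
Proof.
case: p => i m /= /andP[le leN]; rewrite mem_filter /= le /=.
by apply: allpairs_f; [rewrite mem_enum|exact: mem_monos_upto].
Qed.

Lemma scaler_linear (K' : comNzRingType) (V W : lmodType K') (f : V -> K'^o) (w : W) :
  linear f -> linear (fun v => (f v : K') *: w).
Proof. by move=> hf c x y; rewrite hf scalerDl -scalerA. Qed.

(* A finite family (g_q, x_q) such that x = sum_q g_q(x) x_q modulo large
   degrees yields the coproduct of f in the dual, namely
   sum_q g_q (x) f(x_q . _); this replaces a Poincare-Birkhoff-Witt basis. *)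
Definition frame := seq (gdual H * env).

Definition fapp (F : frame) (x : env) : env := \sum_(q <- F) ((q.1 : G) x : K) *: q.2.

Lemma fapp_linear F : linear (fapp F).
Proof.
apply: sum_linear => q; exact: (scaler_linear q.2 (gdual_linear q.1)).
Qed.

(** Functional and element share one degree, which makes [fapp] preserve degrees. *)
Definition homog_pair (q : gdual H * env) : Prop :=
  exists2 j, hpiece j q.1 & piece j q.2.

Definition homog_frame (F : frame) : Prop := forall q, q \in F -> homog_pair q.

Lemma fapp_piece F j x : homog_frame F -> piece j x -> piece j (fapp F x).
Proof.
move=> hF hx; rewrite /fapp; elim: F hF => [|q F IH] hF.
  by rewrite big_nil; exact: env_piece_zero.
rewrite big_cons; apply: env_pieceD; last by apply: IH => r hr; apply: hF; rewrite inE hr orbT.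
have [i hq1 hq2] := hF q (mem_head _ _).
have [<-|ne] := eqVneq i j; first exact: env_pieceZ.
rewrite (hq1 j x) ?scale0r; [exact: env_piece_zero|by rewrite eq_sym|exact: hx].
Qed.

Section Truncated.
Variable N : nat.

Definition proj (x : env) : env := \sum_(p <- basis_upto N) ((coordG p : G) x : K) *: E p.

Lemma proj1 : proj 1 = 0.
Proof.
rewrite /proj big_seq; apply: big1 => p /basis_uptoP le.
by rewrite coordGE coord1 // scale0r.
Qed.

Lemma proj_elt q : q \in basis_upto N -> proj (E q) = E q.
Proof.
move=> hq; have hc p : p \in basis_upto N -> (coordG p : G) (E q) = (p == q)%:R.
  by move=> _; exact: etrans (coordGE p _) (coord_elt p (basis_uptoP hq)).
exact: (@sum_delta K env J (basis_upto N) q (fun p => (coordG p : G) (E q)) E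
  (basis_upto_uniq N) hq hc).
Qed.

(* It represents the r-th convolution power of proj, which kills the words
   shorter than r and multiplies those of length r by r`!, modulo shorter
   words. *)
Fixpoint power_frame (r : nat) : frame :=
  if r is r'.+1 then
    [seq (hmul (coordG p) q.1, E p * q.2) | p <- basis_upto N, q <- power_frame r']
  else [:: (hone (gdual H), 1)].

Lemma power_frame0 x : fapp (power_frame 0) x = @hcounit K H x *: (1 : env).
Proof. by rewrite /fapp big_seq1 (gdual_oneE DiffOp_graded). Qed.

(** The convolution of [proj] with the r-th power: the coproduct of a word runs over its
    unshuffles. *)
Lemma power_frameS r s : fapp (power_frame r.+1) (word s) =
  \sum_(p <- splits s) proj (word p.1) * fapp (power_frame r) (word p.2).
Proof.
rewrite /fapp big_allpairs_dep /=.
transitivity (\sum_(q <- basis_upto N) \sum_(i <- power_frame r)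
   \sum_(p <- splits s) (((coordG q : G) (word p.1) : K) *: E q) *
     (((i.1 : G) (word p.2) : K) *: i.2)).
  apply: eq_bigr => q _; apply: eq_bigr => i _.
  rewrite conv_word scaler_suml; apply: eq_bigr => p _.
  by rewrite -scalerAl -scalerAr scalerA.
exact: sum3_distr.
Qed.

Lemma power_frame_homog r : homog_frame (power_frame r).
Proof.
elim: r => [|r IH] q.
  rewrite inE => /eqP -> /=; exists 0%N; last exact: env_piece_one.
  move=> j u ne hu; rewrite (gdual_oneE DiffOp_graded).
  by apply: (env_piece_counit hE hu); rewrite lt0n.
case/allpairsP => -[p q'] /= [hp /IH[j h1 h2] ->] /=.
exists (basis_wt p + j)%N; last exact: env_pieceM (basis_elt_piece p) h2.
apply: (gdual_mul_piece DiffOp_graded) h1 => i u ne hu.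
rewrite coordGE; apply: coord_piece hu; apply: contra ne => /eqP e.
have le := basis_uptoP hp; rewrite /basis_wt e /=; apply/eqP/esym/maxn_idPr.
by rewrite -ltnS -e (leq_trans a_gt1).
Qed.

(** Since [proj] kills 1, each of the r convolution factors must receive at least one letter. *)
Lemma power_frame_lt r s : (size s < r)%N -> fapp (power_frame r) (word s) = 0.
Proof.
elim: r s => // r IH s; rewrite ltnS => le; rewrite power_frameS big_seq.
apply: big1 => -[[|x u] v] hp /=; first by rewrite word_nil proj1 mul0r.
rewrite [X in _ * X]IH ?mulr0 //; have /= := size_splits hp.
by rewrite addSn => e; apply: leq_trans le; rewrite -e ltnS leq_addl.
Qed.

(** Among the unshuffles of a word of length r + 1, those with empty first part are killed by
    [proj], and those with two or more letters there leave too few for the r-th power. The r + 1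
    remaining ones extract a single letter, and each contributes r! times the word modulo shorter
    words. *)
Lemma power_frame_eq r s : {subset s <= basis_upto N} -> size s = r ->
  fil r (fapp (power_frame r) (word s) - r`!%:R *: word s).
Proof.
elim: r s => [|r IH] s hs sz.
  rewrite (size0nil sz) word_nil power_frame0 (prim_counit_one hE).
  have -> : 0`!%:R = 1 :> K by [].
  have -> : (1 : K) *: (1 : env) - (1 : K) *: (1 : env) = 0 by exact: subrr.
  exact: fil0.
rewrite power_frameS.
have term p : p \in splits s -> fil r.+1 (proj (word p.1) * fapp (power_frame r) (word p.2)
    - (r`!%:R *+ (size p.1 == 1%N)) *: word s).
  case: p => -[|x [|y u]] v hp /=.
  - by rewrite word_nil proj1 mul0r mulr0n scale0r subr0; exact: fil0.
  - have [sub1 sub2] := sub_splits hp; have e := size_splits hp.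
    have xN : x \in basis_upto N by apply/hs/sub1; rewrite mem_head.
    have szv : size v = r by move: e; rewrite /= sz add1n => -[].
    have hv : {subset v <= basis_upto N} by move=> y yv; exact/hs/sub2.
    have wx : word [:: x] = E x by rewrite word_cons word_nil mulr1.
    rewrite wx proj_elt // mulr1n (mul_sub_scale _ _ _ (word v)).
    apply: filD; first exact: (filM (fil_elt x) (IH v hv szv)).
    by apply: filZ; have := splits_word hp; rewrite /= wx sz.
  - rewrite [X in _ * X]power_frame_lt ?mulr0 ?mulr0n ?scale0r ?subr0; first exact: fil0.
    have := size_splits hp; rewrite /= sz !addSn => -[<-].
    by rewrite ltnS leq_addl.
have cnt : r.+1`!%:R = \sum_(p <- splits s) (r`!%:R *+ (size p.1 == 1%N)) :> K.
  rewrite sumrMnr factS mulnC mulrnA -sz -(count_splits1 s) -sum1_count [in LHS]big_mkcond.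
  by congr (_ *+ _); apply: eq_bigr => p _; case: eqP.
rewrite cnt scaler_suml -sumrB big_seq.
by apply: fil_sum => p hp; exact: term.
Qed.

Definition high : env -> Prop := span (fun y => exists2 m, (N <= m)%N & piece m y).

Lemma fapp_high F x : homog_frame F -> high x -> high (fapp F x).
Proof.
move=> hF hx; apply: (span_linear (fapp_linear F)) hx => y [m le hy].
by apply: span_gen; exists m => //; exact: fapp_piece.
Qed.

Definition word_wt (s : seq J) : nat := \sum_(p <- s) basis_wt p.

Lemma word_piece s : piece (word_wt s) (word s).
Proof.
rewrite /word_wt; elim: s => [|p s IH].
  by rewrite big_nil word_nil; exact: env_piece_one.
by rewrite big_cons word_cons; apply: env_pieceM IH; exact: basis_elt_piece.
Qed.

Lemma size_word_wt s : (size s <= word_wt s)%N.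
Proof.
rewrite /word_wt; elim: s => // p s IH.
by rewrite big_cons /= -add1n leq_add // leq_maxl.
Qed.

Lemma high_word s : (N <= word_wt s)%N -> high (word s).
Proof. by move=> h; apply: span_gen; exists (word_wt s) => //; exact: word_piece. Qed.

(** A letter outside the list either has a monomial of degree below a, and is then 0, or a monomial
    of degree above N, and then alone has weight at least N. *)
Lemma high_notin s : ~~ all (mem (basis_upto N)) s -> high (word s).
Proof.
case/allPn => p ps; have [le hp|lt _] := leqP a (mono_deg p.2); last first.
  suff -> : word s = 0 by exact: span_0.
  elim: s ps => // q s IH; rewrite inE word_cons => /orP[/eqP <-|/IH ->].
    by rewrite basis_elt0 // mul0r.
  by rewrite mulr0.
apply: high_word.
have lt : (N < mono_deg p.2)%N.
  by rewrite ltnNge; apply: contra hp => leN; apply: mem_basis_upto; rewrite le.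
rewrite /word_wt (big_rem p ps) /=; apply: leq_trans (leq_addr _ _).
apply: leq_trans (leq_maxr _ _); rewrite -ltnS prednK //.
exact: leq_ltn_trans lt.
Qed.

(** Induction on word length. The r-th convolution power divided by r!, here Q, reproduces words of
    length r modulo shorter ones and kills those shorter words; so x - Q x falls into [fil r], up to
    [high] terms, and the frame F of the previous step takes over. *)
Lemma frame_exists r : exists2 F, homog_frame F & forall x, fil r x -> high (x - fapp F x).
Proof.
have subl (F : frame) : linear (fun x => x - fapp F x).
  move=> c x y; rewrite (fapp_linear F) opprD addrACA scalerBr.
  by [].
elim: r => [|r [F hF IH]].
  exists [::] => // x hx; apply: (span_linear (subl [::])) hx => y [].
  by [].
pose Q : frame := [seq (invfact K r *: q.1, q.2) | q <- power_frame r].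
have hQ : homog_frame Q.
  move=> _ /mapP[q /power_frame_homog[j h1 h2] ->]; exists j => // i u ne hu.
  by rewrite [LHS](_ : _ = invfact K r * (q.1 : G) u) // (h1 i u ne hu) mulr0.
have QE x : fapp Q x = invfact K r *: fapp (power_frame r) x.
  rewrite /fapp big_map scaler_sumr; apply: eq_bigr => q _.
  by rewrite scalerA.
(* Chosen so that id - fapp (F ++ _) = (id - fapp F) o (id - fapp Q). *)
exists (F ++ [seq (q.1, q.2 - fapp F q.2) | q <- Q]).
  move=> q; rewrite mem_cat => /orP[/hF //|/mapP[q' /hQ[j h1 h2] ->]].
  exists j => //=; apply: env_pieceD => //; rewrite -scaleN1r; apply: env_pieceZ.
  exact: fapp_piece.
have FE x : x - fapp (F ++ [seq (q.1, q.2 - fapp F q.2) | q <- Q]) x =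
    (x - fapp Q x) - fapp F (x - fapp Q x).
  have e : fapp (F ++ [seq (q.1, q.2 - fapp F q.2) | q <- Q]) x =
      fapp F x + (fapp Q x - fapp F (fapp Q x)).
    rewrite {1}/fapp big_cat big_map; congr (_ + _).
    rewrite {3}/fapp (lin_sum (fapp_linear F)) -sumrB; apply: eq_bigr => q _.
    by rewrite scalerBr (linZ (fapp_linear F)).
  by rewrite e (linB (fapp_linear F)) subr_rearrange.
have T_lin : linear (fun x => (x - fapp Q x) - fapp F (x - fapp Q x)).
  exact: (comp_linear (subl F) (subl Q)).
move=> x hx; rewrite FE; apply: (span_linear T_lin) hx => _ [s hs ->].
rewrite -/(high _).
(* The formula for Q holds for words in the letters of [basis_upto N]. Any other word is [high], and
   both corrections preserve [high]. *)
have [sN|nsN] := boolP (all (mem (basis_upto N)) s); last first.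
  have hsub G' y : homog_frame G' -> high y -> high (y - fapp G' y).
    move=> hG hy; rewrite addrC -scaleN1r; exact: (span_lin (-1) (fapp_high hG hy) hy).
  exact: (hsub _ _ hF (hsub _ _ hQ (high_notin nsN))).
apply: IH; rewrite QE; have [lt|le] := ltnP (size s) r.
  by rewrite power_frame_lt // scaler0 subr0; exact: fil_word.
have sz : size s = r by apply/eqP; rewrite eqn_leq le andbT -ltnS.
have -> : word s - invfact K r *: fapp (power_frame r) (word s) =
    (- invfact K r) *: (fapp (power_frame r) (word s) - r`!%:R *: word s).
  exact: scaled_sub _ _ (invfactK K r).
by apply: filZ; apply: power_frame_eq => // p ps; exact: (allP sN).
Qed.

(** Every letter has positive weight, so words of length at least N are already [high], and the
    filtration need only be climbed to N. *)
Lemma frame_total : exists2 F, homog_frame F & forall x, high (x - fapp F x).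
Proof.
have [F hF h] := frame_exists N; exists F => // x.
have subl : linear (fun x => x - fapp F x).
  move=> c y y'; rewrite (fapp_linear F) opprD addrACA scalerBr.
  by [].
elim/env_word_ind: x => [|c x y hx hy|s].
- by rewrite (lin0 subl); exact: span_0.
- have -> : c *: x + y - fapp F (c *: x + y) = c *: (x - fapp F x) + (y - fapp F y).
    exact: subl.
  exact: (span_lin c hx hy).
have [lt|le] := ltnP (size s) N; first exact/h/fil_word.
have hs : high (word s) by apply: high_word; exact: leq_trans (size_word_wt s).
by rewrite addrC -scaleN1r; exact: (span_lin (-1) (fapp_high hF hs) hs).
Qed.

End Truncated.

(** The functional f vanishes in degrees at least N and multiplication does not lower degrees, so
    f(uv) depends on u only modulo [high]; there u may be replaced by its frame expansion. *)
Lemma DiffOp_comul_dualizable : comul_dualizable H.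
Proof.
move=> f; have [f_lin [N hN]] := gdualP f; have [F hF h] := frame_total N.
have tr_in (q : gdual H * env) : q \in F -> in_gdual (fun v : H => f (q.2 * (v : env))).
  move=> /hF[j _ hq]; split; first exact: (comp_linear f_lin (@mull_linear K env q.2)).
  exists N => m x le hx; apply: (hN (j + m)%N); last exact: env_pieceM.
  exact: leq_trans (leq_addl _ _).
pose y : tens G G := \sum_(q <- F) pure (q.1 : G) (to_gdual (fun v : H => f (q.2 * (v : env)))).
exists y => u v.
have fhigh x : high N x -> f (x * (v : env)) = 0.
  move=> hx; move: (v : env); apply: env_word_ind => [|c v1 v2 h1 h2|s].
  - by rewrite mulr0 (lin0 f_lin).
  - have -> : x * (c *: v1 + v2) = c *: (x * v1) + x * v2.
      exact: (@mull_linear K env x c v1 v2).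
    exact: (lin_comb0 f_lin c h1 h2).
  have flin : linear (fun x : env => f (x * word s) : K^o).
    exact: (comp_linear f_lin (@mulr_linear K env (word s))).
  elim: hx => [z [m le hz]||c x1 x2 _ h1 _ h2].
  - apply: (hN (m + word_wt s)%N); first exact: leq_trans (leq_addr _ _).
    exact: env_pieceM (word_piece s).
  - exact: (lin0 flin).
  - exact: (lin_comb0 flin c h1 h2).
have e : f ((u : env) * v) = f (fapp F u * (v : env)).
  apply/eqP; rewrite -subr_eq0 -(linB f_lin); apply/eqP.
  apply: etrans (fhigh _ (h u)); congr (f _).
  by rewrite mulrBl.
rewrite [RHS]e /y (lin_sum (tens_pairing_linear u v)).
have flin : linear (fun x : env => f (x * (v : env)) : K^o).
  exact: (comp_linear f_lin (@mulr_linear K env v)).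
rewrite [RHS](lin_sum flin) big_seq [RHS]big_seq; apply: eq_bigr => q hq.
rewrite tens_pairing_pure (to_gdualE (tr_in q hq)).
exact: (esym (linZ flin ((q.1 : G) u) q.2)).
Qed.

End Frames.

(** * The derivations attached to F_t *)

Section PolMap.
Variables (R S : nzRingType) (k : varkind) (n : nat) (f : R -> S).
Hypothesis f0 : f 0 = 0.

Lemma pol_mapE (p : pol R k n) w : (pol_map f p)@_w = f p@_w.
Proof.
rewrite /pol_map (raddf_sum (mcoeff w)) /=.
rewrite (eq_bigr (fun m => f p@_m *+ (m == w))) => [|m _]; last exact: mcoeffU.
have [wp|nwp] := boolP (w \in msupp p).
  rewrite (bigD1_seq w) ?fset_uniq //= eqxx mulr1n big1 ?addr0 // => m ne.
  by rewrite (negbTE ne) mulr0n.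
rewrite (mcoeff_outdom nwp) f0 big_seq big1 // => m mp.
by case: eqP mp nwp => [->|_] // ->.
Qed.

Lemma msupp_pol_map (p : pol R k n) : (msupp (pol_map f p) `<=` msupp p)%fset.
Proof.
apply/fsubsetP => w; rewrite -!mcoeff_neq0 pol_mapE; apply: contra => /eqP ->.
by rewrite f0.
Qed.

Hypotheses (fD : {morph f : x y / x + y}) (fM : {morph f : x y / x * y}).

Lemma pol_mapD : {morph @pol_map R S k n f : p q / p + q}.
Proof. by move=> p q; apply/malgP => w; rewrite mcoeffD !pol_mapE mcoeffD fD. Qed.

Lemma pol_mapM : {morph @pol_map R S k n f : p q / p * q}.
Proof.
move=> p q; apply/malgP => w; rewrite pol_mapE.
rewrite (mcoeffMlw _ (fsubset_refl (msupp p)) (fsubset_refl (msupp q))).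
rewrite (mcoeffMlw _ (msupp_pol_map p) (msupp_pol_map q)).
have fs (I : Type) (r : seq I) (F : I -> R) : f (\sum_(i <- r) F i) = \sum_(i <- r) f (F i).
  exact: (big_morph f fD f0).
rewrite fs; apply: eq_bigr => v _; rewrite fs; apply: eq_bigr => v' _.
by rewrite !pol_mapE; case: eqP; rewrite ?mulr1n ?mulr0n ?fM.
Qed.

End PolMap.

Section PserPolynomials.
Variables (K : comNzRingType) (k : varkind) (n : nat).
Local Notation P := (pol K k n).
Local Notation PT := (pol (pser K) k n).

Lemma tvarX d l : (tvar K ^+ d : pser K) l = (l == d)%:R.
Proof.
elim: d l => [|d IH] l; first by rewrite expr0 pcoef1.
rewrite exprS pcoefM; case: l => [|l].
  by rewrite big_ord1 /= mul0r.
rewrite !big_ord_recl /= mul0r add0r mul1r subSS subn0 IH big1 ?addr0 ?eqSS //.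
by move=> i _; rewrite mul0r.
Qed.

Lemma tvarX_mul d (c : pser K) l : (tvar K ^+ d * c) l = if (d <= l)%N then c (l - d)%N else 0.
Proof.
rewrite pcoefM; case: leqP => [le|lt].
  rewrite (bigD1 (Ordinal (le : (d < l.+1)%N))) //= tvarX eqxx mul1r big1 ?addr0 // => i ne.
  rewrite tvarX (_ : (nat_of_ord i == d) = false) ?mul0r //.
  by apply: negbTE; apply: contra ne => /eqP e; apply/eqP/val_inj.
apply: big1 => i _; rewrite tvarX (_ : (nat_of_ord i == d) = false) ?mul0r //.
by apply/eqP => e; move: (ltn_ord i); rewrite e ltnS leqNgt lt.
Qed.

Lemma tconstD : {morph @tconst K : x y / x + y}.
Proof. by move=> x y; apply: pserP => m /=; rewrite mulrnDl. Qed.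
Lemma tconst0 : @tconst K 0 = 0.
Proof. by apply: pserP => m /=; rewrite mul0rn. Qed.
Lemma tconstM : {morph @tconst K : x y / x * y}.
Proof.
move=> x y; apply: pserP => m; rewrite pcoefM big_ord_recl /= mulr1n subn0 big1 ?addr0.
  by rewrite mulrnAr.
by move=> i _; rewrite mulr0n mul0r.
Qed.

Definition tshift (j : nat) (p : P) : PT := tvar K ^+ j *: pol_map (@tconst K) p.

Lemma tshiftM i j p q : tshift i p * tshift j q = tshift (i + j) (p * q).
Proof.
rewrite /tshift (pol_mapM tconst0 tconstD tconstM) exprD.
by rewrite -scalerAl -malg_scaleAr scalerA.
Qed.

Lemma tshiftD j : {morph tshift j : p q / p + q}.
Proof. by move=> p q; rewrite /tshift (pol_mapD tconst0 tconstD) scalerDr. Qed.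

Lemma tshift0 j : tshift j 0 = 0.
Proof. by apply: (addrI (tshift j 0)); rewrite -tshiftD !addr0. Qed.

Lemma tshift_sum j I (r : seq I) (F : I -> P) :
  tshift j (\sum_(i <- r) F i) = \sum_(i <- r) tshift j (F i).
Proof. exact: (big_morph _ (tshiftD j) (tshift0 j)). Qed.

Lemma tshift1 : tshift 0 1 = 1.
Proof.
rewrite /tshift expr0 scale1r; apply/malgP => w.
rewrite (pol_mapE tconst0) !mcoeff1; case: eqP => _; last exact: tconst0.
by apply: pserP => -[|m].
Qed.

Lemma tshift_coef j p w (c : pser K) l :
  (c * (tshift j p)@_w) l = if (j <= l)%N then c (l - j)%N * p@_w else 0.
Proof.
rewrite /tshift mcoeffZ (pol_mapE tconst0) mulrCA tvarX_mul; case: leqP => // _.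
rewrite pcoefM big_ord_recr /= subnn mulr1n big1 ?add0r // => i _.
by rewrite subn_eq0 leqNgt ltn_ord mulr0n mulr0.
Qed.

(** In each factor the exponent of t is the degree in z minus one, so in a product it is the degree
    minus the number of factors. *)
Lemma prod_tshift (G : 'I_n -> ser (pser K) k n) (phi : 'I_n -> pser P) (s : seq 'I_n) e :
  (forall i d, G i d = if d is l.+1 then tshift l (phi i l) else 0) ->
  (\prod_(i <- s) G i : ser (pser K) k n) e =
    if (size s <= e)%N then tshift (e - size s) ((\prod_(i <- s) phi i : pser P) (e - size s)%N)
    else 0.
Proof.
move=> hG; elim: s e => [|i s IH] e.
  rewrite !big_nil leq0n subn0; case: e => [|e]; first exact: (esym tshift1).
  exact: (esym (tshift0 _)).
rewrite !big_cons.
transitivity (\sum_(x < e.+1) G i x * (\prod_(i <- s) G i : ser (pser K) k n) (e - x)%N).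
  by [].
rewrite big_ord_recl hG mul0r add0r.
case: e => [|e]; first by rewrite big_ord0.
rewrite ltnS subSS; case: leqP => [le|lt]; last first.
  apply: big1 => x _; rewrite hG /= /bump leq0n add1n subSS IH leqNgt (leq_ltn_trans _ lt) ?mulr0 //.
  exact: leq_subr.
transitivity (\sum_(x < e.+1 | (x < (e - size s).+1)%N)
   tshift (e - size s) (phi i x * (\prod_(i <- s) phi i : pser P) (e - size s - x)%N)).
  rewrite [LHS](bigID (fun x : 'I_e.+1 => (x < (e - size s).+1)%N)) /= [X in _ + X]big1 ?addr0.
    apply: eq_bigr => x; rewrite ltnS => lex; rewrite hG /= /bump leq0n add1n subSS IH.
    have -> : (size s <= e - x)%N by rewrite leq_subRL 1?addnC -?leq_subRL // (leq_trans lex) // leq_subr.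
    by rewrite tshiftM subnAC subnKC.
  move=> x; rewrite -leqNgt => ltx; rewrite hG /= /bump leq0n add1n subSS IH leqNgt.
  have -> : (e - x < size s)%N.
    by rewrite ltn_subLR ?leq_ord // addnC -ltn_subLR.
  by rewrite mulr0.
rewrite -(big_ord_widen e.+1 (fun x => tshift (e - size s)
   (phi i x * (\prod_(i <- s) phi i : pser P) (e - size s - x)%N))) ?ltnS ?leq_subr //.
by rewrite pcoefM tshift_sum.
Qed.

End PserPolynomials.

Lemma tens_mul_primitive_pure (K : comNzRingType) (A : algType K)
    (x u v : (A : lalgType K)) :
  tens_mul (pure 1 x + pure x 1) (pure u v) = pure u (x * v) + pure (x * u) v.
Proof.
apply: etrans (linD (tens_mul_linl _) (pure 1 x) (pure x 1)) _.
by rewrite !tens_mul_pure !mul1r.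
Qed.

Section Lambda.
Variables (K : comAlgType rat) (k : varkind) (n alpha : nat).
Hypothesis alpha_gt1 : (1 < alpha)%N.
Variable Ft : 'I_n -> ser (pser K) k n.
Hypothesis Ft_G : Gt alpha Ft.
Local Notation P := (pol K k n).
Local Notation der := (der K k n alpha).
Local Notation env := (env K k n alpha).
Local Notation piece := (@env_piece K k n alpha).
Local Notation z := (zvar K k).
Let H := DiffOp K k n alpha.
Let hE := DiffOp_hopf K k n alpha.
Lemma tshift_coefE j (p : P) w l :
  (tshift j p)@_w l = (if l == j then p@_w else 0 : K).
Proof.
rewrite /tshift mcoeffZ (pol_mapE (@tconst0 K)) tvarX_mul; case: leqP => [le|lt].
  by rewrite /= subn_eq0 mulrb eqn_leq le andbT.
by rewrite ltn_eqF.
Qed.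

(** Comparing components in t F_t(z) = F(tz) identifies the part of F_t of degree l + 1 with t^l
    times that of F. *)
Lemma Gt_components : exists phi : 'I_n -> pser P,
  [/\ forall i d, Ft i d = if d is l.+1 then tshift l (phi i l) else 0,
      forall i l, homog l.+1 (phi i l),
      forall i, phi i 0%N = z i &
      forall i l, ord_ge alpha (phi i l.+1)].
Proof.
case: Ft_G => -[[Ft0 _] Ft_ord] [F _ hF].
pose phi i : pser P := \pser_(l) F i l.+1; exists phi.
have FtE i d : Ft i d = if d is l.+1 then tshift l (phi i l) else 0.
  case: d => [|d]; first exact: Ft0.
  apply/malgP => w; apply: pserP => j.
  (* Multiplication by t shifts coefficients by one, so the equation is read at t^(j+1) and one
     power of t cancels. *)
  have h1 : (tvar K *: Ft i d.+1)@_w j.+1 = (Ft i d.+1)@_w j.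
    apply: etrans (f_equal (fun c : pser K => c j.+1) (mcoeffZ _ _ _)) _.
    apply: etrans (_ : (tvar K ^+ 1 * (Ft i d.+1)@_w) j.+1 = _); first by rewrite expr1.
    by rewrite tvarX_mul /= subSS subn0.
  have h2 := f_equal (fun p : pol (pser K) k n => p@_w j.+1) (hF i d.+1).
  apply: etrans (esym h1) (etrans h2 _).
  apply: etrans (tshift_coefE d.+1 (F i d.+1) w j.+1) _.
  by rewrite tshift_coefE eqSS.
have Fhomog i d : homog d (F i d) by case: (F i) => f /= /asboolP.
(* Below degree alpha, F_t agrees with z, since o(H_t) >= alpha. *)
have low i d : (d < alpha)%N -> Ft i d = zvar (pser K) k i *+ (d == 1%N).
  move=> lt; have [/(_ d lt) h _] := Ft_ord i; apply/eqP; rewrite eq_sym -subr_eq0.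
  by apply/eqP.
split=> //.
- by move=> i l; exact: Fhomog.
- move=> i; apply/malgP => w; have := low i 1%N alpha_gt1; rewrite FtE mulr1n.
  move=> /(congr1 (fun p : pol (pser K) k n => p@_w 0%N)); rewrite tshift_coefE /= => ->.
  by rewrite !mcoeffU1; case: eqP.
- move=> i l; have [le|lt] := leqP alpha l.+2.
    by move=> m /Fhomog ->.
  have := low i _ lt; rewrite FtE mulr0n => h0.
  suff -> : phi i l.+1 = 0 by exact: (@deg_in0 K k n (fun j => (alpha <= j)%N)).
  apply/malgP => w; have /(congr1 (fun p : pol (pser K) k n => p@_w l.+1)) := h0.
  by rewrite tshift_coefE eqxx mcoeff0 => ->; rewrite mcoeff0.
Qed.

Let alpha_gt0 : (0 < alpha)%N. Proof. exact: ltnW. Qed.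

Lemma act_ord_ge (x : env) b p : ord_ge b p -> ord_ge b (act x p).
Proof.
move=> hp; move: x; apply: (@env_word_ind K k n alpha) => [|c x y hx hy|s].
- by rewrite (lin0 (act_linear p)); exact: (@deg_in0 K k n (fun j => (b <= j)%N)).
- rewrite act_linear.
  exact: (@deg_in_lin K k n (fun j => (b <= j)%N) c _ _ hx hy).
elim: s => [|q s IH]; first by rewrite word_nil act1.
by rewrite word_cons actM act_der; exact: der_ord_ge.
Qed.

Lemma der_raise (d : der) p : ord_ge 1 p -> ord_ge alpha (d p).
Proof.
move=> hp.
apply: (@derivation_degree K k n d (fun j => (alpha <= j)%N) (der_linear d) (derM d)
  (@der_zvar _ _ _ _ d) (fun j => (1 <= j)%N) (fun j => (alpha <= j)%N) p hp).
move=> e r j lebe lear ej; rewrite -ltnS ej -addn1 leq_add //.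
Qed.

Lemma zvar_ord1 (i : 'I_n) : ord_ge 1 (z i).
Proof. by move=> m /deg_in_zvar ->. Qed.

Definition der_ser (D : nat -> der) : pser env :=
  \pser_(m) if m is j.+1 then env_der (D j) else 0.

Definition der_trunc (D : nat -> der) (N : nat) : pser env :=
  \pser_(m) if m is j.+1 then (if (j < N)%N then env_der (D j) else 0) else 0.

(** The coefficient of t^(m+1) involves D m only additively, and otherwise only D l with l < m. This
    triangularity lets the derivations be constructed, and later proved homogeneous, one index at a
    time. *)
Lemma pexp_der_serS D m :
  pexp (der_ser D) m.+1 = env_der (D m) + pexp (der_trunc D m) m.+1.
Proof.
have agree i : (i <= m)%N -> der_ser D i = der_trunc D m i by case: i => [|j] //= ->.
have h := pexp_coefS (erefl : der_ser D 0%N = 0) (erefl : der_trunc D m 0%N = 0) agree.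
apply: etrans h _; apply: (f_equal (fun x => x + _)).
by rewrite /= ltnn subr0.
Qed.

(** In each contributing term the outermost factor is a derivation applied to a polynomial without
    constant term. Hence these values are admissible corrections to the values of a derivation. *)
Lemma pexp_trunc_ord D N m i : ord_ge alpha (act (pexp (der_trunc D N) m.+1) (z i)).
Proof.
have ord0 : ord_ge alpha (0 : P) := @deg_in0 K k n (fun j => (alpha <= j)%N).
rewrite pexpE /= (lin_sum (act_linear (z i))).
apply: (@deg_in_sum K k n (fun j => (alpha <= j)%N)) => l _.
rewrite (linZ (act_linear (z i))); apply: (@deg_inZ K k n (fun j => (alpha <= j)%N)).
case: l => -[|l] lt; first by rewrite expr0 pcoef1 (lin0 (act_linear (z i))).
rewrite -[nat_of_ord _]/(l.+1) exprS pcoefM (lin_sum (act_linear (z i))).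
apply: (@deg_in_sum K k n (fun j => (alpha <= j)%N)) => -[[|j] lej] _ /=.
  by rewrite mul0r (lin0 (act_linear (z i))).
case: ifP => _; last by rewrite mul0r (lin0 (act_linear (z i))).
by rewrite actM act_der; apply: der_raise; apply: act_ord_ge; exact: zvar_ord1.
Qed.

Lemma exists_ders (phi : 'I_n -> pser P) : (forall i l, ord_ge alpha (phi i l.+1)) ->
  exists D, forall m i, act (pexp (der_ser D) m.+1) (z i) = phi i m.+1.
Proof.
move=> hphi.
have step (x : (nat -> der) * nat) : exists d : der,
    forall i, d (z i) = phi i x.2.+1 - act (pexp (der_trunc x.1 x.2) x.2.+1) (z i).
  apply: der_exists => i; rewrite -scaleN1r addrC.
  exact: (@deg_in_lin K k n (fun j => (alpha <= j)%N) _ _ _ (@pexp_trunc_ord _ _ _ _) (hphi _ _)).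
have [next nextP] := choice step.
have [d0 _] : exists d : der, forall i, d (z i) = 0.
  by apply: der_exists => i; exact: (@deg_in0 K k n (fun j => (alpha <= j)%N)).
(* Course-of-values recursion: A j carries the first j derivations, with d0 as a filler at the
   indices not yet reached. *)
pose A := fix A (j : nat) : nat -> der :=
  if j is j'.+1 then fun l => if l == j' then next (A j', j') else A j' l else fun=> d0.
pose D l := next (A l, l).
have AD j l : (l < j)%N -> A j l = D l.
  elim: j => // j IH; rewrite ltnS leq_eqVlt /= => /orP[/eqP ->|lt]; first by rewrite eqxx.
  by rewrite ltn_eqF // IH.
exists D => m i.
have -> : pexp (der_ser D) m.+1 = env_der (D m) + pexp (der_trunc D m) m.+1.
  exact: pexp_der_serS.
have -> : der_trunc D m = der_trunc (A m) m.
  by apply: pserP => -[|j]; rewrite /=; [|case: ifP => // lt; rewrite AD].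
rewrite (linD (act_linear (z i))) act_der (nextP (A m, m)).
by rewrite subrK.
Qed.

Lemma act_mul_bilin p q : bilin (fun u v : env => act u p * act v q).
Proof.
split=> [w|w].
  exact: (@comp_linear K env P P (fun y => y * act w q) (fun u => act u p)
    (@mulr_linear K P _) (act_linear p)).
exact: (@comp_linear K env P P (fun y => act w p * y) (fun u => act u q)
  (@mull_linear K P _) (act_linear q)).
Qed.

(** For one derivation this is the Leibniz rule, and both sides are compatible with products of
    derivations. *)
Lemma act_leibniz (x : env) p q :
  act x (p * q) = tlift (fun u v : env => act u p * act v q) (@hcomul K H x).
Proof.
have hb := act_mul_bilin p q.
have t_lin := tlift_linear hb.
have D_lin : linear (@hcomul K H) := prim_comul_linear hE.
move: x; apply: (env_ext (act_linear (p * q)) (comp_linear t_lin D_lin)) => s.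
elim: s => [|d s IH].
  by rewrite big_nil (prim_comul_one hE) (tlift_pure hb) !act1.
rewrite big_cons actM act_der IH (prim_comul_mul hE).
rewrite (prim_comul_prim hE); last by exists d.
move: (@hcomul K H _) => t; apply: esym; move: t.
apply: (@tens_ext K env env P).
- exact: (@comp_linear K (tens env env) (tens env env) P _ _ t_lin (tens_mul_linr _)).
- exact: (@comp_linear K (tens env env) P P _ _ (der_linear d) t_lin).
move=> u v; rewrite (tlift_pure hb) derM.
rewrite tens_mul_primitive_pure.
apply: etrans (linD t_lin _ _) _.
apply: etrans (f_equal2 +%R (tlift_pure hb u (env_der d * v))
  (tlift_pure hb (env_der d * u) v)) _.
have e y r : act (env_der d * y) r = d (act y r) by rewrite actM act_der.
apply: etrans (addrC _ _) _.
exact: (f_equal2 (fun y y' : P => y * act v q + act u p * y') (e u p) (e v q)).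
Qed.

Section Expand.
Variable D : nat -> der.
Let ex := pexp (der_ser D).
Let Phi (p : P) : pser P := \pser_(m) act (ex m) p.

Let Phi1 : Phi 1 = 1.
Proof.
apply: pserP => -[|m].
  exact: etrans (f_equal (fun y : env => act y 1) (pexp_coef0 _)) (act1 _ _).
have -> : Phi 1 m.+1 = \sum_(l < m.+2) act (invfact K l *: (der_ser D ^+ l : pser env) m.+1) 1.
  exact: (lin_sum (act_linear 1)).
apply: big1 => -[[|l] lt] _; rewrite (linZ (act_linear 1)).
  by rewrite expr0 pcoef1 (lin0 (act_linear 1)) scaler0.
rewrite -[nat_of_ord _]/(l.+1) exprSr pcoefM (lin_sum (act_linear 1)) big1 ?scaler0 // => i _.
rewrite actM /=; case: (m.+1 - i)%N => [|j].
  by rewrite (lin0 (act_linear 1)) (lin0 (act_linearr _)).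
by rewrite act_der (derivation1 (derM (D j))) (lin0 (act_linearr _)).
Qed.

Let PhiM : {morph Phi : p q / p * q}.
Proof.
move=> p q; apply: pserP => m; apply: etrans (act_leibniz (ex m) p q) _.
have hb := act_mul_bilin p q.
have a_prim j : exists d, der_ser D j.+1 = env_der d by exists (D j).
have e := pexp_comul hE (erefl : der_ser D 0%N = 0) a_prim m.
exact: etrans (f_equal (tlift _) e) (tlift_sum hb _ _ _).
Qed.

(** The exponential is grouplike, so by [act_leibniz] it acts as an algebra homomorphism from
    polynomials to power series, determined by its values on the variables. *)
Lemma act_pexp_mono (phi : 'I_n -> pser P) :
  (forall i, phi i 0%N = z i) ->
  (forall m i, act (ex m.+1) (z i) = phi i m.+1) ->
  forall w m, act (ex m) << w >> = (\prod_(i <- mono_letters w) phi i : pser P) m.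
Proof.
move=> phi0 phiS w m; rewrite -[LHS]/(Phi << w >> m) monoE.
have PhiZ i : Phi (z i) = phi i.
  apply: pserP => -[|j]; last exact: phiS.
  by apply: etrans (f_equal (fun y : env => act y (z i)) (pexp_coef0 _)) _; rewrite act1 phi0.
congr (pcoef _ m); elim: (mono_letters w) => [|i s IH]; first by rewrite !big_nil.
by rewrite !big_cons PhiM PhiZ IH.
Qed.

End Expand.

End Lambda.

(** * Existence and homogeneity of the lambda_m *)

Section HomogComponents.
Variables (K : comNzRingType) (k : varkind) (n : nat).
Local Notation P := (pol K k n).

Lemma hcomp_coef e (p : P) w : (hcomp e p)@_w = if mono_deg w == e then p@_w else 0.
Proof.
rewrite /hcomp (raddf_sum (mcoeff w)) /=.
rewrite (eq_bigr (fun m => p@_m *+ (m == w))) => [|m _]; last exact: mcoeffU.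
rewrite big_mkcond /=; have [wp|nwp] := boolP (w \in msupp p).
  rewrite (bigD1_seq w) ?fset_uniq //= eqxx mulr1n big1 ?addr0 // => m ne.
  by rewrite (negbTE ne) mulr0n; case: ifP.
rewrite (mcoeff_outdom nwp) if_same big_seq big1 // => m mp.
by case: (eqVneq m w) mp nwp => [->|_] // => [->//|]; case: ifP.
Qed.

Lemma prod_homog (phi : 'I_n -> pser P) (s : seq 'I_n) m :
  (forall i l, homog l.+1 (phi i l)) ->
  homog (m + size s) ((\prod_(i <- s) phi i : pser P) m).
Proof.
move=> h; elim: s m => [|i s IH] m.
  rewrite big_nil addn0; case: m => [|m]; first exact: homog1.
  exact: homog0.
rewrite big_cons pcoefM; apply: homog_sum => x _.
have -> : (m + size (i :: s) = x.+1 + (m - x + size s))%N.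
  by rewrite addSn addnA subnKC ?leq_ord // addnS.
exact: homogM.
Qed.

Lemma ser_coef_sum (R : nzRingType) I (r : seq I) (F : I -> ser R k n) e :
  (\sum_(i <- r) F i : ser R k n) e = \sum_(i <- r) F i e.
Proof. by elim/big_rec2: _ => // i x y _ <-. Qed.

Lemma homogZ d c (p : P) : homog d p -> homog d (c *: p).
Proof. by move=> hp; rewrite -[_ *: _]addr0; apply: homogL hp (homog0 _). Qed.

Lemma homogB d (p q : P) : homog d p -> homog d q -> homog d (p - q).
Proof. by move=> hp hq; rewrite -scaleN1r addrC; apply: homogL. Qed.

End HomogComponents.

Section LambdaExists.
Variables (K : comAlgType rat) (k : varkind) (n alpha : nat).
Hypothesis alpha_gt1 : (1 < alpha)%N.
Variable Ft : 'I_n -> ser (pser K) k n.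
Hypothesis Ft_G : Gt alpha Ft.
Local Notation P := (pol K k n).
Local Notation der := (der K k n alpha).
Local Notation env := (env K k n alpha).
Local Notation piece := (@env_piece K k n alpha).
Local Notation z := (zvar K k).

Lemma tcoefE j (u : ser (pser K) k n) d w : (tcoef j u d)@_w = (u d)@_w j.
Proof. by rewrite /tcoef pol_mapE. Qed.

(** A monomial v of degree d reaches degree e only through the coefficient e - d of its product of
    phi's, which comes with t^(e-d); hence the shifted coefficient of u. *)
Lemma subst_coef (phi : 'I_n -> pser P) (u : ser (pser K) k n) e w j :
  (forall i d, Ft i d = if d is l.+1 then tshift l (phi i l) else 0) ->
  (subst Ft u e)@_w j = \sum_(d < e.+1) \sum_(v <- msupp (u d))
    (if (e - d <= j)%N then (u d)@_v (j - (e - d))%N *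
       ((\prod_(i <- mono_letters v) phi i : pser P) (e - d)%N)@_w else 0).
Proof.
move=> hF.
transitivity ((\sum_(d < e.+1) (peval Ft (u d) : ser (pser K) k n) e)@_w j); first by [].
rewrite (raddf_sum (mcoeff w)) pcoef_sum; apply: eq_bigr => d _.
rewrite /peval ser_coef_sum (raddf_sum (mcoeff w)) pcoef_sum big_seq [RHS]big_seq.
apply: eq_bigr => v hv.
have dv : mono_deg v = d by case: (u) d hv => f /= /asboolP hf d; exact: hf.
transitivity (((u d)@_v *: (\prod_(i <- mono_letters v) Ft i : ser (pser K) k n) e)@_w j).
  by [].
rewrite mcoeffZ (prod_tshift _ _ hF) size_mono_letters dv.
have -> : (d <= e)%N by rewrite -ltnS.
exact: tshift_coef.
Qed.

Lemma act_ser_coef (x : env) (f : nat -> P) e w :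
  (act_ser x f e)@_w = \sum_(d < e.+1) (if mono_deg w == e then (act x (f d))@_w else 0).
Proof.
rewrite /act_ser (raddf_sum (mcoeff w)) /=; apply: eq_bigr => d _.
exact: hcomp_coef.
Qed.

Lemma act_tcoef (x : env) j (u : ser (pser K) k n) d :
  act x (tcoef j u d) = \sum_(v <- msupp (u d)) (u d)@_v j *: act x << v >>.
Proof.
rewrite /tcoef /pol_map (lin_sum (act_linearr x)); apply: eq_bigr => v _.
by rewrite malgUZ (linZ (act_linearr x)).
Qed.

Lemma lambda_exists : exists lam, @is_lambda K k n alpha Ft lam.
Proof.
have [phi [hF phiH phi0 phiS]] := Gt_components alpha_gt1 Ft_G.
have [D hD] := exists_ders alpha_gt1 phiS.
pose ex := pexp (der_ser D).
have hmono := act_pexp_mono phi0 hD.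
exists (fun m => (-1) ^+ m *: ex m); split.
  exists D; apply: pserP => m.
  by rewrite /= scalerA -expr2 sqrr_sign scale1r.
move=> u j e; apply/malgP => w; rewrite tcoefE (subst_coef _ _ _ _ hF).
rewrite (raddf_sum (mcoeff w)) /=.
transitivity (\sum_(m < j.+1) \sum_(d < e.+1) \sum_(v <- msupp (u d))
    (if mono_deg w == e then (u d)@_v (j - m)%N *
       ((\prod_(i <- mono_letters v) phi i : pser P) m)@_w else 0)).
  rewrite exchange_big; apply: eq_bigr => d _.
  rewrite exchange_big big_seq [RHS]big_seq; apply: eq_bigr => v hv.
  have dv : mono_deg v = d by case: (u) d hv => f /= /asboolP hf d; exact: hf.
  have led : (d <= e)%N by rewrite -ltnS.
  (* The coefficient m of the product has degree m + d in z, so on the right only m = e - d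
     survives. *)
  have hPi m : mono_deg w != (m + d)%N ->
      ((\prod_(i <- mono_letters v) phi i : pser P) m)@_w = 0.
    rewrite -dv -(size_mono_letters v).
    by have /homogP := @prod_homog K k n phi (mono_letters v) m phiH; exact.
  have [we|ne] := eqVneq (mono_deg w) e; last first.
    rewrite [RHS]big1 //; case: ifP => // _.
    by rewrite hPi ?mulr0 // subnK.
  case: leqP => [le|lt].
    rewrite (bigD1 (Ordinal (le : (e - d < j.+1)%N))) //= [X in _ + X]big1 ?addr0 // => m nem.
    rewrite hPi ?mulr0 // we; apply: contra nem => /eqP em.
    by apply/eqP/val_inj; rewrite /= [X in (X - _)%N]em addnK.
  rewrite [RHS]big1 // => m _; rewrite hPi ?mulr0 // we.
  apply/eqP => em; move: lt; rewrite [X in (X - _)%N]em addnK => /(leq_trans (ltn_ord m)).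
  by rewrite ltnn.
apply: eq_bigr => m _; rewrite mcoeffZ act_ser_coef mulr_sumr; apply: eq_bigr => d _.
case: ifP => _; last by rewrite mulr0; apply: big1.
have -> : act ((-1) ^+ m *: ex m) (tcoef (j - m) u d) =
    (-1) ^+ m *: act (ex m) (tcoef (j - m) u d).
  exact: (linZ (act_linear _)).
rewrite mcoeffZ mulrA -expr2 sqrr_sign mul1r act_tcoef (raddf_sum (mcoeff w)) /=.
by apply: eq_bigr => v _; rewrite mcoeffZ hmono.
Qed.

Lemma pexp_piece (a : pser env) : (forall m, piece m (a m)) ->
  forall m, piece m (pexp a m).
Proof.
move=> ha m; rewrite pexpE /=; apply: env_piece_sum => l _; apply: env_pieceZ.
move: (nat_of_ord l) => {}l; elim: l m => [|l IH] m.
  rewrite expr0 pcoef1; case: m => [|m]; [exact: env_piece_one|exact: env_piece_zero].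
rewrite exprS pcoefM; apply: env_piece_sum => i _.
by rewrite -[m in piece m](subnKC (leq_ord i)); exact: (env_pieceM (ha i) (IH _)).
Qed.

(** The defining identity is tested on u = z_i. As u is free of t, the coefficient of t^j keeps only
    lambda_j on one side; the other side is the coefficient of t^j in F_t, which is homogeneous of
    degree j + 1. *)
Lemma act_lambda_homog lam : @is_lambda K k n alpha Ft lam ->
  forall j i, homog j.+1 (act (lam j) (z i)).
Proof.
have [phi [hF _ _ _]] := Gt_components alpha_gt1 Ft_G.
case=> _ hlam j i; apply/homogP => w ne.
(* The component of degree 1 of u enters [act_ser] in degree e only if e >= 1, so constant terms are
   excluded separately. *)
have [w0|wn0] := eqVneq (mono_deg w) 0%N.
  apply: mcoeff_outdom; apply/negP.
  by move=> /(@act_ord_ge K k n alpha alpha_gt1 (lam j) 1 _ (@zvar_ord1 K k n i)); rewrite w0.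
pose u := ser_zvar (pser K) k i; pose e := mono_deg w.
have tc l d : tcoef l u d = z i *+ ((d == 1%N) && (l == 0%N)).
  apply/malgP => v; rewrite tcoefE mcoeffMn /= mcoeffMn !mcoeffU1.
  by case: (d == 1%N); case: (_ == v); case: l.
have E : (subst Ft u e)@_w j = (-1) ^+ j * (act_ser (lam j) (tcoef 0 u) e)@_w.
  rewrite -tcoefE hlam (raddf_sum (mcoeff w)) big_ord_recr subnn big1.
    by rewrite Monoid.mul1m [LHS]mcoeffZ.
  move=> m _; rewrite [LHS]mcoeffZ act_ser_coef big1 ?mulr0 // => d _.
  rewrite tc subn_eq0 leqNgt /= ltn_ord andbF mulr0n (lin0 (act_linearr _)) mcoeff0.
  by case: ifP.
apply: (@sign_scale_inj K K^o j).
rewrite scaler0 -[LHS]/((-1) ^+ j * (act (lam j) (z i))@_w).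
apply: (@etrans _ _ ((subst Ft u e)@_w j)).
  rewrite E act_ser_coef; congr (_ * _).
  have e1 : (1 < e.+1)%N by rewrite ltnS lt0n.
  rewrite (bigD1 (Ordinal e1)) //= eqxx tc /= mulr1n big1 ?addr0 // => d ne1.
  rewrite tc; have -> : (d == 1%N :> nat) = false by apply: negbTE.
  by rewrite mulr0n (lin0 (act_linearr _)) mcoeff0.
rewrite (subst_coef _ _ _ _ hF) big1 // => d _; apply: big1 => v _.
case: ifP => // le; rewrite (_ : (u d)@_v _ = 0) ?mul0r //.
have [d1|nd] := eqVneq (d : nat) 1%N; last first.
  by rewrite /= mcoeffMn (negbTE nd) mulr0n.
have : (j - (e - d) != 0)%N.
  rewrite d1 subn1 in le *; rewrite subn_eq0 -ltnNge ltn_neqAle le andbT.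
  by apply: contra ne => /eqP <-; rewrite prednK // lt0n.
by rewrite /= mcoeffMn mcoeffU1; case: (j - _)%N => // l _; case: (_ == v); case: (_ == _).
Qed.

(** The values of D j on the variables are those of lambda_{j+1}, up to sign, minus terms in earlier
    derivations, so strong induction gives its degree. The argument applies to every sequence
    meeting [is_lambda], in particular to the selected one. *)
Lemma lambda_piece lam : @is_lambda K k n alpha Ft lam -> forall m, piece m (lam m).
Proof.
move=> hl; have hact := act_lambda_homog hl; case: hl => [[D hD] _].
have lamE m : (-1) ^+ m *: lam m = pexp (der_ser D) m.
  exact: (f_equal (fun f : pser env => f m) hD).
have hder j : homog_der j.+1 (D j).
  elim/ltn_ind: j => j IH; apply: homog_derP => i.
  have -> : D j (z i) = (-1) ^+ j.+1 *: act (lam j.+1) (z i) -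
      act (pexp (der_trunc D j) j.+1) (z i).
    have sum_eq : act (pexp (der_ser D) j.+1) (z i) =
        D j (z i) + act (pexp (der_trunc D j) j.+1) (z i).
      apply: etrans (f_equal (fun x => act x (z i)) (pexp_der_serS D j)) _.
      apply: etrans (linD (act_linear (z i)) _ _) _.
      exact: (f_equal (fun p => p + _) (act_der _ _)).
    have lam_eq : act (pexp (der_ser D) j.+1) (z i) =
        (-1) ^+ j.+1 *: act (lam j.+1) (z i).
      apply: etrans (f_equal (fun x => act x (z i)) (esym (lamE j.+1))) _.
      exact: (linZ (act_linear (z i)) _ _).
    exact: (canRL (addrK _) (etrans (esym sum_eq) lam_eq)).
  apply: homogB; first exact: homogZ (hact _ _).
  rewrite -[j.+2]addn1; apply: act_homog; last exact: deg_in_zvar.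
  apply: pexp_piece => -[|l] /=; first exact: env_piece_zero.
  case: ifP => lt; last exact: env_piece_zero.
  by apply: env_piece_der; exact: IH.
move=> m; have -> : lam m = (-1) ^+ m *: pexp (der_ser D) m.
  by rewrite -lamE scalerA -expr2 sqrr_sign scale1r.
apply: env_pieceZ; apply: pexp_piece => -[|l] /=; first exact: env_piece_zero.
exact: env_piece_der.
Qed.

End LambdaExists.

(** * The specialization map and its dual *)

Lemma specialization_piece (K : comAlgType rat) (k : varkind) (n a : nat)
    (lam : nat -> env K k n a) :
  (forall m, env_piece m (lam m)) ->
  forall m x, nsym_piece m x -> env_piece m (spec lam x).
Proof.
move=> hl m; pose H := @spec K (env K k n a) lam.
have s_lin : linear H := free_ev_linear _.
move=> x; apply: (@nsym_piece_ind K (env K k n a) H (@env_piece K k n a m) m x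
  s_lin (env_piece_zero _ _ _ _ _)).
  by move=> c u v; exact: env_piece_lin.
move=> [s] <- {m}; elim: s => [|i s IH].
  rewrite nsym_word_nil weight_nil.
  have -> : H 1 = 1 := free_ev1 _.
  exact: env_piece_one.
rewrite weight_cons nsym_word_cons.
have -> : H (Lam K i.+1 * << FMonom s >>) = lam i.+1 * H << FMonom s >>.
  apply: etrans (free_evM _ _ _) _.
  exact: (f_equal (fun t => t * H << FMonom s >>) (free_ev_letter _ _)).
exact: env_pieceM (hl _) IH.
Qed.

Theorem corollary4p2 (K : comAlgType rat) (k : varkind) (n alpha : nat)
    (Ft : 'I_n -> ser (pser K) k n) :
  (0 < n)%N -> (2 <= alpha)%N -> Gt alpha Ft ->
  @gr_hopf_morphism K (gdual (DiffOp K k n alpha)) (QSym K)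
    (gdual_map (specialization alpha Ft)).
Proof.
move=> _ a_gt1 Ft_G.
(* The sequence [lambda] is selected by [epsilon] and may differ from the one constructed, so only
   [is_lambda] is used from here on. *)
have hlam : is_lambda Ft (lambda alpha Ft).
  exact: (epsilon_spec (inhabits (fun _ => 0)) _ (lambda_exists a_gt1 Ft_G)).
have [D lamE] := lambda_exp hlam.
have hH := DiffOp_hopf K k n alpha.
have a_prim m : exists d, der_ser D m.+1 = env_der d by exists (D m).
have a0 : der_ser D 0%N = 0 by [].
have -> : specialization alpha Ft = spec (lambda alpha Ft).
  apply: funext => x; rewrite /specialization /spec /free_ev /malg_lift.
  apply: eq_bigr => w _; apply: (f_equal (fun t => x@_w *: t)).
  exact: eq_bigr.
rewrite /QSym.
exact: (@gdual_map_morphism K (DiffOp K k n alpha) (NSym K)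
  (spec (lambda alpha Ft)) (DiffOp_graded K k n alpha) (NSym_graded K)
  (DiffOp_comul_dualizable a_gt1) (@QSym_pairing_inj K)
  (free_ev_linear _) (free_evM _) (free_ev1 _)
  (spec_comul hH a0 a_prim lamE) (spec_counit hH a0 a_prim lamE)
  (spec_antipode hH a0 a_prim lamE)
  (specialization_piece (lambda_piece a_gt1 Ft_G hlam))).
Qed.
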